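(* Let $n\ge3$, $\mu_1,\mu_2,\beta>0$, $p=2q+1$ with $\frac{n}{n-2}<p<\frac{n+2}{n-2}$. (1) If $n\ge4$, system (S) has no positive semi-singular solution at $0$. (2) Suppose $n\ge4$, or $n=3$ and (S) has no positive semi-singular solution at $0$. Then for every positive solution $(u,v)$ of (S) there exist constants $0<C_1\le C_2$ such that $$C_1|x|^{-\frac{2}{p-1}}\le u(x),\,v(x)\le C_2|x|^{-\frac{2}{p-1}}\quad\text{for } x\in B_1\setminus\{0\}.$$
   Context: System (S): $-\Delta u=\mu_1u^{2q+1}+\beta u^qv^{q+1}$, $-\Delta v=\mu_2v^{2q+1}+\beta v^qu^{q+1}$ in $\mathbb{R}^n\setminus\{0\}$; a positive solution is a pair $u,v\in C^2(\mathbb{R}^n\setminus\{0\})$, $u,v>0$, solving (S). For positive solutions, the limits $\lim_{|x|\to0}u(x)$ and $\lim_{|x|\to0}v(x)$ exist in $(0,+\infty]$. A positive solution is semi-singular at $0$ if one of these limits is finite and the other equals $+\infty$. $B_1=\{|x|<1\}$. *)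

(* Defs.v *)
(* classical reals. Points of R^n are represented as
   x : nat -> R with x i = 0 for all i >= n (predicate [pt n x]). *)
From Stdlib Require Import Reals.
Open Scope R_scope.

Fixpoint rsum (n : nat) (f : nat -> R) : R :=
  match n with O => 0 | S k => rsum k f + f k end.

Definition pt (n : nat) (x : nat -> R) : Prop := forall i, (n <= i)%nat -> x i = 0.

Definition nrm (n : nat) (x : nat -> R) : R := sqrt (rsum n (fun i => x i ^ 2)).

Definition vsub (x y : nat -> R) : nat -> R := fun i => x i - y i.

Definition upd (x : nat -> R) (i : nat) (t : R) : nat -> R :=
  fun j => if Nat.eqb j i then x j + t else x j.

Definition has_partial (f : (nat -> R) -> R) (i : nat) (x : nat -> R) (l : R) : Prop :=
  derivable_pt_lim (fun t => f (upd x i t)) 0 l.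

Definition cont_at (n : nat) (g : (nat -> R) -> R) (x : nat -> R) : Prop :=
  forall eps, 0 < eps -> exists delta, 0 < delta /\
    forall y, pt n y -> nrm n (vsub y x) < delta -> Rabs (g y - g x) < eps.

Definition C2_punct_with (n : nat) (f : (nat -> R) -> R)
  (D1 : nat -> (nat -> R) -> R) (D2 : nat -> nat -> (nat -> R) -> R) : Prop :=
  forall x, pt n x -> 0 < nrm n x ->
    cont_at n f x /\
    forall i, (i < n)%nat ->
      has_partial f i x (D1 i x) /\ cont_at n (D1 i) x /\
      forall j, (j < n)%nat ->
        has_partial (D1 i) j x (D2 i j x) /\ cont_at n (D2 i j) x.

Definition lap (n : nat) (D2 : nat -> nat -> (nat -> R) -> R) (x : nat -> R) : R :=
  rsum n (fun i => D2 i i x).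

Definition pos_sol (n : nat) (mu1 mu2 beta q : R) (u v : (nat -> R) -> R) : Prop :=
  exists D1u D2u D1v D2v,
    C2_punct_with n u D1u D2u /\ C2_punct_with n v D1v D2v /\
    forall x, pt n x -> 0 < nrm n x ->
      0 < u x /\ 0 < v x /\
      - lap n D2u x = mu1 * Rpower (u x) (2 * q + 1)
                      + beta * Rpower (u x) q * Rpower (v x) (q + 1) /\
      - lap n D2v x = mu2 * Rpower (v x) (2 * q + 1)
                      + beta * Rpower (v x) q * Rpower (u x) (q + 1).

Definition lim0_fin (n : nat) (f : (nat -> R) -> R) (L : R) : Prop :=
  forall eps, 0 < eps -> exists delta, 0 < delta /\
    forall x, pt n x -> 0 < nrm n x < delta -> Rabs (f x - L) < eps.

Definition lim0_inf (n : nat) (f : (nat -> R) -> R) : Prop :=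
  forall M, exists delta, 0 < delta /\
    forall x, pt n x -> 0 < nrm n x < delta -> M < f x.

Definition semi_singular (n : nat) (u v : (nat -> R) -> R) : Prop :=
  ((exists L, lim0_fin n u L) /\ lim0_inf n v) \/
  (lim0_inf n u /\ (exists L, lim0_fin n v L)).

(* Main.v *)
(* Both statements reduce to a system of ordinary differential equations, because every positive solution
   is radially symmetric and radially nonincreasing about the origin.

   Symmetry (moving spheres).  For a centre x0 <> 0 and 0 < c < |x0|^2, compare u with its Kelvin transform
   in the sphere |x - x0|^2 = c.  The exponent being subcritical, the Kelvin transforms are strict
   supersolutions inside the sphere, so the comparison persists from small c up to |x0|^2: since the system
   is cooperative, the differences are strictly superharmonic and only comparison with the fundamental
   solution is needed, at the two punctures (the centre and the preimage of the origin) and, as in Hopf's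
   lemma, at the boundary.  The limit of large spheres gives th . grad u(x) >= 0 whenever x . th <= 0.

   Dynamics.  In t = ln r, the pair X = r^(1/q) u, Y = r^(1/q) v solves an autonomous Emden-Fowler system
   whose energy E satisfies E' = a (X'^2 + Y'^2) with a > 0.  Monotonicity of u gives
   -u' >= c r u^p, hence X is bounded, and -r u' <= C u, hence X' = O(X).  Bounded orbits have E <= 0 at
   +oo, so E < 0 and (X, Y) stays away from 0 as t -> -oo.  If X is small while Y is not, then for q < 1
   (n >= 4) the coupling term X^q Y^(q+1) dominates and contradicts X' = O(X), whereas for q > 1 (n = 3)
   the linear part forces X = O(exp (t/q)), that is, u is bounded and the solution is semi-singular. *)

Require Import Defs.
From Stdlib Require Import Reals Lra Lia Arith FunctionalExtensionality Classical ClassicalEpsilon.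
From Coquelicot Require Import Coquelicot.
Open Scope R_scope.

(** The sphere comparison has to run without any information on the singularity. Keeping c < |x0|^2
    leaves the origin outside the sphere, so u itself is smooth inside and only the Kelvin transform
    is punctured, at the centre and at the preimage of the origin; there it is positive and
    superharmonic, and a lower bound is all that the comparison asks for. The two ends of the range
    of p enter separately. The lower end gives 1 < q (n - 2), which makes the linear coefficient of
    the Emden-Fowler system positive; the upper end gives q (n - 2) < 2, which is both the
    subcriticality behind the moving spheres and the sign of a. Together they force q < 1 for n >= 4
    and q > 1 for n = 3, hence the different role of semi-singular solutions in dimension 3. That E
    <= 0 for bounded orbits comes from the quantity X X' + Y Y': where the velocities are small, its
    derivative is at most about -(2q + 2) E, so a positive energy would drive it to -oo. *)

(** * Finite sums *)

Lemma rsum_ext (n : nat) (f g : nat -> R) :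
  (forall i, (i < n)%nat -> f i = g i) -> rsum n f = rsum n g.
Proof.
  induction n as [|n IH]; intros H; simpl; [reflexivity|].
  rewrite IH, (H n) by (intros; try apply H; lia); reflexivity.
Qed.

Lemma rsum_plus (n : nat) (f g : nat -> R) :
  rsum n (fun i => f i + g i) = rsum n f + rsum n g.
Proof. induction n as [|n IH]; simpl; [lra|rewrite IH; lra]. Qed.

Lemma rsum_scal (n : nat) (c : R) (f : nat -> R) :
  rsum n (fun i => c * f i) = c * rsum n f.
Proof. induction n as [|n IH]; simpl; [lra|rewrite IH; lra]. Qed.

Lemma rsum_const (n : nat) (c : R) : rsum n (fun _ => c) = INR n * c.
Proof. induction n as [|n IH]; [simpl; lra|]. rewrite S_INR; simpl; rewrite IH; lra. Qed.

Lemma rsum_swap (n k : nat) (f : nat -> nat -> R) :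
  rsum n (fun i => rsum k (fun j => f i j)) = rsum k (fun j => rsum n (fun i => f i j)).
Proof.
  induction n as [|n IH]; simpl.
  - rewrite rsum_const; lra.
  - rewrite IH, <- rsum_plus; reflexivity.
Qed.

Definition kron (i j : nat) : R := if Nat.eqb i j then 1 else 0.

Lemma kron_sym (i j : nat) : kron i j = kron j i.
Proof. unfold kron; rewrite Nat.eqb_sym; reflexivity. Qed.

Lemma rsum_kron (n l : nat) (f : nat -> R) :
  (l < n)%nat -> rsum n (fun i => kron i l * f i) = f l.
Proof.
  assert (Hz : forall k, (k <= l)%nat -> rsum k (fun i => kron i l * f i) = 0).
  { induction k as [|k IHk]; intros Hk; simpl; [reflexivity|].
    rewrite IHk by lia; unfold kron; destruct (Nat.eqb_spec k l); [lia|lra]. }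
  induction n as [|n IH]; intros H; [lia|]; simpl.
  destruct (Nat.eq_dec l n) as [->|Hne].
  - rewrite Hz by lia; unfold kron; rewrite Nat.eqb_refl; lra.
  - rewrite IH by lia; unfold kron; destruct (Nat.eqb_spec n l); [lia|lra].
Qed.

Lemma rsum_le (n : nat) (f g : nat -> R) :
  (forall i, (i < n)%nat -> f i <= g i) -> rsum n f <= rsum n g.
Proof.
  induction n as [|n IH]; intros H; simpl; [lra|].
  apply Rplus_le_compat; [apply IH; intros; apply H; lia|apply H; lia].
Qed.

Lemma rsum_nonneg (n : nat) (f : nat -> R) :
  (forall i, (i < n)%nat -> 0 <= f i) -> 0 <= rsum n f.
Proof.
  intros H; replace 0 with (rsum n (fun _ => 0)) by (rewrite rsum_const; lra).
  apply rsum_le, H.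
Qed.

Lemma rsum_ge_term (n l : nat) (f : nat -> R) :
  (l < n)%nat -> (forall i, (i < n)%nat -> 0 <= f i) -> f l <= rsum n f.
Proof.
  intros Hl H; rewrite <- (rsum_kron n l f Hl); apply rsum_le; intros i Hi.
  specialize (H i Hi); unfold kron; destruct (Nat.eqb i l); lra.
Qed.

(** * Vectors of R^n and squared norms *)

Definition sq (n : nat) (x : nat -> R) : R := rsum n (fun i => x i ^ 2).
Definition dot (n : nat) (x y : nat -> R) : R := rsum n (fun i => x i * y i).
Definition vadd (x y : nat -> R) : nat -> R := fun i => x i + y i.
Definition smul (k : R) (x : nat -> R) : nat -> R := fun i => k * x i.
Definition zv : nat -> R := fun _ => 0.

Lemma sq_nonneg (n : nat) (x : nat -> R) : 0 <= sq n x.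
Proof. apply rsum_nonneg; intros; apply pow2_ge_0. Qed.

Lemma sq_ge_coord (n i : nat) (x : nat -> R) : (i < n)%nat -> x i ^ 2 <= sq n x.
Proof. intros Hi; apply (rsum_ge_term n i (fun i => x i ^ 2) Hi); intros; apply pow2_ge_0. Qed.

Lemma nrm_sq (n : nat) (x : nat -> R) : nrm n x ^ 2 = sq n x.
Proof. unfold nrm; apply pow2_sqrt, sq_nonneg. Qed.

Lemma nrm_pos (n : nat) (x : nat -> R) : 0 < nrm n x <-> 0 < sq n x.
Proof.
  split; intros H; [rewrite <- nrm_sq; apply pow_lt, H|apply sqrt_lt_R0, H].
Qed.

Lemma nrm_lt (n : nat) (x : nat -> R) (d : R) : 0 < d -> (nrm n x < d <-> sq n x < d ^ 2).
Proof.
  intros Hd; split; intros H.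
  - rewrite <- nrm_sq; assert (0 <= nrm n x) by apply sqrt_pos; nra.
  - unfold nrm; rewrite <- (sqrt_pow2 d) by lra; apply sqrt_lt_1; [apply sq_nonneg|nra|exact H].
Qed.

Lemma sq_zero (n : nat) (x : nat -> R) : pt n x -> sq n x = 0 -> x = zv.
Proof.
  intros Hp H; apply functional_extensionality; intros i; unfold zv.
  destruct (le_lt_dec n i) as [Hi|Hi]; [apply Hp, Hi|].
  pose proof (sq_ge_coord n i x Hi); pose proof (pow2_ge_0 (x i)); nra.
Qed.

Lemma sq_smul (n : nat) (k : R) (x : nat -> R) : sq n (smul k x) = k ^ 2 * sq n x.
Proof. unfold sq; rewrite <- rsum_scal; apply rsum_ext; intros; unfold smul; ring. Qed.

Lemma sq_vsub (n : nat) (x y : nat -> R) : sq n (vsub x y) = sq n x - 2 * dot n x y + sq n y.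
Proof.
  unfold Rminus; replace (- (2 * dot n x y)) with ((-2) * dot n x y) by ring.
  unfold sq, dot; rewrite <- rsum_scal, <- !rsum_plus; apply rsum_ext; intros; unfold vsub; ring.
Qed.

Lemma pt_zv (n : nat) : pt n zv.
Proof. intros i _; reflexivity. Qed.

Lemma pt_vadd (n : nat) (x y : nat -> R) : pt n x -> pt n y -> pt n (vadd x y).
Proof. intros Hx Hy i Hi; unfold vadd; rewrite Hx, Hy by exact Hi; ring. Qed.

Lemma pt_vsub (n : nat) (x y : nat -> R) : pt n x -> pt n y -> pt n (vsub x y).
Proof. intros Hx Hy i Hi; unfold vsub; rewrite Hx, Hy by exact Hi; ring. Qed.

Lemma pt_smul (n : nat) (k : R) (x : nat -> R) : pt n x -> pt n (smul k x).
Proof. intros Hx i Hi; unfold smul; rewrite Hx by exact Hi; ring. Qed.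

Lemma pt_upd (n i : nat) (x : nat -> R) (t : R) : (i < n)%nat -> pt n x -> pt n (upd x i t).
Proof.
  intros Hi Hx j Hj; unfold upd; destruct (Nat.eqb_spec j i); [lia|apply Hx, Hj].
Qed.

Lemma upd_kron (x : nat -> R) (i j : nat) (t : R) : upd x i t j = x j + t * kron i j.
Proof. unfold upd, kron; rewrite Nat.eqb_sym; destruct (Nat.eqb i j); ring. Qed.

Lemma upd_0 (x : nat -> R) (i : nat) : upd x i 0 = x.
Proof. apply functional_extensionality; intros j; rewrite upd_kron; ring. Qed.

Lemma upd_upd (x : nat -> R) (i : nat) (s t : R) : upd (upd x i s) i t = upd x i (s + t).
Proof. apply functional_extensionality; intros j; rewrite !upd_kron; ring. Qed.

Lemma vadd_upd (x y : nat -> R) (i : nat) (t : R) : vadd x (upd y i t) = upd (vadd x y) i t.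
Proof. apply functional_extensionality; intros j; unfold vadd; rewrite !upd_kron; unfold vadd; ring. Qed.

Lemma vsub_upd (x y : nat -> R) (i : nat) (t : R) : vsub (upd y i t) x = upd (vsub y x) i t.
Proof. apply functional_extensionality; intros j; unfold vsub; rewrite !upd_kron; unfold vsub; ring. Qed.

Lemma sq_upd (n i : nat) (y : nat -> R) (t : R) :
  (i < n)%nat -> sq n (upd y i t) = sq n y + 2 * y i * t + t ^ 2.
Proof.
  intros Hi.
  pose proof (rsum_kron n i (fun j => 2 * y j * t + kron i j * t ^ 2) Hi) as E; cbv beta in E.
  replace (kron i i) with 1 in E by (unfold kron; rewrite Nat.eqb_refl; reflexivity).
  replace (2 * y i * t + 1 * t ^ 2) with (2 * y i * t + t ^ 2) in E by ring.
  unfold sq; rewrite Rplus_assoc, <- E, <- rsum_plus; apply rsum_ext; intros j _; rewrite upd_kron.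
  rewrite (kron_sym j i); unfold kron; destruct (Nat.eqb i j); ring.
Qed.

Lemma dot_comm (n : nat) (x y : nat -> R) : dot n x y = dot n y x.
Proof. apply rsum_ext; intros; ring. Qed.

Lemma dot_smul (n : nat) (k : R) (x y : nat -> R) : dot n x (smul k y) = k * dot n x y.
Proof. unfold dot; rewrite <- rsum_scal; apply rsum_ext; intros; unfold smul; ring. Qed.

Lemma dot_smul_l (n : nat) (k : R) (x y : nat -> R) : dot n (smul k x) y = k * dot n x y.
Proof. rewrite dot_comm, dot_smul, dot_comm; reflexivity. Qed.

(** * Neighbourhoods and limits *)

(** Neighbourhoods relative to the copy of R^n cut out by [pt n]. As a filter it turns [cont_at]
    into [filterlim], so that limits compose and combine with parameters through [filter_prod]. *)
Definition locn (n : nat) (x : nat -> R) (P : (nat -> R) -> Prop) : Prop :=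
  exists d, 0 < d /\ forall y, pt n y -> nrm n (vsub y x) < d -> P y.

Global Instance locn_filter (n : nat) (x : nat -> R) : Filter (locn n x).
Proof.
  constructor.
  - exists 1; split; [lra|intros; exact I].
  - intros P Q [d [Hd HP]] [e [He HQ]]; exists (Rmin d e); split; [apply Rmin_pos; lra|].
    intros y Hy Hn; split.
    + apply HP; [exact Hy|]; pose proof (Rmin_l d e); lra.
    + apply HQ; [exact Hy|]; pose proof (Rmin_r d e); lra.
  - intros P Q H [d [Hd HP]]; exists d; split; [exact Hd|]; intros y Hy Hn; apply H, HP; assumption.
Qed.

Lemma locn_pt (n : nat) (x : nat -> R) : locn n x (pt n).
Proof. exists 1; split; [lra|intros; assumption]. Qed.

Lemma vsub_self (x : nat -> R) : vsub x x = zv.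
Proof. apply functional_extensionality; intros i; unfold vsub, zv; ring. Qed.

Lemma sq_zv (n : nat) : sq n zv = 0.
Proof.
  unfold sq; rewrite (rsum_ext n _ (fun _ => 0)) by (intros; unfold zv; ring); rewrite rsum_const; ring.
Qed.

Lemma locn_self (n : nat) (x : nat -> R) (P : (nat -> R) -> Prop) : pt n x -> locn n x P -> P x.
Proof.
  intros Hx [d [Hd H]]; apply H; [exact Hx|].
  apply nrm_lt; [exact Hd|]; rewrite vsub_self, sq_zv; apply pow_lt, Hd.
Qed.

Lemma flim_eps {T : Type} (F : (T -> Prop) -> Prop) {FF : Filter F} (f : T -> R) (l : R) :
  filterlim f F (locally l) <-> (forall eps, 0 < eps -> F (fun t => Rabs (f t - l) < eps)).
Proof.
  split.
  - intros H eps He. apply (H (fun y => Rabs (y - l) < eps)).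
    exists (mkposreal eps He); intros y Hy; exact Hy.
  - intros H P [e He]; unfold filtermap. generalize (H e (cond_pos e)); apply filter_imp.
    intros t Ht; apply He, Ht.
Qed.

Lemma flim_const {T : Type} (F : (T -> Prop) -> Prop) {FF : Filter F} (c : R) :
  filterlim (fun _ : T => c) F (locally c).
Proof. apply filterlim_const. Qed.

Lemma flim_plus {T : Type} (F : (T -> Prop) -> Prop) {FF : Filter F} (f g : T -> R) (a b : R) :
  filterlim f F (locally a) -> filterlim g F (locally b) ->
  filterlim (fun t => f t + g t) F (locally (a + b)).
Proof. intros Hf Hg; eapply filterlim_comp_2; [exact Hf|exact Hg|]; apply (filterlim_plus a b). Qed.

Lemma flim_mult {T : Type} (F : (T -> Prop) -> Prop) {FF : Filter F} (f g : T -> R) (a b : R) :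
  filterlim f F (locally a) -> filterlim g F (locally b) ->
  filterlim (fun t => f t * g t) F (locally (a * b)).
Proof. intros Hf Hg; eapply filterlim_comp_2; [exact Hf|exact Hg|]; apply (filterlim_mult a b). Qed.

Lemma flim_scal {T : Type} (F : (T -> Prop) -> Prop) {FF : Filter F} (c : R) (g : T -> R) (b : R) :
  filterlim g F (locally b) -> filterlim (fun t => c * g t) F (locally (c * b)).
Proof. intros Hg; apply flim_mult; [exact FF|apply flim_const, FF|exact Hg]. Qed.

Lemma flim_minus {T : Type} (F : (T -> Prop) -> Prop) {FF : Filter F} (f g : T -> R) (a b : R) :
  filterlim f F (locally a) -> filterlim g F (locally b) ->
  filterlim (fun t => f t - g t) F (locally (a - b)).
Proof.
  intros Hf Hg; replace (a - b) with (a + (-1) * b) by ring.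
  apply filterlim_ext with (fun t => f t + (-1) * g t); [intros; ring|].
  apply flim_plus; [exact FF|exact Hf|apply flim_scal; [exact FF|exact Hg]].
Qed.

Lemma flim_comp {T : Type} (F : (T -> Prop) -> Prop) {FF : Filter F} (f : T -> R) (h : R -> R) (a : R) :
  filterlim f F (locally a) -> continuous h a -> filterlim (fun t => h (f t)) F (locally (h a)).
Proof. intros Hf Hh; eapply filterlim_comp; [exact Hf|exact Hh]. Qed.

Lemma flim_rsum {T : Type} (F : (T -> Prop) -> Prop) {FF : Filter F} (n : nat)
  (f : nat -> T -> R) (a : nat -> R) :
  (forall i, (i < n)%nat -> filterlim (f i) F (locally (a i))) ->
  filterlim (fun t => rsum n (fun i => f i t)) F (locally (rsum n a)).
Proof.
  induction n as [|n IH]; intros H; simpl; [apply flim_const, FF|].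
  apply flim_plus; [exact FF|apply IH; intros; apply H; lia|apply H; lia].
Qed.

Lemma flim_gt {T : Type} (F : (T -> Prop) -> Prop) {FF : Filter F} (f : T -> R) (l c : R) :
  filterlim f F (locally l) -> c < l -> F (fun t => c < f t).
Proof.
  intros H Hc; generalize (proj1 (flim_eps F f l) H (l - c) ltac:(lra)); apply filter_imp.
  intros t Ht; apply Rabs_def2 in Ht; lra.
Qed.

Lemma flim_lt {T : Type} (F : (T -> Prop) -> Prop) {FF : Filter F} (f : T -> R) (l c : R) :
  filterlim f F (locally l) -> l < c -> F (fun t => f t < c).
Proof.
  intros H Hc; generalize (proj1 (flim_eps F f l) H (c - l) ltac:(lra)); apply filter_imp.
  intros t Ht; apply Rabs_def2 in Ht; lra.
Qed.

(** Coordinatewise convergence suffices because the squared distance is a finite sum; every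
    continuity proof for a map into R^n goes through this. *)
Lemma flim_locn {T : Type} (F : (T -> Prop) -> Prop) {FF : Filter F} (n : nat)
  (X : T -> nat -> R) (x : nat -> R) :
  (forall i, (i < n)%nat -> filterlim (fun t => X t i) F (locally (x i))) ->
  F (fun t => pt n (X t)) -> filterlim X F (locn n x).
Proof.
  intros H Hp P [d [Hd HP]]; unfold filtermap.
  assert (Hs : filterlim (fun t => sq n (vsub (X t) x)) F (locally 0)).
  { replace 0 with (rsum n (fun i => (x i - x i) * (x i - x i)))
      by (rewrite (rsum_ext n _ (fun _ => 0)) by (intros; ring); rewrite rsum_const; ring).
    unfold sq; apply (flim_rsum F n (fun i t => vsub (X t) x i ^ 2)); intros i Hi.
    apply filterlim_ext with (fun t => (X t i - x i) * (X t i - x i)); [intros; unfold vsub; ring|].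
    apply flim_mult; [exact FF| |]; (apply flim_minus; [exact FF|apply H, Hi|apply flim_const, FF]). }
  assert (Hd2 : 0 < d ^ 2) by (apply pow_lt, Hd).
  generalize (filter_and _ _ Hp (flim_lt F _ _ _ Hs Hd2)); apply filter_imp.
  intros t [Ht1 Ht2]; apply HP; [exact Ht1|]; apply nrm_lt; assumption.
Qed.

Lemma flim_coord (n : nat) (x : nat -> R) (i : nat) :
  (i < n)%nat -> filterlim (fun y : nat -> R => y i) (locn n x) (locally (x i)).
Proof.
  intros Hi; apply flim_eps; [apply locn_filter|]; intros eps He; exists eps; split; [exact He|].
  intros y _ Hn; apply nrm_lt in Hn; [|exact He].
  pose proof (sq_ge_coord n i (vsub y x) Hi) as Hc; unfold vsub in Hc at 1.
  apply Rabs_def1; nra.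
Qed.

Lemma cont_at_flim (n : nat) (g : (nat -> R) -> R) (x : nat -> R) :
  cont_at n g x <-> filterlim g (locn n x) (locally (g x)).
Proof. rewrite (flim_eps (locn n x)); unfold cont_at, locn; reflexivity. Qed.

Lemma flim_sq (n : nat) (a x : nat -> R) :
  filterlim (fun y => sq n (vsub y a)) (locn n x) (locally (sq n (vsub x a))).
Proof.
  unfold sq.
  apply (flim_rsum (locn n x) n (fun i y => vsub y a i ^ 2) (fun i => vsub x a i ^ 2)); intros i Hi.
  apply filterlim_ext with (fun y : nat -> R => (y i - a i) * (y i - a i)); [intros; unfold vsub; ring|].
  replace (vsub x a i ^ 2) with ((x i - a i) * (x i - a i)) by (unfold vsub; ring).
  apply flim_mult; try typeclasses eauto;
  (apply flim_minus; [typeclasses eauto|apply flim_coord, Hi|apply flim_const; typeclasses eauto]).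
Qed.

Lemma vsub_zv (x : nat -> R) : vsub x zv = x.
Proof. apply functional_extensionality; intros i; unfold vsub, zv; ring. Qed.

Lemma flim_sq0 (n : nat) (x : nat -> R) :
  filterlim (fun y => sq n y) (locn n x) (locally (sq n x)).
Proof.
  pose proof (flim_sq n zv x) as H; rewrite vsub_zv in H.
  apply filterlim_ext with (2 := H); intros y; rewrite vsub_zv; reflexivity.
Qed.

Lemma continuous_Rpower (m s : R) : 0 < s -> continuous (fun t => Rpower t m) s.
Proof.
  intros Hs; apply (ex_derive_continuous (fun t => Rpower t m)); unfold Rpower; auto_derive; exact Hs.
Qed.

Lemma ball_R (a e t : R) : ball a e t <-> Rabs (t - a) < e.
Proof. reflexivity. Qed.

(** * Compactness and the minimum principle *)

(** Coquelicot states the compactness of boxes on the nested tuples [Tn n R]; [tn] and [vt]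
    translate between these and functions of an index. *)
Fixpoint tn (n : nat) (x : nat -> R) : Compactness.Tn n R :=
  match n with O => tt | S k => (x k, tn k x) end.

Fixpoint vt (n : nat) : Compactness.Tn n R -> nat -> R :=
  match n with
  | O => fun _ _ => 0
  | S k => fun p i => if Nat.eqb i k then fst p else vt k (snd p) i
  end.

Lemma vt_pt (n : nat) (p : Compactness.Tn n R) : pt n (vt n p).
Proof.
  induction n as [|n IH]; intros i Hi; simpl; [reflexivity|].
  destruct (Nat.eqb_spec i n); [lia|apply IH; lia].
Qed.

Lemma bounded_tn (n : nat) (M : R) (y : nat -> R) :
  (forall i, (i < n)%nat -> Rabs (y i) <= M) ->
  bounded_n n (tn n (fun _ => - M)) (tn n (fun _ => M)) (tn n y).
Proof.
  induction n as [|n IH]; intros H; simpl; [exact I|].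
  split; [|apply IH; intros; apply H; lia].
  specialize (H n (Nat.lt_succ_diag_r n)); apply Rabs_le_between in H; lra.
Qed.

Lemma close_tn (n : nat) (d : R) (y : nat -> R) (p : Compactness.Tn n R) :
  close_n n d (tn n y) p -> forall i, (i < n)%nat -> Rabs (y i - vt n p i) < d.
Proof.
  induction n as [|n IH]; intros H i Hi; [lia|]; destruct p as [p1 p2]; simpl in *.
  destruct H as [H1 H2]; destruct (Nat.eqb_spec i n) as [->|Hne]; [exact H1|apply IH; [exact H2|lia]].
Qed.

(** Finite subcovering with a parameter: what holds near each point for small [t > 0] holds on the
    whole ball for a common range of [t]. Below, [t] is either a margin in a lower bound or an
    increment of the squared radius of the sphere. *)
Lemma compact_uniform (n : nat) (M : R) (Q : R -> (nat -> R) -> Prop) :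
  (forall x, pt n x ->
     filter_prod (at_right 0) (locn n x) (fun z => Q (fst z) (snd z))) ->
  exists e, 0 < e /\ forall t y, 0 < t < e -> pt n y -> sq n y <= M -> Q t y.
Proof.
  intros H.
  assert (H' : forall x, pt n x -> exists d : posreal, forall t y,
    0 < t < d -> pt n y -> (forall i, (i < n)%nat -> Rabs (y i - x i) < d) -> Q t y).
  { intros x Hx; destruct (H x Hx) as [P1 P2 [e He] [d [Hd Hl]] HPQ].
    (* A cube of half-width [d'] lies in the ball of radius [d], since [n d'^2 < ((n + 1) d')^2]. *)
    set (d' := d / (INR n + 1)).
    assert (Hn : 0 < INR n + 1) by (pose proof (pos_INR n); lra).
    assert (Hd' : 0 < d') by (apply Rdiv_lt_0_compat; assumption).
    assert (Hm : 0 < Rmin e d') by (apply Rmin_pos; [apply cond_pos|exact Hd']).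
    exists (mkposreal _ Hm); simpl; intros t y Ht Hy Hc.
    pose proof (Rmin_l e d'); pose proof (Rmin_r e d').
    apply (HPQ t y).
    - apply He; [|apply Ht]; apply ball_R; rewrite Rabs_right; lra.
    - apply Hl; [exact Hy|]; apply nrm_lt; [exact Hd|].
      apply Rle_lt_trans with (rsum n (fun _ => d' ^ 2)).
      + unfold sq; apply rsum_le; intros i Hi; specialize (Hc i Hi).
        apply Rabs_def2 in Hc; unfold vsub; nra.
      + rewrite rsum_const; replace d with (d' * (INR n + 1)) by (unfold d'; field; lra).
        pose proof (pos_INR n); nra. }
  set (dl := fun p => proj1_sig (constructive_indefinite_description _ (H' (vt n p) (vt_pt n p)))).
  destruct (compactness_value n (tn n (fun _ => - (sqrt M))) (tn n (fun _ => sqrt M)) dl) as [d Hd].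
  exists d; split; [apply cond_pos|]; intros t y Ht Hy HM.
  (* [compactness_value] delivers the covering point only under a double negation. *)
  apply NNPP; intros Hc; apply (Hd (tn n y)).
  - apply bounded_tn; intros i Hi; rewrite <- sqrt_Rsqr_abs; apply sqrt_le_1_alt.
    pose proof (sq_ge_coord n i y Hi); unfold Rsqr; lra.
  - intros [p [_ [Hp1 Hp2]]]; apply Hc.
    apply (proj2_sig (constructive_indefinite_description _ (H' (vt n p) (vt_pt n p)))).
    + fold (dl p); lra.
    + exact Hy.
    + apply close_tn, Hp1.
Qed.

Lemma filter_prod_right {T U : Type} (F : (T -> Prop) -> Prop) (G : (U -> Prop) -> Prop)
  {FF : Filter F} (P : T -> U -> Prop) (Q : U -> Prop) :
  G Q -> (forall t u, Q u -> P t u) -> filter_prod F G (fun z => P (fst z) (snd z)).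
Proof.
  intros HG H; exists (fun _ => True) Q; [apply filter_true|exact HG|]; intros x y _ Hy; apply H, Hy.
Qed.

Lemma at_right_lt (e : R) : 0 < e -> at_right 0 (fun t => 0 < t < e).
Proof.
  intros He; exists (mkposreal e He); intros y Hy Hy0; split; [exact Hy0|].
  apply (proj1 (ball_R _ _ _)) in Hy; simpl in Hy; apply Rabs_def2 in Hy; lra.
Qed.

(** A positive continuous function on a compact set is bounded away from 0. The second hypothesis
    says that [K] is closed. *)
Lemma compact_pos_bound (n : nat) (M : R) (K : (nat -> R) -> Prop) (g : (nat -> R) -> R) :
  (forall x, pt n x -> K x -> sq n x <= M /\ cont_at n g x /\ 0 < g x) ->
  (forall x, pt n x -> ~ K x -> locn n x (fun y => ~ K y)) ->
  exists s, 0 < s /\ forall x, pt n x -> K x -> s <= g x.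
Proof.
  intros HK Hc; destruct (compact_uniform n M (fun t y => K y -> t <= g y)) as [e [He H]].
  - intros x Hx; destruct (classic (K x)) as [Hk|Hk].
    + destruct (HK x Hx Hk) as [_ [Hg Hp]]; apply cont_at_flim in Hg.
      exists (fun t => 0 < t < g x / 2) (fun y => g x / 2 < g y).
      * apply at_right_lt; lra.
      * apply (flim_gt (locn n x) g (g x) (g x / 2) Hg); lra.
      * intros t y Ht Hy _; simpl in *; lra.
    + apply (filter_prod_right _ _ (fun t y => K y -> t <= g y) (fun y => ~ K y)).
      * apply Hc; assumption.
      * intros t y H1 H2; contradiction.
  - exists (e / 2); split; [lra|]; intros x Hx Hk; apply H; try assumption; [lra|].
    apply (HK x Hx Hk).
Qed.

(* [L] is the trace of the Hessian, computed from second derivatives of [g] along the coordinate lines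
   through [x] only. *)
Definition lap_at (n : nat) (g : (nat -> R) -> R) (x : nat -> R) (L : R) : Prop :=
  exists (d : nat -> R -> R) (l : nat -> R),
    (forall i, (i < n)%nat ->
       locally 0 (fun t => is_derive (fun s => g (upd x i s)) t (d i t)) /\
       is_derive (d i) 0 (l i)) /\ L = rsum n l.

(** At the minimum [d 0 = 0], so [l < 0] would make [d] negative just to the right of 0, and the
    mean value theorem would bring [h] below [h 0]. *)
Lemma second_derivative_min (h d : R -> R) (l : R) :
  locally 0 (fun t => is_derive h t (d t)) -> is_derive d 0 l ->
  locally 0 (fun t => h 0 <= h t) -> 0 <= l.
Proof.
  intros [e1 H1] H2 [e2 H3].
  assert (B : forall (e : posreal) t, Rabs t < e -> ball 0 e t).
  { intros e t Ht; apply ball_R; replace (t - 0) with t by ring; exact Ht. }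
  destruct (Rle_lt_dec 0 l) as [Hl|Hl]; [exact Hl|exfalso].
  assert (D0 : d 0 = 0).
  { assert (Hd0 : is_derive h 0 (d 0)) by (apply H1, B; rewrite Rabs_R0; apply cond_pos).
    apply is_derive_Reals in Hd0.
    assert (pr : derivable_pt h 0) by (exists (d 0); exact Hd0).
    apply is_derive_Reals in Hd0. apply is_derive_unique in Hd0. rewrite <- Hd0.
    rewrite <- (Derive_Reals h 0 pr).
    apply (deriv_minimum h (- e2) e2 0 pr); try (pose proof (cond_pos e2); lra).
    intros x Hx1 Hx2; apply H3, B; apply Rabs_def1; lra. }
  assert (Hneg : exists e3 : posreal, forall t, 0 < t < e3 -> d t < 0).
  { apply is_derive_Reals in H2. destruct (H2 (- l) ltac:(lra)) as [e3 H4]; exists e3; intros t Ht.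
    assert (Ht0 : t <> 0) by lra.
    specialize (H4 t Ht0 ltac:(apply Rabs_def1; lra)).
    replace (0 + t) with t in H4 by ring; rewrite D0 in H4; apply Rabs_def2 in H4.
    assert (Hq : (d t - 0) / t < 0) by lra.
    replace (d t) with ((d t - 0) / t * t) by (field; exact Ht0); nra. }
  destruct Hneg as [e3 H5].
  set (t0 := Rmin (Rmin e1 e2) e3 / 2).
  assert (Ht0 : 0 < t0 /\ t0 < e1 /\ t0 < e2 /\ t0 < e3).
  { pose proof (cond_pos e1); pose proof (cond_pos e2); pose proof (cond_pos e3).
    pose proof (Rmin_l (Rmin e1 e2) e3); pose proof (Rmin_r (Rmin e1 e2) e3).
    pose proof (Rmin_l e1 e2); pose proof (Rmin_r e1 e2).
    assert (0 < Rmin (Rmin e1 e2) e3) by (repeat apply Rmin_pos; assumption); unfold t0; lra. }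
  destruct (MVT_cor2 h d 0 t0) as [c [Hc1 Hc2]]; [lra| |].
  - intros c Hc; apply is_derive_Reals, H1, B, Rabs_def1; lra.
  - specialize (H5 c ltac:(lra)).
    assert (h 0 <= h t0) by (apply H3, B, Rabs_def1; lra); nra.
Qed.

Lemma flim_upd (n i : nat) (x : nat -> R) (t0 : R) :
  (i < n)%nat -> pt n x -> filterlim (fun t => upd x i t) (locally t0) (locn n (upd x i t0)).
Proof.
  intros Hi Hx; apply flim_locn; [typeclasses eauto| |].
  - intros j Hj; rewrite upd_kron.
    apply filterlim_ext with (fun t => x j + t * kron i j); [intros; rewrite upd_kron; reflexivity|].
    apply (ex_derive_continuous (fun t => x j + t * kron i j)); auto_derive; exact I.
  - apply filter_forall; intros t; apply pt_upd; assumption.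
Qed.

Lemma lap_at_min (n : nat) (g : (nat -> R) -> R) (x : nat -> R) (L : R) :
  pt n x -> locn n x (fun y => g x <= g y) -> lap_at n g x L -> 0 <= L.
Proof.
  intros Hx Hm [d [l [H ->]]]; apply rsum_nonneg; intros i Hi; destruct (H i Hi) as [H1 H2].
  apply (second_derivative_min (fun s => g (upd x i s)) (d i) (l i) H1 H2).
  pose proof (flim_upd n i x 0 Hi Hx) as Hu; rewrite upd_0 in Hu |- *; apply (Hu _ Hm).
Qed.

Lemma lap_at_plus (n : nat) (f g : (nat -> R) -> R) (x : nat -> R) (L M : R) :
  lap_at n f x L -> lap_at n g x M -> lap_at n (fun y => f y + g y) x (L + M).
Proof.
  intros [d [l [H ->]]] [d' [l' [H' ->]]].
  exists (fun i t => d i t + d' i t), (fun i => l i + l' i); split; [|rewrite rsum_plus; reflexivity].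
  intros i Hi; destruct (H i Hi) as [H1 H2]; destruct (H' i Hi) as [H1' H2']; split.
  - generalize (filter_and _ _ H1 H1'); apply filter_imp; intros t [Ha Hb].
    apply (is_derive_plus (fun s => f (upd x i s)) (fun s => g (upd x i s)) t _ _ Ha Hb).
  - apply (is_derive_plus (d i) (d' i) 0 _ _ H2 H2').
Qed.

Lemma lap_at_scal (n : nat) (c : R) (f : (nat -> R) -> R) (x : nat -> R) (L : R) :
  lap_at n f x L -> lap_at n (fun y => c * f y) x (c * L).
Proof.
  intros [d [l [H ->]]]; exists (fun i t => c * d i t), (fun i => c * l i).
  split; [|rewrite rsum_scal; reflexivity]; intros i Hi; destruct (H i Hi) as [H1 H2]; split.
  - generalize H1; apply filter_imp; intros t Ha.
    apply (is_derive_scal (fun s => f (upd x i s)) t c _ Ha).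
  - apply (is_derive_scal (d i) 0 c _ H2).
Qed.

Lemma lap_at_const (n : nat) (c : R) (x : nat -> R) : lap_at n (fun _ => c) x 0.
Proof.
  exists (fun _ _ => 0), (fun _ => 0); split; [|rewrite rsum_const; ring]; intros i Hi; split.
  - apply filter_forall; intros t; apply (is_derive_const c).
  - apply (is_derive_const 0).
Qed.

Lemma lap_at_vadd (n : nat) (f : (nat -> R) -> R) (a x : nat -> R) (L : R) :
  lap_at n f (vadd a x) L -> lap_at n (fun y => f (vadd a y)) x L.
Proof.
  intros [d [l [H HL]]]; exists d, l; split; [|exact HL]; intros i Hi; destruct (H i Hi) as [H1 H2].
  split; [|exact H2]; generalize H1; apply filter_imp; intros t Ht.
  apply is_derive_ext with (2 := Ht); intros s; rewrite vadd_upd; reflexivity.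
Qed.

Lemma lap_at_ext (n : nat) (f g : (nat -> R) -> R) (x : nat -> R) (L : R) :
  (forall y, f y = g y) -> lap_at n f x L -> lap_at n g x L.
Proof. intros H; replace g with f; [tauto|]; apply functional_extensionality, H. Qed.

(** A negative Laplacian excludes interior minima. The last hypothesis is a lower limit [>= 0] at
    every point outside [D], so that punctures and outer boundary are treated alike. *)
Lemma min_principle (n : nat) (M : R) (D : (nat -> R) -> Prop) (g : (nat -> R) -> R) :
  (forall x, D x -> pt n x /\ sq n x <= M /\ locn n x D) ->
  (forall x, D x -> cont_at n g x /\ exists L, L < 0 /\ lap_at n g x L) ->
  (forall x, pt n x -> ~ D x -> forall eps, 0 < eps -> locn n x (fun y => D y -> - eps < g y)) ->
  forall x, D x -> 0 <= g x.
Proof.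
  intros HD Hg Hb x0 Hx0; destruct (Rle_lt_dec 0 (g x0)) as [H0|H0]; [exact H0|exfalso].
  (* The infimum of [g] over [D], if not attained, is improved uniformly by compactness. *)
  assert (Hbd : exists B, forall y, D y -> B <= g y).
  (* The bound [- / t] becomes arbitrarily weak as [t] tends to 0, so a local lower bound at each
     point is enough for a global one. *)
  { destruct (compact_uniform n M (fun t y => D y -> - / t <= g y)) as [e [He H]].
    - intros x Hx.
      assert (Hloc : exists B, 0 < B /\ locn n x (fun y => D y -> - B < g y)).
      { destruct (classic (D x)) as [Hd|Hd].
        - exists (Rabs (g x) + 1); split; [pose proof (Rabs_pos (g x)); lra|].
          destruct (Hg x Hd) as [Hc _]; apply cont_at_flim in Hc.
          generalize (flim_gt (locn n x) g (g x) (- (Rabs (g x) + 1)) Hc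
            ltac:(pose proof (Rle_abs (- g x)) as Hr; rewrite Rabs_Ropp in Hr; lra)).
          apply filter_imp; tauto.
        - exists 1; split; [lra|]; apply Hb; [exact Hx|exact Hd|lra]. }
      destruct Hloc as [B [HB Hl]].
      exists (fun t => 0 < t < / B) (fun y => D y -> - B < g y); [apply at_right_lt, Rinv_0_lt_compat, HB|exact Hl|].
      intros t y Ht Hy HDy; simpl in *; specialize (Hy HDy).
      assert (B < / t) by (rewrite <- (Rinv_inv B); apply Rinv_lt_contravar;
        [apply Rmult_lt_0_compat; [lra|apply Rinv_0_lt_compat, HB]|lra]); lra.
    - exists (- / (e / 2)); intros y Hy; destruct (HD y Hy) as [H1 [H2 _]]; apply H; try assumption; lra. }
  destruct Hbd as [B HB].
  destruct (completeness (fun r => exists y, D y /\ r = - g y)) as [s [Hs1 Hs2]].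
  - exists (- B); intros r [y [Hy ->]]; specialize (HB y Hy); lra.
  - exists (- g x0), x0; split; [exact Hx0|reflexivity].
  - assert (Hge : forall y, D y -> - s <= g y).
    { intros y Hy; specialize (Hs1 (- g y) (ex_intro _ y (conj Hy eq_refl))); lra. }
    destruct (classic (exists y, D y /\ g y = - s)) as [[y [Hy Hys]]|Hno].
    + destruct (Hg y Hy) as [_ [L [HL Hlap]]]; destruct (HD y Hy) as [Hpy [_ Hop]].
      assert (0 <= L); [|lra].
      apply (lap_at_min n g y L Hpy); [|exact Hlap].
      generalize Hop; apply filter_imp; intros z Hz; rewrite Hys; apply Hge, Hz.
    + destruct (compact_uniform n M (fun t y => D y -> - s + t <= g y)) as [e [He H]].
      * intros x Hx.
        assert (Hloc : exists c, - s < c /\ locn n x (fun y => D y -> c < g y)).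
        { destruct (classic (D x)) as [Hd|Hd].
          - exists ((g x - s) / 2); assert (g x <> - s) by (intros E; apply Hno; exists x; tauto).
            pose proof (Hge x Hd); split; [lra|].
            destruct (Hg x Hd) as [Hc _]; apply cont_at_flim in Hc.
            generalize (flim_gt (locn n x) g (g x) ((g x - s) / 2) Hc ltac:(lra)); apply filter_imp; tauto.
          - assert (- s <= g x0) by (apply Hge, Hx0).
            exists (- (s / 2)); split; [lra|]; apply Hb; [exact Hx|exact Hd|lra]. }
        destruct Hloc as [c [Hc Hl]].
        exists (fun t => 0 < t < c + s) (fun y => D y -> c < g y); [apply at_right_lt; lra|exact Hl|].
        intros t y Ht Hy HDy; simpl in *; specialize (Hy HDy); lra.
      * assert (s <= s - e / 2); [|lra].
        apply Hs2; intros r [y [Hy ->]]; destruct (HD y Hy) as [H1 [H2 _]].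
        specialize (H (e / 2) y ltac:(lra) H1 H2 Hy); lra.
Qed.

(** * Chain rule and the Kelvin transform *)

Lemma is_derive_extR (f g : R -> R) (x l : R) :
  (forall t, f t = g t) -> is_derive f x l -> is_derive g x l.
Proof. intros H; apply is_derive_ext, H. Qed.

Lemma filterlim_imp {T U : Type} (F : (T -> Prop) -> Prop) (G : (U -> Prop) -> Prop) {FF : Filter F}
  (f : T -> U) (P : U -> Prop) (Q : T -> Prop) :
  filterlim f F G -> G P -> (forall t, P (f t) -> Q t) -> F Q.
Proof. intros H HP HQ; exact (filter_imp _ _ HQ (H P HP)). Qed.

(** The broken path from [b] to [a] that changes one coordinate at a time; the chain rule telescopes
    along it. *)
Definition mix (k : nat) (a b : nat -> R) : nat -> R := fun i => if Nat.ltb i k then a i else b i.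

Lemma mix_S (k : nat) (a b : nat -> R) : mix (S k) a b = upd (mix k a b) k (a k - b k).
Proof.
  apply functional_extensionality; intros i; unfold mix, upd.
  destruct (Nat.eqb_spec i k) as [->|Hne].
  - rewrite (proj2 (Nat.ltb_lt k (S k))), (proj2 (Nat.ltb_ge k k)) by lia; ring.
  - destruct (Nat.ltb_spec i k), (Nat.ltb_spec i (S k)); try lia; reflexivity.
Qed.

Lemma pt_mix (n k : nat) (a b : nat -> R) : pt n a -> pt n b -> pt n (mix k a b).
Proof. intros Ha Hb i Hi; unfold mix; destruct (Nat.ltb i k); [apply Ha|apply Hb]; exact Hi. Qed.

Lemma mix_full (n : nat) (a b : nat -> R) : pt n a -> pt n b -> mix n a b = a.
Proof.
  intros Ha Hb; apply functional_extensionality; intros i; unfold mix.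
  destruct (Nat.ltb_spec i n); [reflexivity|rewrite Ha, Hb by assumption; reflexivity].
Qed.

Lemma has_partial_line (f : (nat -> R) -> R) (i : nat) (x : nat -> R) (t l : R) :
  has_partial f i (upd x i t) l <-> is_derive (fun s => f (upd x i s)) t l.
Proof.
  unfold has_partial; rewrite is_derive_Reals; split; intros H eps He; destruct (H eps He) as [d Hd];
  exists d; intros h Hh1 Hh2; specialize (Hd h Hh1 Hh2).
  - rewrite !upd_upd in Hd; rewrite Rplus_0_l, Rplus_0_r in Hd; exact Hd.
  - rewrite !upd_upd; rewrite Rplus_0_l, Rplus_0_r; exact Hd.
Qed.

(** Existence of the partials near [x] feeds the mean value theorem in each coordinate, and their
    continuity at [x] controls the intermediate points. *)
Definition C1_at (n : nat) (f : (nat -> R) -> R) (D : nat -> (nat -> R) -> R) (x : nat -> R) : Prop :=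
  locn n x (fun y => forall k, (k < n)%nat -> has_partial f k y (D k y)) /\
  forall k, (k < n)%nat -> cont_at n (D k) x.

Lemma increment_partial (n k : nat) (f : (nat -> R) -> R) (g : (nat -> R) -> R) (x z : nat -> R) (s d : R) :
  (k < n)%nat -> pt n z -> 0 < d ->
  (forall y, pt n y -> nrm n (vsub y x) < d -> has_partial f k y (g y)) ->
  (forall t, Rabs t <= Rabs s -> nrm n (vsub (upd z k t) x) < d) ->
  exists t, Rabs t <= Rabs s /\ f (upd z k s) - f z = g (upd z k t) * s.
Proof.
  intros Hk Hz Hd Hp Hn.
  destruct (MVT_gen (fun t => f (upd z k t)) 0 s (fun t => g (upd z k t))) as [t [Ht1 Ht2]].
  - intros t Ht; apply has_partial_line, Hp; [apply pt_upd; assumption|apply Hn].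
    revert Ht; unfold Rmin, Rmax, Rabs; destruct (Rle_dec 0 s), (Rcase_abs t), (Rcase_abs s); lra.
  - intros t Ht; apply derivable_continuous_pt; exists (g (upd z k t)); apply is_derive_Reals.
    apply has_partial_line, Hp; [apply pt_upd; assumption|apply Hn].
    revert Ht; unfold Rmin, Rmax, Rabs; destruct (Rle_dec 0 s), (Rcase_abs t), (Rcase_abs s); lra.
  - exists t; split.
    + revert Ht1; unfold Rmin, Rmax, Rabs; destruct (Rle_dec 0 s), (Rcase_abs t), (Rcase_abs s); lra.
    + rewrite upd_0 in Ht2; rewrite Ht2; ring.
Qed.

(** Induction on the number of coordinates already moved: the increment of [f] from [mix k] to
    [mix (S k)] is a single partial derivative at an intermediate point, times the increment of the
    [k]-th coordinate. *)
Lemma chain_rule (n : nat) (f : (nat -> R) -> R) (D : nat -> (nat -> R) -> R)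
  (c : R -> nat -> R) (c' : nat -> R) (t0 : R) :
  (forall t, pt n (c t)) -> C1_at n f D (c t0) ->
  (forall k, (k < n)%nat -> is_derive (fun t => c t k) t0 (c' k)) ->
  is_derive (fun t => f (c t)) t0 (rsum n (fun k => D k (c t0) * c' k)).
Proof.
  intros Hpt [Hp Hc] Hd; set (x := c t0) in *.
  assert (Hcont : forall k, (k < n)%nat -> filterlim (fun t => c t k) (locally t0) (locally (x k))).
  { intros k Hk; apply (ex_derive_continuous (fun t => c t k)); exists (c' k); apply Hd, Hk. }
  assert (Hmixlim : forall k, filterlim (fun t => mix k (c t) x) (locally t0) (locn n x)).
  { intros k; apply flim_locn; [typeclasses eauto| |].
    - intros i Hi; unfold mix; destruct (Nat.ltb i k); [apply Hcont, Hi|apply flim_const; typeclasses eauto].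
    - apply filter_forall; intros t; apply pt_mix; [apply Hpt|apply (Hpt t0)]. }
  assert (Hstep : forall k, (k <= n)%nat ->
    is_derive (fun t => f (mix k (c t) x)) t0 (rsum k (fun k => D k x * c' k))).
  { induction k as [|k IH]; intros Hk; simpl.
    - apply is_derive_extR with (fun _ => f (mix 0 x x)); [intros; reflexivity|apply (is_derive_const (f (mix 0 x x)))].
    - assert (Hkn : (k < n)%nat) by lia.
      apply is_derive_extR with (fun t => f (mix k (c t) x) + (f (mix (S k) (c t) x) - f (mix k (c t) x)));
        [intros; ring|].
      apply (is_derive_plus (fun t => f (mix k (c t) x)) (fun t => f (mix (S k) (c t) x) - f (mix k (c t) x)));
        [apply IH; lia|].
      assert (Hm0 : forall j, mix j x x = x)
        by (intros j; apply functional_extensionality; intros i; unfold mix; destruct (Nat.ltb i j); reflexivity).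
      apply is_derive_Reals; intros eps He.
      pose proof (Hd k Hkn) as Hdk; apply is_derive_Reals in Hdk.
      set (M := Rabs (c' k) + 1); set (N := Rabs (D k x) + 1).
      assert (HM : 0 < M) by (unfold M; pose proof (Rabs_pos (c' k)); lra).
      assert (HN : 0 < N) by (unfold N; pose proof (Rabs_pos (D k x)); lra).
      (* The error will be split as [(dd - D k x) * (s / h) + D k x * (s / h - c' k)], each summand
         getting [eps / 2]; the cap 1 in [e2] yields [|s / h| <= M]. *)
      set (e1 := eps / (2 * M)). set (e2 := Rmin 1 (eps / (2 * N))).
      assert (He1 : 0 < e1) by (apply Rdiv_lt_0_compat; lra).
      assert (He2 : 0 < e2) by (apply Rmin_pos; [lra|apply Rdiv_lt_0_compat; lra]).
      assert (Hgood : exists d, 0 < d /\ forall y, pt n y -> nrm n (vsub y x) < d ->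
        has_partial f k y (D k y) /\ Rabs (D k y - D k x) < e1).
      { pose proof (filter_and _ _ Hp (proj1 (flim_eps (locn n x) _ _) (proj1 (cont_at_flim n _ _) (Hc k Hkn)) e1 He1)) as Hf.
        destruct Hf as [d [Hd0 Hf]]; exists d; split; [exact Hd0|]; intros y Hy1 Hy2.
        destruct (Hf y Hy1 Hy2); split; auto. }
      destruct Hgood as [d [Hd0 Hgood]].
      (* One half of [d ^ 2] is for the coordinates already moved, the other for the displacement of
         the [k]-th one. *)
      assert (Hdd : 0 < d ^ 2 / 2) by (pose proof (pow_lt d 2 Hd0); lra).
      assert (Hn0 : sq n (vsub x x) < d ^ 2 / 2) by (rewrite vsub_self, sq_zv; exact Hdd).
      assert (Hb1 : locally t0 (fun t => sq n (vsub (mix k (c t) x) x) < d ^ 2 / 2))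
        by exact (Hmixlim k _ (flim_lt (locn n x) _ _ _ (flim_sq n x x) Hn0)).
      assert (Hb2 : locally t0 (fun t => (c t k - x k) ^ 2 < d ^ 2 / 2)).
      { apply (flim_lt (locally t0) (fun t => (c t k - x k) ^ 2) ((x k - x k) * (x k - x k)));
          [|replace ((x k - x k) * (x k - x k)) with 0 by ring; exact Hdd].
        apply filterlim_ext with (fun t => (c t k - x k) * (c t k - x k)); [intros; ring|].
        apply flim_mult; [typeclasses eauto| |]; (apply flim_minus; [typeclasses eauto|apply Hcont, Hkn|apply flim_const; typeclasses eauto]). }
      destruct (filter_and _ _ Hb1 Hb2) as [d1 Hd1]; destruct (Hdk e2 He2) as [d2 Hd2].
      assert (Hm : 0 < Rmin d1 d2) by (apply Rmin_pos; apply cond_pos).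
      exists (mkposreal _ Hm); simpl; intros h Hh0 Hh.
      pose proof (Rmin_l d1 d2); pose proof (Rmin_r d1 d2).
      destruct (Hd1 (t0 + h)) as [Hs1 Hs2].
      { apply ball_R; replace (t0 + h - t0) with h by ring; lra. }
      specialize (Hd2 h Hh0 ltac:(lra)).
      fold x; rewrite !Hm0.
      set (z := mix k (c (t0 + h)) x) in *.
      assert (Hz : pt n z) by (apply pt_mix; [apply Hpt|apply (Hpt t0)]).
      assert (Hzk : z k = x k) by (unfold z, mix; rewrite (proj2 (Nat.ltb_ge k k)) by lia; reflexivity).
      set (s := c (t0 + h) k - x k) in *.
      destruct (increment_partial n k f (D k) x z s d Hkn Hz Hd0) as [t [Ht1 Ht2]].
      - intros y Hy1 Hy2; apply Hgood; assumption.
      - intros t Ht; apply nrm_lt; [exact Hd0|]; rewrite vsub_upd, sq_upd by exact Hkn.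
        unfold vsub at 2; rewrite Hzk.
        assert (t ^ 2 <= s ^ 2) by (apply pow_maj_Rabs with (n := 2%nat) in Ht; rewrite pow2_abs in Ht; exact Ht).
        lra.
      - rewrite mix_S; fold z s; rewrite Ht2.
        destruct (Hgood (upd z k t)) as [_ Hg].
        + apply pt_upd; assumption.
        + apply nrm_lt; [exact Hd0|]; rewrite vsub_upd, sq_upd by exact Hkn.
          unfold vsub at 2; rewrite Hzk.
          assert (t ^ 2 <= s ^ 2) by (apply pow_maj_Rabs with (n := 2%nat) in Ht1; rewrite pow2_abs in Ht1; exact Ht1).
          lra.
        + set (dd := D k (upd z k t)) in *; change (c t0 k) with (x k) in Hd2; fold s in Hd2.
          replace ((dd * s - (f x - f x)) / h - D k x * c' k)
            with ((dd - D k x) * (s / h) + D k x * (s / h - c' k)) by (field; exact Hh0).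
          assert (He2a : e2 <= 1) by apply Rmin_l.
          assert (He2b : e2 <= eps / (2 * N)) by apply Rmin_r.
          assert (Hsh : Rabs (s / h) <= M).
          { replace (s / h) with (c' k + (s / h - c' k)) by ring.
            eapply Rle_trans; [apply Rabs_triang|]; unfold M; lra. }
          eapply Rle_lt_trans; [apply Rabs_triang|]; rewrite !Rabs_mult.
          assert (A1 : Rabs (dd - D k x) * Rabs (s / h) <= Rabs (dd - D k x) * M)
            by (apply Rmult_le_compat_l; [apply Rabs_pos|exact Hsh]).
          assert (A2 : Rabs (dd - D k x) * M < eps / 2).
          { replace (eps / 2) with (e1 * M) by (unfold e1; field; lra); apply Rmult_lt_compat_r; lra. }
          assert (A3 : Rabs (D k x) * Rabs (s / h - c' k) <= N * (eps / (2 * N))).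
          { apply Rmult_le_compat; try apply Rabs_pos; [unfold N|]; lra. }
          replace (N * (eps / (2 * N))) with (eps / 2) in A3 by (field; lra); lra. }
  apply is_derive_extR with (fun t => f (mix n (c t) x)).
  - intros t; rewrite mix_full by (try apply (Hpt t0); apply Hpt); reflexivity.
  - apply Hstep; lia.
Qed.

(** Inversion in the sphere of squared radius [c] about [x0], of the point whose offset from [x0] is
    [y]. All comparisons below are written in this offset. *)
Definition Tmap (n : nat) (x0 : nat -> R) (c : R) (y : nat -> R) : nat -> R :=
  vadd x0 (smul (c / sq n y) y).

(** The Kelvin transform: for [2 * m = n - 2] the weight is [(sqrt c / |y|)^(n - 2)]. *)
Definition kel (n : nat) (m : R) (x0 : nat -> R) (u : (nat -> R) -> R) (c : R) (y : nat -> R) : R :=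
  Rpower (c / sq n y) m * u (Tmap n x0 c y).

Lemma pt_Tmap (n : nat) (x0 : nat -> R) (c : R) (y : nat -> R) : pt n x0 -> pt n y -> pt n (Tmap n x0 c y).
Proof. intros Hx Hy; apply pt_vadd; [exact Hx|apply pt_smul, Hy]. Qed.

Lemma flim_Tmap {T : Type} (F : (T -> Prop) -> Prop) {FF : Filter F} (n : nat) (x0 : nat -> R)
  (c : T -> R) (Y : T -> nat -> R) (c0 : R) (y0 : nat -> R) :
  pt n x0 -> filterlim c F (locally c0) -> filterlim Y F (locn n y0) -> 0 < sq n y0 ->
  filterlim (fun t => Tmap n x0 (c t) (Y t)) F (locn n (Tmap n x0 c0 y0)) /\
  filterlim (fun t => c t / sq n (Y t)) F (locally (c0 / sq n y0)).
Proof.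
  intros Hx Hc HY Hs.
  assert (Hk : filterlim (fun t => c t / sq n (Y t)) F (locally (c0 / sq n y0))).
  { apply flim_mult; [exact FF|exact Hc|].
    apply (flim_comp F (fun t => sq n (Y t)) Rinv).
    - apply (filterlim_comp _ _ _ Y (sq n) _ _ _ HY (flim_sq0 n y0)).
    - apply continuous_Rinv; lra. }
  split; [|exact Hk]; apply flim_locn; [exact FF| |].
  - intros i Hi; unfold Tmap, vadd, smul; apply flim_plus; [exact FF|apply flim_const, FF|].
    apply flim_mult; [exact FF|exact Hk|].
    apply (filterlim_comp _ _ _ Y (fun y => y i) _ _ _ HY (flim_coord n y0 i Hi)).
  - apply (filter_imp (fun t => pt n (Y t))); [|exact (HY _ (locn_pt n y0))].
    intros t Ht; apply pt_Tmap; assumption.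
Qed.

Lemma flim_kel {T : Type} (F : (T -> Prop) -> Prop) {FF : Filter F} (n : nat) (m : R) (x0 : nat -> R)
  (u : (nat -> R) -> R) (c : T -> R) (Y : T -> nat -> R) (c0 : R) (y0 : nat -> R) :
  pt n x0 -> filterlim c F (locally c0) -> filterlim Y F (locn n y0) -> 0 < sq n y0 -> 0 < c0 ->
  cont_at n u (Tmap n x0 c0 y0) ->
  filterlim (fun t => kel n m x0 u (c t) (Y t)) F (locally (kel n m x0 u c0 y0)).
Proof.
  intros Hx Hc HY Hs Hc0 Hu.
  destruct (flim_Tmap F n x0 c Y c0 y0 Hx Hc HY Hs) as [HT Hk].
  apply flim_mult; [exact FF| |].
  - apply (flim_comp F (fun t => c t / sq n (Y t)) (fun s => Rpower s m)); [exact Hk|].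
    apply continuous_Rpower, Rdiv_lt_0_compat; assumption.
  - apply cont_at_flim in Hu; apply (filterlim_comp _ _ _ _ u _ _ _ HT Hu).
Qed.

Definition C2_at (n : nat) (f : (nat -> R) -> R) (D1 : nat -> (nat -> R) -> R)
  (D2 : nat -> nat -> (nat -> R) -> R) (x : nat -> R) : Prop :=
  C1_at n f D1 x /\ forall i, (i < n)%nat -> C1_at n (D1 i) (D2 i) x.

Lemma C2_punct_at (n : nat) (f : (nat -> R) -> R) (D1 : nat -> (nat -> R) -> R)
  (D2 : nat -> nat -> (nat -> R) -> R) (x : nat -> R) :
  C2_punct_with n f D1 D2 -> pt n x -> 0 < sq n x -> cont_at n f x /\ C2_at n f D1 D2 x.
Proof.
  intros H Hx Hs.
  assert (Hl : locn n x (fun y => pt n y /\ 0 < nrm n y)).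
  { apply filter_and; [apply locn_pt|].
    generalize (flim_gt (locn n x) _ _ _ (flim_sq0 n x) Hs); apply filter_imp; intros y; apply nrm_pos. }
  destruct (H x Hx (proj2 (nrm_pos n x) Hs)) as [H0 H1].
  split; [exact H0|]; split; split.
  - generalize Hl; apply filter_imp; intros y [Hy1 Hy2] k Hk; apply (proj2 (H y Hy1 Hy2)); exact Hk.
  - intros k Hk; apply H1, Hk.
  - generalize Hl; apply filter_imp; intros y [Hy1 Hy2] k Hk.
    destruct (proj2 (H y Hy1 Hy2) i H2) as [_ [_ Hz]]; apply Hz, Hk.
  - intros k Hk; destruct (H1 i H2) as [_ [_ Hz]]; apply Hz, Hk.
Qed.

Lemma C2_at_lap (n : nat) (f : (nat -> R) -> R) (D1 : nat -> (nat -> R) -> R)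
  (D2 : nat -> nat -> (nat -> R) -> R) (x : nat -> R) :
  pt n x -> C2_at n f D1 D2 x -> lap_at n f x (lap n D2 x).
Proof.
  intros Hx [[H1 _] H2].
  exists (fun i t => D1 i (upd x i t)), (fun i => D2 i i x); split; [|reflexivity]; intros i Hi; split.
  - pose proof (flim_upd n i x 0 Hi Hx) as Hu; rewrite upd_0 in Hu.
    apply (filterlim_imp _ _ _ _ _ Hu H1); intros t Ht; apply has_partial_line, Ht, Hi.
  - destruct (H2 i Hi) as [H3 _]; apply (locn_self n x _ Hx) in H3; specialize (H3 i Hi).
    apply has_partial_line; rewrite upd_0; exact H3.
Qed.

Lemma is_derive_rsum (n : nat) (f : nat -> R -> R) (l : nat -> R) (t : R) :
  (forall i, (i < n)%nat -> is_derive (f i) t (l i)) ->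
  is_derive (fun s => rsum n (fun i => f i s)) t (rsum n l).
Proof.
  induction n as [|n IH]; intros H; simpl; [apply (is_derive_const 0)|].
  apply (is_derive_plus (fun s => rsum n (fun i => f i s)) (f n)); [apply IH; intros; apply H; lia|apply H; lia].
Qed.

Lemma is_derive_mulR (f g : R -> R) (t df dg : R) :
  is_derive f t df -> is_derive g t dg -> is_derive (fun s => f s * g s) t (df * g t + f t * dg).
Proof. intros Hf Hg; apply (is_derive_mult f g t df dg Hf Hg), Rmult_comm. Qed.

Lemma is_derive_Rpower (m s : R) : 0 < s -> is_derive (fun t => Rpower t m) s (m / s * Rpower s m).
Proof. intros Hs; unfold Rpower; auto_derive; [exact Hs|field; lra]. Qed.

Section KelvinLine.

(* [r], [b] and [c] stand for [sq n y], [y i] and the squared radius of the sphere: along the line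
   [t |-> y + t e_i], [rho] is the squared norm, [kk] the inversion ratio and [KK] the Kelvin weight. *)
Context (r b c m : R).

Let rho (t : R) : R := r + 2 * b * t + t ^ 2.
Let kk (t : R) : R := c / rho t.
Let kk1 (t : R) : R := - c * (2 * b + 2 * t) / rho t ^ 2.
Let KK (t : R) : R := Rpower (kk t) m.
Let KK1 (t : R) : R := - m * (2 * b + 2 * t) / rho t * KK t.

Lemma kk_derive (t : R) : 0 < rho t -> is_derive kk t (kk1 t).
Proof.
  intros H; unfold kk, kk1, rho in *; auto_derive; [lra|field; lra].
Qed.

Lemma kk1_derive : 0 < r -> is_derive kk1 0 (c / r * (8 * b ^ 2 / r ^ 2 - 2 / r)).
Proof.
  intros H; unfold kk1, rho; auto_derive; [simpl; nra|field; lra].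
Qed.

Lemma KK_derive (t : R) : 0 < c -> 0 < rho t -> is_derive KK t (KK1 t).
Proof.
  intros Hc H; assert (Hk : 0 < kk t) by (apply Rdiv_lt_0_compat; assumption).
  evar_last.
  { apply (is_derive_comp (fun s => Rpower s m) kk t); [apply is_derive_Rpower, Hk|apply kk_derive, H]. }
  unfold KK1, KK, scal; simpl; unfold mult; simpl.
  set (P := Rpower (kk t) m); unfold kk1, kk; field; lra.
Qed.

Lemma KK1_derive : 0 < c -> 0 < r ->
  is_derive KK1 0 (KK 0 * (4 * m * (m + 1) * b ^ 2 / r ^ 2 - 2 * m / r)).
Proof.
  intros Hc H.
  assert (H0 : rho 0 = r) by (unfold rho; ring).
  assert (HK : is_derive KK 0 (KK1 0)) by (apply KK_derive; [exact Hc|rewrite H0; exact H]).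
  unfold KK1 at 1.
  evar_last.
  { apply (is_derive_mulR (fun t => - m * (2 * b + 2 * t) / rho t) KK 0 ((- m * 2 * r + m * 2 * b * (2 * b)) / r ^ 2) (KK1 0)).
    - unfold rho; auto_derive; [lra|]; field; lra.
    - exact HK. }
  unfold KK1, plus, mult; simpl; rewrite H0; field; lra.
Qed.

End KelvinLine.

(** The [i]-th summand is the second derivative of the Kelvin transform along the [i]-th axis. The
    terms in [u] and in [D1] cancel in the sum exactly because [2 m = n - 2]; the Hessian terms
    reduce to the trace because [kron i j - 2 y_i y_j / r] is the matrix of a reflection, hence
    orthogonal. *)
Lemma kel_lap_algebra (n : nat) (m r k K u : R) (y D1 : nat -> R) (D2 : nat -> nat -> R) :
  2 * m = INR n - 2 -> r = sq n y -> 0 < r ->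
  rsum n (fun i =>
    K * (4 * m * (m + 1) * y i ^ 2 / r ^ 2 - 2 * m / r) * u +
    2 * (- m * (2 * y i) / r * K) * rsum n (fun l => D1 l * (k * (kron i l - 2 * y i * y l / r))) +
    K * rsum n (fun l =>
      rsum n (fun j => D2 l j * (k * (kron i j - 2 * y i * y j / r))) * (k * (kron i l - 2 * y i * y l / r)) +
      D1 l * (k * (8 * y i ^ 2 / r ^ 2 - 2 / r) * y l - 4 * k * y i / r * kron i l)))
  = K * k ^ 2 * rsum n (fun i => D2 i i).
Proof.
  intros Hm Hr Hr0.
  set (A := fun i => K * (4 * m * (m + 1) * y i ^ 2 / r ^ 2 - 2 * m / r) * u).
  set (B := fun i l => D1 l * (2 * (- m * (2 * y i) / r * K) * (k * (kron i l - 2 * y i * y l / r)) +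
      K * (k * (8 * y i ^ 2 / r ^ 2 - 2 / r) * y l - 4 * k * y i / r * kron i l))).
  set (C := fun i l j => K * k ^ 2 * (D2 l j * ((kron i j - 2 * y i * y j / r) * (kron i l - 2 * y i * y l / r)))).
  rewrite (rsum_ext n _ (fun i => A i + rsum n (B i) + rsum n (fun l => rsum n (fun j => C i l j)))).
  2:{ intros i Hi; rewrite rsum_plus.
      set (p := fun l => k * (kron i l - 2 * y i * y l / r)).
      set (w := fun l => k * (8 * y i ^ 2 / r ^ 2 - 2 / r) * y l - 4 * k * y i / r * kron i l).
      assert (EB : rsum n (B i) = 2 * (- m * (2 * y i) / r * K) * rsum n (fun l => D1 l * p l) +
        K * rsum n (fun l => D1 l * w l)).
      { rewrite <- !rsum_scal, <- rsum_plus; apply rsum_ext; intros l _; unfold B, p, w; ring. }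
      assert (EC : rsum n (fun l => rsum n (fun j => C i l j)) =
        K * rsum n (fun l => rsum n (fun j => D2 l j * p j) * p l)).
      { rewrite <- rsum_scal; apply rsum_ext; intros l _.
        rewrite (Rmult_comm (rsum n _) (p l)), <- Rmult_assoc, <- rsum_scal.
        apply rsum_ext; intros j _; unfold C, p; ring. }
      rewrite EB, EC; unfold A, p, w; ring. }
  rewrite !rsum_plus.
  assert (Sq : rsum n (fun i => y i ^ 2) = r) by (rewrite Hr; reflexivity).
  assert (EA : rsum n A = 0).
  { unfold A; rewrite (rsum_ext n _ (fun i => (K * 4 * m * (m + 1) / r ^ 2 * u) * y i ^ 2 + (- K * 2 * m / r * u)))
      by (intros; field; lra).
    rewrite rsum_plus, rsum_scal, rsum_const, Sq; replace (INR n) with (2 * m + 2) by lra; field; lra. }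
  assert (EB : rsum n (fun i => rsum n (B i)) = 0).
  { rewrite rsum_swap, (rsum_ext n _ (fun _ => 0)); [rewrite rsum_const; ring|]; intros l Hl; unfold B.
    rewrite (rsum_ext n _ (fun i => (D1 l * K * k * (8 * m + 8) * y l / r ^ 2) * y i ^ 2
       + ((- D1 l * K * k * 2 * y l / r) + kron i l * (- (4 * m + 4) * D1 l * K * k * y i / r))))
      by (intros; field; lra).
    rewrite !rsum_plus, rsum_scal, rsum_const, Sq, (rsum_kron n l (fun i => - (4 * m + 4) * D1 l * K * k * y i / r) Hl).
    replace (INR n) with (2 * m + 2) by lra; field; lra. }
  rewrite EA, EB, !Rplus_0_l, rsum_swap, <- rsum_scal; apply rsum_ext; intros l Hl.
  rewrite rsum_swap; rewrite (rsum_ext n _ (fun j => kron j l * (K * k ^ 2 * D2 l j))).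
  - rewrite (rsum_kron n l (fun j => K * k ^ 2 * D2 l j) Hl); ring.
  - intros j Hj; unfold C.
    rewrite (rsum_ext n _ (fun i => (kron i l * (K * k ^ 2 * D2 l j * (kron i j - 2 * y i * y j / r)))
        + (kron i j * (- K * k ^ 2 * D2 l j * 2 * y i * y l / r) + (K * k ^ 2 * D2 l j * 4 * y j * y l / r ^ 2) * y i ^ 2)))
      by (intros; field; lra).
    rewrite !rsum_plus, rsum_scal, Sq,
      (rsum_kron n l (fun i => K * k ^ 2 * D2 l j * (kron i j - 2 * y i * y j / r)) Hl),
      (rsum_kron n j (fun i => - K * k ^ 2 * D2 l j * 2 * y i * y l / r) Hj), (kron_sym l j).
    field; lra.
Qed.

(** Conformal covariance of the Laplacian. In the exponent [m + 2], [m] is the Kelvin weight and 2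
    comes from the squared dilation factor [c / |y|^2] of the inversion. *)
Lemma kel_lap (n : nat) (m : R) (x0 : nat -> R) (u : (nat -> R) -> R) (D1 : nat -> (nat -> R) -> R)
  (D2 : nat -> nat -> (nat -> R) -> R) (c : R) (y : nat -> R) :
  2 * m = INR n - 2 -> pt n x0 -> pt n y -> 0 < sq n y -> 0 < c ->
  locn n (Tmap n x0 c y) (C2_at n u D1 D2) ->
  lap_at n (kel n m x0 u c) y (Rpower (c / sq n y) (m + 2) * lap n D2 (Tmap n x0 c y)).
Proof.
  intros Hm Hx Hy Hs Hc Hu; set (r := sq n y).
  set (rho := fun i t => r + 2 * y i * t + t ^ 2).
  set (kk := fun i t => c / rho i t).
  set (kk1 := fun i t => - c * (2 * y i + 2 * t) / rho i t ^ 2).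
  set (KK := fun i t => Rpower (kk i t) m).
  set (KK1 := fun i t => - m * (2 * y i + 2 * t) / rho i t * KK i t).
  (* [ga i] is the image of the [i]-th coordinate line under the inversion, and [ga1 i] its
     velocity. *)
  set (ga := fun i t => Tmap n x0 c (upd y i t)).
  set (ga1 := fun i t l => kk1 i t * (y l + t * kron i l) + kk i t * kron i l).
  assert (Hrho : forall i t, (i < n)%nat -> sq n (upd y i t) = rho i t).
  { intros i t Hi; rewrite sq_upd by exact Hi; reflexivity. }
  assert (Hga : forall i t l, (i < n)%nat -> ga i t l = x0 l + kk i t * (y l + t * kron i l)).
  { intros i t l Hi; unfold ga, Tmap, vadd, smul; rewrite Hrho, upd_kron by exact Hi; reflexivity. }
  assert (Hga0 : forall i, ga i 0 = Tmap n x0 c y) by (intros; unfold ga; rewrite upd_0; reflexivity).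
  assert (Hgp : forall i t, (i < n)%nat -> pt n (ga i t)).
  { intros i t Hi; apply pt_Tmap; [exact Hx|apply pt_upd; assumption]. }
  assert (Hrp : forall i, (i < n)%nat -> locally 0 (fun t => 0 < rho i t)).
  { intros i Hi; assert (continuous (rho i) 0) as Hcr
      by (apply (ex_derive_continuous (rho i)); unfold rho; auto_derive; exact I).
    apply (flim_gt (locally 0) (rho i) (rho i 0) 0 Hcr); unfold rho; fold r in Hs; lra. }
  assert (Hgd : forall i t l, (i < n)%nat -> 0 < rho i t -> is_derive (fun t => ga i t l) t (ga1 i t l)).
  { intros i t l Hi Ht; apply is_derive_extR with (fun t => x0 l + kk i t * (y l + t * kron i l)).
    - intros; rewrite Hga by exact Hi; reflexivity.
    - pose proof (kk_derive r (y i) c t Ht) as Hk.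
      fold (rho i t) in Hk; change (is_derive (kk i) t (kk1 i t)) in Hk.
      evar_last.
      { apply (is_derive_plus (fun _ => x0 l) (fun t => kk i t * (y l + t * kron i l)) t 0); [apply (is_derive_const (x0 l))|].
        apply (is_derive_mulR (kk i) (fun t => y l + t * kron i l) t (kk1 i t) (kron i l)); [exact Hk|].
        auto_derive; [exact I|ring]. }
      unfold plus, mult, ga1; simpl; ring. }
  assert (Hgl : forall i, (i < n)%nat -> locally 0 (fun t => C2_at n u D1 D2 (ga i t))).
  { intros i Hi.
    assert (Hl : filterlim (ga i) (locally 0) (locn n (Tmap n x0 c y))).
    { apply flim_locn; [typeclasses eauto| |apply filter_forall; intros; apply Hgp, Hi].
      intros l Hl; rewrite <- (Hga0 i); apply (ex_derive_continuous (fun t => ga i t l)).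
      exists (ga1 i 0 l); apply Hgd; [exact Hi|]; unfold rho; fold r in Hs; lra. }
    apply (Hl _ Hu). }
  exists (fun i t => KK1 i t * u (ga i t) + KK i t * rsum n (fun l => D1 l (ga i t) * ga1 i t l)).
  set (T := Tmap n x0 c y) in *.
  set (k := c / r); set (K := Rpower k m).
  exists (fun i =>
    K * (4 * m * (m + 1) * y i ^ 2 / r ^ 2 - 2 * m / r) * u T +
    2 * (- m * (2 * y i) / r * K) * rsum n (fun l => D1 l T * (k * (kron i l - 2 * y i * y l / r))) +
    K * rsum n (fun l =>
      rsum n (fun j => D2 l j T * (k * (kron i j - 2 * y i * y j / r))) * (k * (kron i l - 2 * y i * y l / r)) +
      D1 l T * (k * (8 * y i ^ 2 / r ^ 2 - 2 / r) * y l - 4 * k * y i / r * kron i l))).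
  fold r in Hs.
  assert (Hk0 : 0 < k) by (apply Rdiv_lt_0_compat; assumption).
  split.
  - intros i Hi; split.
    + generalize (filter_and _ _ (Hrp i Hi) (Hgl i Hi)); apply filter_imp; intros t [Ht1 [Ht2 _]].
      apply is_derive_extR with (fun s => KK i s * u (ga i s)).
      * intros s; unfold kel; rewrite Hrho by exact Hi; reflexivity.
      * evar_last.
        { apply (is_derive_mulR (KK i) (fun s => u (ga i s)) t (KK1 i t)).
          - apply KK_derive; assumption.
          - apply (chain_rule n u D1 (ga i) (ga1 i t)); [intros; apply Hgp, Hi|exact Ht2|].
            intros l Hl; apply Hgd; assumption. }
        unfold plus, mult; simpl; ring.
    + assert (Hr0 : rho i 0 = r) by (unfold rho; ring).
      assert (Hr0' : 0 < rho i 0) by (rewrite Hr0; exact Hs).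
      assert (Hk0' : kk i 0 = k) by (unfold kk; rewrite Hr0; reflexivity).
      assert (Hg1 : forall l, ga1 i 0 l = k * (kron i l - 2 * y i * y l / r)).
      { intros l; unfold ga1; rewrite Hk0'; unfold kk1, k; rewrite Hr0; field; lra. }
      destruct (locn_self n T _ (pt_Tmap n x0 c y Hx Hy) Hu) as [HT1 HT2].
      assert (DU : is_derive (fun t => u (ga i t)) 0 (rsum n (fun l => D1 l T * ga1 i 0 l))).
      { rewrite <- (Hga0 i); apply (chain_rule n u D1 (ga i)); [intros; apply Hgp, Hi|rewrite Hga0; exact HT1|].
        intros l Hl; apply Hgd; assumption. }
      assert (DD : forall l, (l < n)%nat ->
        is_derive (fun t => D1 l (ga i t)) 0 (rsum n (fun j => D2 l j T * ga1 i 0 j))).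
      { intros l Hl; rewrite <- (Hga0 i); apply (chain_rule n (D1 l) (D2 l) (ga i));
          [intros; apply Hgp, Hi|rewrite Hga0; apply HT2, Hl|].
        intros j Hj; apply Hgd; assumption. }
      assert (DG : forall l, is_derive (fun t => ga1 i t l) 0
        (k * (8 * y i ^ 2 / r ^ 2 - 2 / r) * y l - 4 * k * y i / r * kron i l)).
      { intros l; unfold ga1. evar_last.
        { apply (is_derive_plus (fun t => kk1 i t * (y l + t * kron i l)) (fun t => kk i t * kron i l)).
          - apply (is_derive_mulR (kk1 i) (fun t => y l + t * kron i l) 0 (k * (8 * y i ^ 2 / r ^ 2 - 2 / r)) (kron i l));
              [apply kk1_derive, Hs|].
            auto_derive; [exact I|ring].
          - apply (is_derive_mulR (kk i) (fun _ => kron i l) 0 (kk1 i 0) 0);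
              [apply kk_derive, Hr0'|apply (is_derive_const (kron i l))]. }
        unfold plus, mult; simpl; unfold kk1, k; rewrite Hr0; field; lra. }
      evar_last.
      { apply (is_derive_plus (fun t => KK1 i t * u (ga i t))
          (fun t => KK i t * rsum n (fun l => D1 l (ga i t) * ga1 i t l))).
        - apply (is_derive_mulR (KK1 i) (fun t => u (ga i t)) 0
            (KK i 0 * (4 * m * (m + 1) * y i ^ 2 / r ^ 2 - 2 * m / r)));
            [apply KK1_derive; assumption|exact DU].
        - apply (is_derive_mulR (KK i) (fun t => rsum n (fun l => D1 l (ga i t) * ga1 i t l)) 0 (KK1 i 0));
            [apply KK_derive; assumption|].
          apply (is_derive_rsum n (fun l t => D1 l (ga i t) * ga1 i t l)
            (fun l => rsum n (fun j => D2 l j T * ga1 i 0 j) * ga1 i 0 l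
               + D1 l (ga i 0) * (k * (8 * y i ^ 2 / r ^ 2 - 2 / r) * y l - 4 * k * y i / r * kron i l))).
          intros l Hl.
          apply (is_derive_mulR (fun t => D1 l (ga i t)) (fun t => ga1 i t l) 0); [apply DD, Hl|apply DG]. }
      assert (EK : KK i 0 = K) by (unfold KK; rewrite Hk0'; reflexivity).
      assert (EK1 : KK1 i 0 = - m * (2 * y i) / r * K) by (unfold KK1; rewrite Hr0, EK; field; lra).
      rewrite Hga0, EK, EK1; unfold plus, mult; simpl.
      rewrite (rsum_ext n (fun l => D1 l T * ga1 i 0 l) (fun l => D1 l T * (k * (kron i l - 2 * y i * y l / r))))
        by (intros; rewrite Hg1; reflexivity).
      rewrite (rsum_ext n (fun l => rsum n (fun j => D2 l j T * ga1 i 0 j) * ga1 i 0 l + _)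
        (fun l => rsum n (fun j => D2 l j T * (k * (kron i j - 2 * y i * y j / r))) * (k * (kron i l - 2 * y i * y l / r)) +
      D1 l T * (k * (8 * y i ^ 2 / r ^ 2 - 2 / r) * y l - 4 * k * y i / r * kron i l))).
      * simpl; ring.
      * intros l Hl; rewrite Hg1; do 2 f_equal; apply rsum_ext; intros j Hj; rewrite Hg1; reflexivity.
  - rewrite (kel_lap_algebra n m r k K (u T) y (fun l => D1 l T) (fun l j => D2 l j T) Hm eq_refl Hs).
    unfold lap; rewrite Rpower_plus; fold k K; replace (Rpower k 2) with (k ^ 2); [reflexivity|].
    symmetry; exact (Rpower_pow 2 k Hk0).
Qed.

(** * Superharmonic functions on punctured balls *)

Lemma locn_sq_lt (n : nat) (a x : nat -> R) (c : R) :
  sq n (vsub x a) < c -> locn n x (fun y => sq n (vsub y a) < c).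
Proof. apply (flim_lt (locn n x) _ _ _ (flim_sq n a x)). Qed.

Lemma locn_sq_gt (n : nat) (a x : nat -> R) (c : R) :
  c < sq n (vsub x a) -> locn n x (fun y => c < sq n (vsub y a)).
Proof. apply (flim_gt (locn n x) _ _ _ (flim_sq n a x)). Qed.

Lemma locn_sq0_lt (n : nat) (x : nat -> R) (c : R) : sq n x < c -> locn n x (fun y => sq n y < c).
Proof. apply (flim_lt (locn n x) _ _ _ (flim_sq0 n x)). Qed.

Lemma locn_sq0_gt (n : nat) (x : nat -> R) (c : R) : c < sq n x -> locn n x (fun y => c < sq n y).
Proof. apply (flim_gt (locn n x) _ _ _ (flim_sq0 n x)). Qed.

Lemma locn_off_sphere (n : nat) (a x : nat -> R) (r : R) :
  sq n (vsub x a) <> r -> locn n x (fun y => sq n (vsub y a) <> r).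
Proof.
  intros Hne; destruct (Rdichotomy _ _ Hne) as [H|H].
  - generalize (locn_sq_lt n a x r H); apply filter_imp; intros; lra.
  - generalize (locn_sq_gt n a x r H); apply filter_imp; intros; lra.
Qed.

Lemma locn_off_sphere0 (n : nat) (x : nat -> R) (r : R) : sq n x <> r -> locn n x (fun y => sq n y <> r).
Proof.
  intros H; pose proof (locn_off_sphere n zv x r) as H'; rewrite vsub_zv in H'; generalize (H' H).
  apply filter_imp; intros y; rewrite vsub_zv; tauto.
Qed.

Lemma sq_le_double (n : nat) (x a : nat -> R) : sq n x <= 2 * sq n (vsub x a) + 2 * sq n a.
Proof.
  unfold sq; rewrite <- !rsum_scal, <- rsum_plus; apply rsum_le; intros i _; unfold vsub.
  pose proof (pow2_ge_0 (x i - 2 * a i)); nra.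
Qed.

Lemma sq_vsub_eq0 (n : nat) (x y : nat -> R) : pt n x -> pt n y -> sq n (vsub x y) = 0 -> x = y.
Proof.
  intros Hx Hy H; apply sq_zero in H; [|apply pt_vsub; assumption].
  apply functional_extensionality; intros i; apply (f_equal (fun f => f i)) in H; unfold vsub, zv in H; lra.
Qed.

Lemma sq_vsub_self (n : nat) (x : nat -> R) : sq n (vsub x x) = 0.
Proof. rewrite vsub_self; apply sq_zv. Qed.

Lemma Rpower_pos (x y : R) : 0 < Rpower x y.
Proof. apply exp_pos. Qed.

Lemma Rpower_inv_large (m B : R) : 0 < m -> exists e, 0 < e /\ forall s, 0 < s < e -> B < Rpower (1 / s) m.
Proof.
  intros Hm; set (B' := Rabs B + 1).
  assert (HB : 0 < B') by (unfold B'; pose proof (Rabs_pos B); lra).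
  exists (exp (- (ln B' / m))); split; [apply exp_pos|]; intros s [Hs1 Hs2].
  apply Rlt_trans with B'; [unfold B'; pose proof (Rle_abs B); lra|].
  unfold Rpower; rewrite <- (exp_ln B') at 1 by exact HB; apply exp_increasing.
  unfold Rdiv; rewrite Rmult_1_l, ln_Rinv by exact Hs1.
  apply ln_increasing in Hs2; [|exact Hs1]; rewrite ln_exp in Hs2.
  replace (ln B') with (m * (ln B' / m)) by (field; lra); apply Rmult_lt_compat_l; lra.
Qed.

Lemma Rpower_1_l (m : R) : Rpower 1 m = 1.
Proof. unfold Rpower; rewrite ln_1, Rmult_0_r, exp_0; reflexivity. Qed.

(** [|y - b|^(2 - n)], the fundamental solution with pole [b] up to a constant. *)
Definition fund (n : nat) (m : R) (b y : nat -> R) : R := Rpower (1 / sq n (vsub y b)) m.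

(** The fundamental solution is the Kelvin transform of the constant 1 in the unit sphere about its
    pole, so harmonicity is an instance of [kel_lap]. *)
Lemma fund_lap (n : nat) (m : R) (b y : nat -> R) :
  2 * m = INR n - 2 -> pt n b -> pt n y -> 0 < sq n (vsub y b) -> lap_at n (fund n m b) y 0.
Proof.
  intros Hm Hb Hy Hs.
  assert (E : vadd (smul (-1) b) y = vsub y b)
    by (apply functional_extensionality; intros i; unfold vadd, smul, vsub; ring).
  apply lap_at_ext with (fun y => kel n m zv (fun _ => 1) 1 (vadd (smul (-1) b) y)).
  - intros z; unfold fund, kel; replace (vadd (smul (-1) b) z) with (vsub z b); [ring|].
    apply functional_extensionality; intros i; unfold vadd, smul, vsub; ring.
  - apply lap_at_vadd; rewrite E.
    assert (HC1 : forall z, C1_at n (fun _ => 0) (fun _ _ => 0) z).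
    { intros z; split.
      - apply filter_forall; intros t k _; apply is_derive_Reals, (is_derive_const 0).
      - intros k _; apply cont_at_flim, flim_const; typeclasses eauto. }
    pose proof (kel_lap n m zv (fun _ => 1) (fun _ _ => 0) (fun _ _ _ => 0) 1 (vsub y b) Hm (pt_zv n)
      (pt_vsub n y b Hy Hb) Hs Rlt_0_1) as H.
    unfold lap in H; rewrite rsum_const in H.
    replace (Rpower (1 / sq n (vsub y b)) (m + 2) * (INR n * 0)) with 0 in H by ring; apply H.
    apply filter_forall; intros z; split; [|intros; apply HC1]; split.
    + apply filter_forall; intros t k _; apply is_derive_Reals, (is_derive_const 1).
    + intros k _; apply cont_at_flim, flim_const; typeclasses eauto.
Qed.

Lemma fund_cont (n : nat) (m : R) (b y : nat -> R) : 0 < sq n (vsub y b) -> cont_at n (fund n m b) y.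
Proof.
  intros Hs; apply cont_at_flim; unfold fund.
  apply (flim_comp (locn n y) (fun y => 1 / sq n (vsub y b)) (fun s => Rpower s m));
    [|apply continuous_Rpower, Rdiv_lt_0_compat; lra].
  apply flim_mult; [typeclasses eauto|apply flim_const; typeclasses eauto|].
  apply (flim_comp (locn n y) (fun y => sq n (vsub y b)) Rinv); [apply flim_sq|apply continuous_Rinv; lra].
Qed.

Lemma fund_large (n : nat) (m : R) (b : nat -> R) (B : R) :
  0 < m -> locn n b (fun y => 0 < sq n (vsub y b) -> B < fund n m b y).
Proof.
  intros Hm; destruct (Rpower_inv_large m B Hm) as [e [He H]].
  assert (H0 : sq n (vsub b b) < e) by (rewrite sq_vsub_self; exact He).
  generalize (locn_sq_lt n b b _ H0); apply filter_imp.
  intros y Hy Hs; apply H; split; assumption.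
Qed.

Definition super (n : nat) (g : (nat -> R) -> R) (y : nat -> R) : Prop :=
  cont_at n g y /\ exists L, L < 0 /\ lap_at n g y L.

Lemma cont_at_plus (n : nat) (f g : (nat -> R) -> R) (x : nat -> R) :
  cont_at n f x -> cont_at n g x -> cont_at n (fun y => f y + g y) x.
Proof. rewrite !cont_at_flim; intros; apply flim_plus; [typeclasses eauto|assumption|assumption]. Qed.

Lemma cont_at_scal (n : nat) (c : R) (f : (nat -> R) -> R) (x : nat -> R) :
  cont_at n f x -> cont_at n (fun y => c * f y) x.
Proof. rewrite !cont_at_flim; intros; apply flim_scal; [typeclasses eauto|assumption]. Qed.

Lemma cont_at_const (n : nat) (c : R) (x : nat -> R) : cont_at n (fun _ => c) x.
Proof. apply cont_at_flim, flim_const; typeclasses eauto. Qed.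

(** Punctures cannot lower a nonnegative superharmonic function: adding [eta] times the fundamental
    solutions with poles [b1] and [b2] makes it large there, the minimum principle applies, and
    [eta] tends to 0. The two poles may coincide or lie outside the ball. *)
Lemma punctured_ball_min (n : nat) (m : R) (a b1 b2 : nat -> R) (r s : R) (g : (nat -> R) -> R)
  (D := fun y => pt n y /\ sq n (vsub y a) < r /\ 0 < sq n (vsub y b1) /\ 0 < sq n (vsub y b2)) :
  2 * m = INR n - 2 -> 0 < m -> pt n a -> pt n b1 -> pt n b2 ->
  (forall y, D y -> super n g y /\ 0 <= g y) ->
  (forall x, pt n x -> sq n (vsub x a) = r -> forall eps, 0 < eps -> locn n x (fun y => D y -> s - eps < g y)) ->
  forall y, D y -> s <= g y.
Proof.
  intros Hm Hm0 Ha Hb1 Hb2 Hg Hbd y0 Hy0.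
  assert (Heta : forall eta, 0 < eta -> 0 <= g y0 + (eta * (fund n m b1 y0 + fund n m b2 y0) + - s)).
  { intros eta Heta.
    apply (min_principle n (2 * r + 2 * sq n a) D
      (fun y => g y + (eta * (fund n m b1 y + fund n m b2 y) + - s))).
    - intros x [Hx1 [Hx2 [Hx3 Hx4]]]; split; [exact Hx1|split].
      + pose proof (sq_le_double n x a); lra.
      + apply filter_and; [apply locn_pt|].
        apply filter_and; [apply (locn_sq_lt n a x _ Hx2)|].
        apply filter_and; [apply (locn_sq_gt n b1 x _ Hx3)|
          apply (locn_sq_gt n b2 x _ Hx4)].
    - intros x Hx; destruct (Hg x Hx) as [[Hc [L [HL Hlap]]] _]; destruct Hx as [Hx1 [Hx2 [Hx3 Hx4]]]; split.
      + apply cont_at_plus; [exact Hc|]; apply cont_at_plus; [|apply cont_at_const].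
        apply cont_at_scal, cont_at_plus; apply fund_cont; assumption.
      + exists (L + (eta * (0 + 0) + 0)); split; [lra|].
        apply lap_at_plus; [exact Hlap|]; apply lap_at_plus; [|apply lap_at_const].
        apply lap_at_scal, lap_at_plus; apply fund_lap; assumption.
    - intros x Hx HnD eps Heps.
      assert (Hpf : forall b y, 0 < fund n m b y) by (intros; apply Rpower_pos).
      assert (Hpunct : forall b, b = b1 \/ b = b2 -> x = b -> locn n x (fun y : nat -> R => D y ->
        - eps < g y + (eta * (fund n m b1 y + fund n m b2 y) + - s))).
      { intros b Hb ->; generalize (fund_large n m b (s / eta) Hm0); apply filter_imp; intros y Hy HD.
        destruct (Hg y HD) as [_ Hg0]; destruct HD as [_ [_ [Hd1 Hd2]]].
        assert (Hlt : s / eta < fund n m b y) by (apply Hy; destruct Hb as [->| ->]; assumption).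
        assert (s < eta * fund n m b y).
        { replace s with (eta * (s / eta)) by (field; lra); apply Rmult_lt_compat_l; assumption. }
        pose proof (Rmult_lt_0_compat _ _ Heta (Hpf b1 y)); pose proof (Rmult_lt_0_compat _ _ Heta (Hpf b2 y)).
        destruct Hb as [->| ->]; lra. }
      destruct (Rtotal_order (sq n (vsub x a)) r) as [Hr|[Hr|Hr]].
      + destruct (Req_dec (sq n (vsub x b1)) 0) as [E1|E1]; [|destruct (Req_dec (sq n (vsub x b2)) 0) as [E2|E2]].
        * apply (Hpunct b1); [tauto|apply (sq_vsub_eq0 n); assumption].
        * apply (Hpunct b2); [tauto|apply (sq_vsub_eq0 n); assumption].
        * exfalso; apply HnD; pose proof (sq_nonneg n (vsub x b1)); pose proof (sq_nonneg n (vsub x b2)).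
          repeat split; [exact Hx|exact Hr|lra|lra].
      + generalize (Hbd x Hx Hr eps Heps); apply filter_imp; intros y Hy HD; specialize (Hy HD).
        pose proof (Rmult_lt_0_compat _ _ Heta (Hpf b1 y)); pose proof (Rmult_lt_0_compat _ _ Heta (Hpf b2 y)); lra.
      + generalize (locn_sq_gt n a x _ Hr); apply filter_imp.
        intros y Hy [_ [Hc _]]; lra.
    - exact Hy0. }
  destruct (Rle_lt_dec s (g y0)) as [H|H]; [exact H|exfalso].
  set (f := fund n m b1 y0 + fund n m b2 y0) in *.
  assert (Hf : 0 < f) by (unfold f; pose proof (Rpower_pos (1 / sq n (vsub y0 b1)) m);
    pose proof (Rpower_pos (1 / sq n (vsub y0 b2)) m); unfold fund; lra).
  (* With this [eta] the added term is only half of the deficit [s - g y0]. *)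
  specialize (Heta ((s - g y0) / (2 * f)) ltac:(apply Rdiv_lt_0_compat; lra)).
  replace ((s - g y0) / (2 * f) * f) with ((s - g y0) / 2) in Heta by (field; lra); lra.
Qed.

(** * Moving spheres *)

(* With [m = (n - 2) / 2], the exponent [m + 2 = (n + 2) / 2] is the critical one: the last clause is
   strict subcriticality. *)
Definition growth (m : R) (F : R -> R -> R) : Prop :=
  (forall a b, 0 < a -> 0 < b -> 0 < F a b) /\
  (forall a a' b b', 0 < a <= a' -> 0 < b <= b' -> F a b <= F a' b') /\
  (forall k a b, 1 < k -> 0 < a -> 0 < b -> F (Rpower k m * a) (Rpower k m * b) < Rpower k (m + 2) * F a b).

(* The preimage of the origin under [Tmap n x0 c]. *)
Definition zc (n : nat) (x0 : nat -> R) (c : R) : nat -> R := smul (- (c / sq n x0)) x0.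

(** The ball in the offset variable, without the centre and the preimage of the origin. The centre
    appears as [vsub y zv] to match the shape required by [punctured_ball_min]. *)
Definition Dom (n : nat) (x0 : nat -> R) (c : R) (y : nat -> R) : Prop :=
  pt n y /\ sq n y < c /\ 0 < sq n (vsub y zv) /\ 0 < sq n (vsub y (zc n x0 c)).

Lemma Tmap_nonzero (n : nat) (x0 : nat -> R) (c : R) (y : nat -> R) :
  pt n x0 -> pt n y -> 0 < c -> 0 < sq n x0 -> 0 < sq n y ->
  0 < sq n (vsub y (zc n x0 c)) -> 0 < sq n (Tmap n x0 c y).
Proof.
  intros Hx Hy Hc Hx0 Hs Hz.
  destruct (Rle_lt_or_eq_dec 0 _ (sq_nonneg n (Tmap n x0 c y))) as [H|H]; [exact H|exfalso].
  symmetry in H; apply sq_zero in H; [|apply pt_Tmap; assumption].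
  set (k := c / sq n y) in *.
  assert (Hk : 0 < k) by (apply Rdiv_lt_0_compat; assumption).
  assert (E : x0 = smul (- k) y).
  { apply functional_extensionality; intros i; apply (f_equal (fun f => f i)) in H.
    unfold Tmap, vadd, smul, zv in H; fold k in H; unfold smul; lra. }
  assert (E2 : y = zc n x0 c).
  { apply functional_extensionality; intros i; unfold zc; rewrite E, sq_smul; unfold smul, k; field; split; lra. }
  rewrite <- E2, sq_vsub_self in Hz; lra.
Qed.

Lemma Tmap_zc (n : nat) (x0 : nat -> R) (c : R) :
  pt n x0 -> 0 < c -> 0 < sq n x0 -> Tmap n x0 c (zc n x0 c) = zv.
Proof.
  intros Hx Hc Hs; apply functional_extensionality; intros i; unfold Tmap, vadd, zc.
  rewrite sq_smul; unfold smul, zv; field; split; lra.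
Qed.

Lemma sq_zc (n : nat) (x0 : nat -> R) (c : R) : 0 < sq n x0 -> sq n (zc n x0 c) = c ^ 2 / sq n x0.
Proof. intros H; unfold zc; rewrite sq_smul; field; lra. Qed.

Lemma pt_zc (n : nat) (x0 : nat -> R) (c : R) : pt n x0 -> pt n (zc n x0 c).
Proof. intros H; apply pt_smul, H. Qed.

Lemma vadd_nonzero (n : nat) (x0 y : nat -> R) :
  pt n x0 -> pt n y -> sq n y < sq n x0 -> 0 < sq n (vadd x0 y).
Proof.
  intros Hx Hy H; destruct (Rle_lt_or_eq_dec 0 _ (sq_nonneg n (vadd x0 y))) as [H0|H0]; [exact H0|exfalso].
  symmetry in H0; apply sq_zero in H0; [|apply pt_vadd; assumption].
  assert (E : y = smul (-1) x0).
  { apply functional_extensionality; intros i; apply (f_equal (fun f => f i)) in H0.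
    unfold vadd, zv in H0; unfold smul; lra. }
  rewrite E, sq_smul in H; lra.
Qed.

Lemma flim_shift (n : nat) (x0 x : nat -> R) :
  pt n x0 -> pt n x -> filterlim (fun y => vadd x0 y) (locn n x) (locn n (vadd x0 x)).
Proof.
  intros Hx0 Hx; apply flim_locn; [typeclasses eauto| |].
  - intros i Hi; unfold vadd; apply flim_plus; [typeclasses eauto|apply flim_const; typeclasses eauto|apply flim_coord, Hi].
  - generalize (locn_pt n x); apply filter_imp; intros y Hy; apply pt_vadd; assumption.
Qed.

Lemma cont_at_shift (n : nat) (f : (nat -> R) -> R) (x0 x : nat -> R) :
  pt n x0 -> pt n x -> cont_at n f (vadd x0 x) -> cont_at n (fun y => f (vadd x0 y)) x.
Proof.
  rewrite !cont_at_flim; intros H1 H2 H; apply (filterlim_comp _ _ _ _ f _ _ _ (flim_shift n x0 x H1 H2) H).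
Qed.

Lemma flim_fst_right (n : nat) (x : nat -> R) (c : R) :
  filterlim (fun p : R * (nat -> R) => c + fst p) (filter_prod (at_right 0) (locn n x)) (locally c).
Proof.
  apply flim_eps; [typeclasses eauto|]; intros eps He.
  exists (fun t => 0 < t < eps) (fun _ => True); [apply at_right_lt, He|apply filter_true|].
  intros t y Ht _; simpl; apply Rabs_def1; lra.
Qed.

Lemma flim_sqzc {T : Type} (F : (T -> Prop) -> Prop) {FF : Filter F} (n : nat) (x0 : nat -> R)
  (c : T -> R) (Y : T -> nat -> R) (c0 : R) (y0 : nat -> R) :
  filterlim c F (locally c0) -> filterlim Y F (locn n y0) ->
  filterlim (fun t => sq n (vsub (Y t) (zc n x0 (c t)))) F (locally (sq n (vsub y0 (zc n x0 c0)))).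
Proof.
  intros Hc HY.
  refine (flim_rsum F n (fun i t => vsub (Y t) (zc n x0 (c t)) i ^ 2) (fun i => vsub y0 (zc n x0 c0) i ^ 2) _).
  intros i Hi; set (q := x0 i / sq n x0).
  apply filterlim_ext with (fun t => (Y t i + c t * q) * (Y t i + c t * q)).
  { intros t; unfold vsub, zc, smul, q; unfold Rdiv; ring. }
  replace (vsub y0 (zc n x0 c0) i ^ 2) with ((y0 i + c0 * q) * (y0 i + c0 * q))
    by (unfold vsub, zc, smul, q; unfold Rdiv; ring).
  assert (HYi : filterlim (fun t => Y t i) F (locally (y0 i)))
    by exact (filterlim_comp _ _ _ Y (fun y => y i) _ _ _ HY (flim_coord n y0 i Hi)).
  apply flim_mult; [exact FF| |]; (apply flim_plus; [exact FF|exact HYi|];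
    apply flim_mult; [exact FF|exact Hc|apply flim_const, FF]).
Qed.

Lemma derive_left_min (f : R -> R) (a l e : R) :
  is_derive f a l -> 0 < e -> (forall t, a - e < t < a -> f a <= f t) -> l <= 0.
Proof.
  intros Hf He H; destruct (Rle_lt_dec l 0) as [Hl|Hl]; [exact Hl|exfalso].
  apply is_derive_Reals in Hf; destruct (Hf l Hl) as [d Hd].
  set (h := Rmin e d / 2).
  assert (Hh : 0 < h /\ h < e /\ h < d).
  { pose proof (cond_pos d); pose proof (Rmin_l e d); pose proof (Rmin_r e d).
    assert (0 < Rmin e d) by (apply Rmin_pos; assumption); unfold h; lra. }
  specialize (Hd (- h) ltac:(lra) ltac:(rewrite Rabs_Ropp, Rabs_right; lra)).
  specialize (H (a + - h) ltac:(lra)); apply Rabs_def2 in Hd.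
  assert (0 < (f (a + - h) - f a) / - h) by lra.
  assert ((f (a + - h) - f a) / - h <= 0); [|lra].
  unfold Rdiv; rewrite Rinv_opp; assert (0 < / h) by (apply Rinv_0_lt_compat; lra); nra.
Qed.

Lemma derive_right_min (f : R -> R) (a l e : R) :
  is_derive f a l -> 0 < e -> (forall t, a < t < a + e -> f a <= f t) -> 0 <= l.
Proof.
  intros Hf He H.
  assert (- l <= 0); [|lra]; apply (derive_left_min (fun t => f (- t)) (- a) (- l) e); [|exact He|].
  - evar_last; [apply (is_derive_comp f (fun t => - t) (- a) l (-1))|].
    + rewrite Ropp_involutive; exact Hf.
    + auto_derive; [exact I|ring].
    + unfold scal; simpl; unfold mult; simpl; ring.
  - intros t Ht; rewrite Ropp_involutive; apply H; lra.
Qed.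

Section MovingSpheres.

Context (n : nat) (m : R) (Hm : 2 * m = INR n - 2) (Hm0 : 0 < m).
Context (F : R -> R -> R) (HF : growth m F).
Context (u v : (nat -> R) -> R) (D1 : nat -> (nat -> R) -> R) (D2 : nat -> nat -> (nat -> R) -> R).
Context (HC2 : C2_punct_with n u D1 D2).
Context (Hpos : forall x, pt n x -> 0 < sq n x -> 0 < u x /\ 0 < v x).
Context (Heq : forall x, pt n x -> 0 < sq n x -> lap n D2 x = - F (u x) (v x)).
Context (x0 : nat -> R) (Hx0 : pt n x0) (Hs0 : 0 < sq n x0).

Let K (c : R) (y : nat -> R) : R := kel n m x0 u c y.

Lemma u_cont (x : nat -> R) : pt n x -> 0 < sq n x -> cont_at n u x.
Proof. intros H1 H2; apply (proj1 (C2_punct_at n u D1 D2 x HC2 H1 H2)). Qed.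

Lemma u_C2_near (x : nat -> R) : pt n x -> 0 < sq n x -> locn n x (C2_at n u D1 D2).
Proof.
  intros H1 H2.
  generalize (filter_and _ _ (locn_pt n x) (locn_sq0_gt n x _ H2)); apply filter_imp.
  intros y [Hy1 Hy2]; apply (C2_punct_at n u D1 D2 y HC2 Hy1 Hy2).
Qed.

Lemma kel_pos (c : R) (y : nat -> R) : pt n y -> 0 < sq n (Tmap n x0 c y) -> 0 < K c y.
Proof.
  intros Hy HT; apply Rmult_lt_0_compat; [apply Rpower_pos|].
  apply Hpos; [apply pt_Tmap; assumption|exact HT].
Qed.

Lemma kel_super (c : R) (y : nat -> R) :
  pt n y -> 0 < c -> 0 < sq n y -> 0 < sq n (Tmap n x0 c y) -> super n (K c) y.
Proof.
  intros Hy Hc Hs HT; assert (HpT := pt_Tmap n x0 c y Hx0 Hy); split.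
  - apply cont_at_flim; unfold K; apply (flim_kel (locn n y) n m x0 u (fun _ => c) (fun y => y)); try assumption.
    + apply flim_const; typeclasses eauto.
    + apply filterlim_id.
    + apply u_cont; assumption.
  - exists (Rpower (c / sq n y) (m + 2) * lap n D2 (Tmap n x0 c y)); split.
    + rewrite Heq by assumption; destruct (Hpos _ HpT HT) as [Hu Hv]; destruct HF as [HF1 _].
      pose proof (HF1 _ _ Hu Hv); pose proof (Rpower_pos (c / sq n y) (m + 2)); nra.
    + apply (kel_lap n m x0 u D1 D2 c y); try assumption; apply u_C2_near; assumption.
Qed.

Lemma Dom_facts (c : R) (y : nat -> R) :
  0 < c < sq n x0 -> Dom n x0 c y ->
  pt n y /\ 0 < sq n y < c /\ 0 < sq n (Tmap n x0 c y) /\ 0 < sq n (vadd x0 y).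
Proof.
  intros Hc [H1 [H2 [H3 H4]]]; rewrite vsub_zv in H3; repeat split; try assumption.
  - apply Tmap_nonzero; try assumption; lra.
  - apply vadd_nonzero; [assumption|assumption|lra].
Qed.

Lemma Dom_open (c : R) (y : nat -> R) : Dom n x0 c y -> locn n y (Dom n x0 c).
Proof.
  intros [H1 [H2 [H3 H4]]].
  apply filter_and; [apply locn_pt|].
  apply filter_and; [apply (locn_sq0_lt n y _ H2)|].
  apply filter_and; [apply (locn_sq_gt n zv y _ H3)|
    apply (locn_sq_gt n _ y _ H4)].
Qed.

(** Both components are compared at once, because the superharmonicity of one difference uses the
    ordering of the other. The conclusions of this section concern [u]; those for [v] follow by
    exchanging the roles. *)
Definition below (c : R) : Prop :=
  forall y, Dom n x0 c y -> u (vadd x0 y) <= K c y /\ v (vadd x0 y) <= kel n m x0 v c y.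

Let w (c : R) (y : nat -> R) : R := K c y + (-1) * u (vadd x0 y).

(** Put [k = c / |y|^2 > 1] and let u', v' be the values at the reflected point. Monotonicity and
    then subcriticality give [F(u, v) <= F(k^m u', k^m v') < k^(m+2) F(u', v')], and the Laplacian
    of the difference is the first minus the last. *)
Lemma w_super (c : R) (y : nat -> R) : 0 < c < sq n x0 -> below c -> Dom n x0 c y -> super n (w c) y.
Proof.
  intros Hc HP HD; destruct (HP y HD) as [HPu HPv]; destruct (Dom_facts c y Hc HD) as [H1 [H2 [H3 H4]]].
  assert (HpT := pt_Tmap n x0 c y Hx0 H1); assert (Hpa := pt_vadd n x0 y Hx0 H1).
  split.
  - apply cont_at_plus; [apply kel_super; try assumption; lra|].
    apply cont_at_scal, cont_at_shift; [exact Hx0|exact H1|apply u_cont; assumption].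
  - exists (Rpower (c / sq n y) (m + 2) * lap n D2 (Tmap n x0 c y) + (-1) * lap n D2 (vadd x0 y)); split.
    + rewrite !Heq by assumption.
      destruct (Hpos _ HpT H3) as [Hu Hv]; destruct (Hpos _ Hpa H4) as [Hu' Hv'].
      destruct HF as [_ [HF2 HF3]].
      assert (Hk : 1 < c / sq n y) by (apply Rlt_div_r; lra).
      pose proof (HF3 _ _ _ Hk Hu Hv) as Hlt.
      assert (Hle := HF2 (u (vadd x0 y)) (Rpower (c / sq n y) m * u (Tmap n x0 c y)) (v (vadd x0 y))
        (Rpower (c / sq n y) m * v (Tmap n x0 c y)) (conj Hu' HPu) (conj Hv' HPv)); lra.
    + apply lap_at_plus; [apply (kel_lap n m x0 u D1 D2 c y); try assumption; [lra|lra|apply u_C2_near; assumption]|].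
      apply lap_at_scal, lap_at_vadd, (C2_at_lap n u D1 D2); [exact Hpa|].
      apply (C2_punct_at n u D1 D2); assumption.
Qed.

(** A zero of the nonnegative [w] would be an interior minimum, against its negative Laplacian. *)
Lemma w_pos (c : R) (y : nat -> R) : 0 < c < sq n x0 -> below c -> Dom n x0 c y -> 0 < w c y.
Proof.
  intros Hc HP HD.
  assert (Hge : forall z, Dom n x0 c z -> 0 <= w c z) by (intros z Hz; destruct (HP z Hz); unfold w; lra).
  destruct (Rle_lt_or_eq_dec _ _ (Hge y HD)) as [H|H]; [exact H|exfalso].
  destruct (w_super c y Hc HP HD) as [_ [L [HL Hlap]]].
  assert (0 <= L); [|lra]; apply (lap_at_min n (w c) y L); [apply HD| |exact Hlap].
  generalize (Dom_open c y HD); apply filter_imp; intros z Hz; rewrite <- H; apply Hge, Hz.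
Qed.

(** The derivative at [k = 1] of [k^m u(x0 + k y)]. Its positivity on the sphere is the
    infinitesimal form of the comparison. *)
Definition Psi (y : nat -> R) : R := m * u (vadd x0 y) + rsum n (fun k => D1 k (vadd x0 y) * y k).

Lemma Psi_cont (y : nat -> R) : pt n y -> 0 < sq n (vadd x0 y) ->
  filterlim Psi (locn n y) (locally (Psi y)).
Proof.
  intros Hy Hs; assert (Hp := pt_vadd n x0 y Hx0 Hy).
  destruct (C2_punct_at n u D1 D2 _ HC2 Hp Hs) as [Hc [[_ Hd] _]].
  apply flim_plus; [typeclasses eauto| |].
  - apply flim_scal; [typeclasses eauto|]; apply (proj1 (cont_at_flim n (fun y => u (vadd x0 y)) y)), cont_at_shift; assumption.
  - apply (flim_rsum (locn n y) n (fun k y => D1 k (vadd x0 y) * y k)); intros k Hk.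
    apply flim_mult; [typeclasses eauto| |apply flim_coord, Hk].
    apply (proj1 (cont_at_flim n (fun y => D1 k (vadd x0 y)) y)), cont_at_shift; [assumption|assumption|apply Hd, Hk].
Qed.

Lemma smul_1 (y : nat -> R) : smul 1 y = y.
Proof. apply functional_extensionality; intros i; unfold smul; ring. Qed.

Lemma ray_derive (y : nat -> R) (k : R) : pt n y -> 0 < k -> 0 < sq n (vadd x0 (smul k y)) ->
  is_derive (fun k => Rpower k m * u (vadd x0 (smul k y))) k (Rpower k m / k * Psi (smul k y)).
Proof.
  intros Hy Hk Hs; assert (Hp := pt_vadd n x0 _ Hx0 (pt_smul n k y Hy)).
  evar_last.
  { apply (is_derive_mulR (fun k => Rpower k m) (fun k => u (vadd x0 (smul k y))) k); [apply is_derive_Rpower, Hk|].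
    apply (chain_rule n u D1 (fun k => vadd x0 (smul k y)) y).
    - intros t; apply pt_vadd; [exact Hx0|apply pt_smul, Hy].
    - apply (C2_punct_at n u D1 D2 _ HC2 Hp Hs).
    - intros l Hl; unfold vadd, smul; auto_derive; [exact I|ring]. }
  unfold plus, mult, Psi; simpl.
  rewrite (rsum_ext n (fun l => D1 l _ * smul k y l) (fun l => k * (D1 l (vadd x0 (smul k y)) * y l)))
    by (intros; unfold smul; ring).
  rewrite rsum_scal; field; lra.
Qed.

Lemma ray_mono (y : nat -> R) (k : R) : pt n y -> 1 <= k ->
  (forall t, 1 <= t <= k -> 0 < sq n (vadd x0 (smul t y)) /\ 0 < Psi (smul t y)) ->
  u (vadd x0 y) <= Rpower k m * u (vadd x0 (smul k y)).
Proof.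
  intros Hy Hk H.
  assert (E : Rpower 1 m * u (vadd x0 (smul 1 y)) = u (vadd x0 y)).
  { rewrite smul_1, Rpower_1_l; ring. }
  rewrite <- E; destruct (Rle_lt_or_eq_dec 1 k Hk) as [Hlt|<-]; [|lra].
  destruct (MVT_cor2 (fun k => Rpower k m * u (vadd x0 (smul k y)))
    (fun k => Rpower k m / k * Psi (smul k y)) 1 k Hlt) as [t [Ht1 Ht2]].
  - intros t Ht; apply is_derive_Reals, ray_derive; [exact Hy|lra|apply H, Ht].
  - assert (0 < Rpower t m / t * Psi (smul t y)).
    { apply Rmult_lt_0_compat; [apply Rdiv_lt_0_compat; [apply Rpower_pos|lra]|apply H; lra]. }
    nra.
Qed.

(** The Kelvin transform at [y] is [k^m u(x0 + k y)] at [k = c / |y|^2], while [u(x0 + y)] is its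
    value at [k = 1]: the comparison is a statement along a ray and follows from [Psi > 0] on the
    segment between. *)
Lemma kel_ray (c : R) (y : nat -> R) : K c y = Rpower (c / sq n y) m * u (vadd x0 (smul (c / sq n y) y)).
Proof. reflexivity. Qed.

(** [c ^ 2 / sq n x0] is the squared norm of the puncture [zc], so the outer half of the annulus
    between it and the sphere contains no puncture. *)
Lemma annulus_Dom (c : R) (y : nat -> R) : 0 < c < sq n x0 -> pt n y ->
  (c ^ 2 / sq n x0 + c) / 2 <= sq n y < c -> Dom n x0 c y.
Proof.
  intros Hc Hy [H1 H2].
  assert (Hz : 0 < c ^ 2 / sq n x0) by (apply Rdiv_lt_0_compat; [apply pow_lt|]; lra).
  assert (Hz' : c ^ 2 / sq n x0 < c) by (apply Rlt_div_l; nra).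
  repeat split; [exact Hy|exact H2|rewrite vsub_zv; lra|].
  destruct (Rle_lt_or_eq_dec 0 _ (sq_nonneg n (vsub y (zc n x0 c)))) as [H|H]; [exact H|exfalso].
  symmetry in H; apply sq_vsub_eq0 in H; [|exact Hy|apply pt_zc, Hx0].
  rewrite H, sq_zc in H1 by exact Hs0; lra.
Qed.

Lemma kel_sphere (c : R) (x : nat -> R) : 0 < c -> sq n x = c -> K c x = u (vadd x0 x).
Proof.
  intros Hc Hx; rewrite kel_ray, Hx; replace (c / c) with 1 by (field; lra).
  rewrite smul_1, Rpower_1_l; ring.
Qed.

(** Hopf's lemma. On an annulus [w] dominates a multiple of the harmonic barrier
    [|y|^(2-n) - c^(-m)], which vanishes on the outer sphere with nonzero slope. As [w] vanishes
    there too and has derivative [-2 Psi x] along [t |-> t x] at [t = 1], [Psi x] is positive. *)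
Lemma hopf (c : R) (x : nat -> R) :
  0 < c < sq n x0 -> below c -> pt n x -> sq n x = c -> 0 < Psi x.
Proof.
  intros Hc HP Hx Hxc.
  set (r1 := (c ^ 2 / sq n x0 + c) / 2).
  assert (Hz : 0 < c ^ 2 / sq n x0) by (apply Rdiv_lt_0_compat; [apply pow_lt|]; lra).
  assert (Hz' : c ^ 2 / sq n x0 < c) by (apply Rlt_div_l; nra).
  assert (Hr1 : 0 < r1 < c) by (unfold r1; lra).
  assert (HDom : forall y, pt n y -> r1 <= sq n y < c -> Dom n x0 c y)
    by (intros y H1 H2; apply annulus_Dom; assumption).
  destruct (compact_pos_bound n r1 (fun y => sq n y = r1) (w c)) as [s [Hs Hws]].
  { intros y Hy Hys; assert (HD : Dom n x0 c y) by (apply HDom; [exact Hy|lra]); split; [lra|split].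
    - apply w_super; assumption.
    - apply w_pos; assumption. }
  { intros y Hy Hne; apply locn_off_sphere0, Hne. }
  set (C := Rpower (1 / c) m); set (h1 := Rpower (1 / r1) m - C).
  assert (HC : 0 < C) by apply Rpower_pos.
  assert (Hh1 : 0 < h1).
  { unfold h1, C; assert (Rpower (1 / c) m < Rpower (1 / r1) m); [|lra].
    apply Rlt_Rpower_l; [exact Hm0|split; [apply Rdiv_lt_0_compat; lra|]].
    unfold Rdiv; rewrite !Rmult_1_l; apply Rinv_lt_contravar; [nra|lra]. }
  (* The barrier then equals [s], a lower bound of [w c], on the inner sphere. *)
  set (e := s / h1); assert (He : 0 < e) by (apply Rdiv_lt_0_compat; assumption).
  set (g := fun y => w c y + ((- e) * fund n m zv y + e * C)).
  assert (Hmain : forall y, pt n y /\ r1 < sq n y /\ sq n y < c -> 0 <= g y).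
  { apply (min_principle n c (fun y => pt n y /\ r1 < sq n y /\ sq n y < c) g).
    - intros y [H1 [H2 H3]]; split; [exact H1|split; [lra|]].
      apply filter_and; [apply locn_pt|]; apply filter_and;
        [apply (locn_sq0_gt n y _ H2)|apply (locn_sq0_lt n y _ H3)].
    - intros y [H1 [H2 H3]]; assert (HD : Dom n x0 c y) by (apply HDom; [exact H1|lra]).
      assert (Hy0 : 0 < sq n (vsub y zv)) by (rewrite vsub_zv; lra).
      destruct (w_super c y Hc HP HD) as [Hcont [L [HL Hlap]]]; split.
      + apply cont_at_plus; [exact Hcont|]; apply cont_at_plus; [|apply cont_at_const].
        apply cont_at_scal, fund_cont, Hy0.
      + exists (L + ((- e) * 0 + 0)); split; [lra|].
        apply lap_at_plus; [exact Hlap|]; apply lap_at_plus; [|apply lap_at_const].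
        apply lap_at_scal, fund_lap; [assumption|apply pt_zv|assumption|exact Hy0].
    - intros y Hy HnD eps Heps.
      assert (Hlim : cont_at n (w c) y -> 0 <= g y -> 0 < sq n y ->
        locn n y (fun z => pt n z /\ r1 < sq n z /\ sq n z < c -> - eps < g z)).
      { intros Hcont Hgy Hsy.
        assert (Hgc : cont_at n g y).
        { apply cont_at_plus; [exact Hcont|]; apply cont_at_plus; [|apply cont_at_const].
          apply cont_at_scal, fund_cont; rewrite vsub_zv; exact Hsy. }
        apply cont_at_flim in Hgc.
        generalize (flim_gt (locn n y) g (g y) (- eps) Hgc ltac:(lra)); apply filter_imp; tauto. }
      destruct (Rtotal_order (sq n y) r1) as [H1|[H1|H1]].
      + generalize (locn_sq0_lt n y _ H1); apply filter_imp; intros; lra.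
      + assert (HD : Dom n x0 c y) by (apply HDom; [exact Hy|lra]).
        apply Hlim; [apply w_super; assumption| |lra].
        pose proof (Hws y Hy H1) as Hw; unfold g, fund; rewrite vsub_zv, H1.
        replace s with (e * h1) in Hw by (unfold e; field; lra); unfold h1 in Hw; lra.
      + destruct (Rtotal_order (sq n y) c) as [H2|[H2|H2]].
        * exfalso; apply HnD; repeat split; assumption.
        * assert (Hv0 : 0 < sq n (vadd x0 y)) by (apply vadd_nonzero; [assumption|assumption|lra]).
          apply Hlim; [| |lra].
          -- apply cont_at_plus.
             ++ apply kel_super; [exact Hy|lra|lra|].
                unfold Tmap; rewrite H2; replace (c / c) with 1 by (field; lra); rewrite smul_1; exact Hv0.
             ++ apply cont_at_scal, cont_at_shift; [exact Hx0|exact Hy|].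
                apply u_cont; [apply pt_vadd; assumption|exact Hv0].
          -- unfold g, w, fund; rewrite kel_sphere by (try exact H2; lra).
             rewrite vsub_zv, H2; fold C; lra.
        * generalize (locn_sq0_gt n y _ H2); apply filter_imp; intros; lra. }
  set (H := fun k => Rpower k m * u (vadd x0 (smul k x))).
  (* Divided by [t^(-m)], the inequality [0 <= g (t x)] becomes [G t <= G (1 / t)] for [t < 1] near
     1. The difference vanishes at [t = 1] with derivative [-2 G'(1)], hence
     [0 <= G'(1) = Psi x - e C m]. *)
  set (G := fun k => H k - e * C * Rpower k m).
  assert (HG : is_derive G 1 (Psi x - e * C * m)).
  { evar_last.
    { apply (is_derive_minus H (fun k => e * C * Rpower k m) 1).
      - apply ray_derive; [exact Hx|lra|]; rewrite smul_1; apply vadd_nonzero; [assumption|assumption|lra].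
      - apply (is_derive_scal (fun k => Rpower k m) 1 (e * C)), is_derive_Rpower; lra. }
    rewrite smul_1; unfold minus, plus, opp, mult; simpl.
    rewrite Rpower_1_l; field. }
  assert (Hr : r1 / c < 1) by (apply Rlt_div_l; lra).
  assert (Hr' : 0 < r1 / c) by (apply Rdiv_lt_0_compat; lra).
  assert (Hle : (- 1) * (Psi x - e * C * m) - (Psi x - e * C * m) <= 0).
  { apply (derive_left_min (fun t => G (/ t) - G t) 1 _ ((1 - r1 / c) / 2)); [|lra|].
    - apply (is_derive_minus (fun t => G (/ t)) G 1); [|exact HG].
      apply (is_derive_comp G Rinv 1); [rewrite Rinv_1; exact HG|].
      auto_derive; [lra|field].
    - intros t Ht; rewrite Rinv_1; replace (G 1 - G 1) with 0 by ring.
      assert (Ht0 : 0 < t) by lra.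
      assert (Htc : r1 < t ^ 2 * c).
      { replace r1 with (r1 / c * c) by (field; lra); apply Rmult_lt_compat_r; [lra|].
        assert (r1 / c < 2 * t - 1) by lra; pose proof (pow2_ge_0 (t - 1)); lra. }
      assert (Ht2 : t ^ 2 < 1) by (simpl; assert (0 < (1 - t) * (1 + t)) by (apply Rmult_lt_0_compat; lra); lra).
      assert (Htc' : t ^ 2 * c < 1 * c) by (apply Rmult_lt_compat_r; lra).
      assert (Hsq : sq n (smul t x) = t ^ 2 * c) by (rewrite sq_smul, Hxc; reflexivity).
      specialize (Hmain (smul t x)).
      assert (Hg : 0 <= g (smul t x)) by (apply Hmain; repeat split; [apply pt_smul, Hx|lra|lra]).
      set (P := Rpower (/ t) m).
      assert (HP0 : 0 < P) by apply Rpower_pos.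
      assert (HPt : P * Rpower t m = 1).
      { unfold P; rewrite Rpower_mult_distr by (try apply Rinv_0_lt_compat; lra).
        rewrite Rinv_l by lra; apply Rpower_1_l. }
      assert (EK : K c (smul t x) = P * H (/ t)).
      { rewrite kel_ray, Hsq; replace (c / (t ^ 2 * c)) with (/ t * / t) by (field; lra).
        rewrite <- Rpower_mult_distr by (apply Rinv_0_lt_compat; lra); unfold H; fold P.
        replace (smul (/ t * / t) (smul t x)) with (smul (/ t) x); [ring|].
        apply functional_extensionality; intros i; unfold smul; field; lra. }
      assert (Eu : u (vadd x0 (smul t x)) = P * H t).
      { unfold H; rewrite <- Rmult_assoc, HPt; ring. }
      assert (EF : fund n m zv (smul t x) = P * P * C).
      { unfold fund, P, C; rewrite vsub_zv, Hsq, !Rpower_mult_distr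
          by (repeat apply Rmult_lt_0_compat; try apply Rdiv_lt_0_compat; try apply Rinv_0_lt_compat; lra).
        f_equal; field; lra. }
      unfold g, w in Hg; rewrite EK, Eu, EF in Hg; unfold minus, plus, opp, G; simpl; fold P.
      assert (HQ : 0 <= P * (H (/ t) + - H t - e * C * P + e * C * Rpower t m)).
      { replace (P * (H (/ t) + - H t - e * C * P + e * C * Rpower t m))
          with (P * H (/ t) - P * H t - e * C * (P * P) + e * C * (P * Rpower t m)) by ring.
        rewrite HPt; lra. }
      assert (0 <= H (/ t) + - H t - e * C * P + e * C * Rpower t m); [|lra].
      apply (Rmult_le_reg_l P); [exact HP0|rewrite Rmult_0_r; exact HQ]. }
  assert (0 < e * C * m) by (apply Rmult_lt_0_compat; [apply Rmult_lt_0_compat|]; assumption); lra.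
Qed.

Lemma flim_smul {T : Type} (FT : (T -> Prop) -> Prop) {FF : Filter FT} (k : T -> R) (Y : T -> nat -> R)
  (k0 : R) (y0 : nat -> R) :
  filterlim k FT (locally k0) -> filterlim Y FT (locn n y0) ->
  filterlim (fun t => smul (k t) (Y t)) FT (locn n (smul k0 y0)).
Proof.
  intros Hk HY; apply flim_locn; [exact FF| |].
  - intros i Hi; unfold smul; apply flim_mult; [exact FF|exact Hk|].
    exact (filterlim_comp _ _ _ Y (fun y => y i) _ _ _ HY (flim_coord n y0 i Hi)).
  - apply (filter_imp (fun t => pt n (Y t))); [intros t Ht; apply pt_smul, Ht|exact (HY _ (locn_pt n y0))].
Qed.

(** Convexity of the squared distance: [Hc] writes its value at [t] as the interpolation of the
    values at 1 and [k] minus a nonnegative term. *)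
Lemma segment_in_ball (x y : nat -> R) (d k t : R) :
  1 <= t <= k -> sq n (vsub y x) < d -> sq n (vsub (smul k y) x) < d -> sq n (vsub (smul t y) x) < d.
Proof.
  intros Ht H1 Hk; rewrite sq_vsub in H1; rewrite sq_vsub, sq_smul, dot_smul_l in Hk |- *.
  set (A := sq n y) in *; set (B := dot n y x) in *; set (E := sq n x) in *.
  assert (HA : 0 <= A) by apply sq_nonneg.
  destruct (Rle_lt_or_eq_dec 1 k ltac:(lra)) as [Hlt|Heqk].
  - assert (Hc : (k - 1) * (t ^ 2 * A - 2 * (t * B) + E) =
      (k - t) * (A - 2 * B + E) + (t - 1) * (k ^ 2 * A - 2 * (k * B) + E) - A * ((k - 1) * (k - t) * (t - 1))) by ring.
    assert (0 <= A * ((k - 1) * (k - t) * (t - 1))) by (repeat apply Rmult_le_pos; lra).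
    apply (Rmult_lt_reg_l (k - 1)); [lra|]; rewrite Hc.
    assert ((k - t) * (A - 2 * B + E) <= (k - t) * d) by (apply Rmult_le_compat_l; lra).
    assert ((t - 1) * (k ^ 2 * A - 2 * (k * B) + E) <= (t - 1) * d) by (apply Rmult_le_compat_l; lra).
    destruct (Req_dec t 1) as [->|Hne]; [|assert ((t - 1) * (k ^ 2 * A - 2 * (k * B) + E) < (t - 1) * d)
      by (apply Rmult_lt_compat_l; lra); lra].
    assert ((k - 1) * (A - 2 * B + E) < (k - 1) * d) by (apply Rmult_lt_compat_l; lra); lra.
  - assert (t = 1) by lra; subst t; lra.
Qed.

(** By [hopf], [Psi] is positive near [x]. For small [t] and [y] near [x] the ratio
    [(c + t) / |y|^2] is close to 1, so the ray segment from [y] to its multiple stays in that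
    neighbourhood and [ray_mono] applies. *)
Lemma extend_sphere (c : R) (x : nat -> R) :
  0 < c < sq n x0 -> below c -> pt n x -> sq n x = c ->
  filter_prod (at_right 0) (locn n x)
    (fun p => Dom n x0 (c + fst p) (snd p) -> u (vadd x0 (snd p)) <= K (c + fst p) (snd p)).
Proof.
  intros Hc HP Hx Hxc; pose proof (hopf c x Hc HP Hx Hxc) as Hpsi.
  assert (Hv0 : 0 < sq n (vadd x0 x)) by (apply vadd_nonzero; [assumption|assumption|lra]).
  pose proof (flim_gt (locn n x) _ _ _ (Psi_cont x Hx Hv0) Hpsi) as L1.
  assert (L2 : locn n x (fun y => 0 < sq n (vadd x0 y))).
  { pose proof (filterlim_comp _ _ _ _ _ _ _ _ (flim_shift n x0 x Hx0 Hx) (flim_sq0 n (vadd x0 x))) as E2.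
    apply (flim_gt (locn n x) _ _ 0 E2 Hv0). }
  destruct (filter_and _ _ L1 L2) as [d [Hd Hball]].
  assert (Hd2 : 0 < d ^ 2) by (apply pow_lt, Hd).
  assert (Hxx : sq n (vsub x x) < d ^ 2) by (rewrite sq_vsub_self; exact Hd2).
  set (FT := filter_prod (at_right 0) (locn n x)).
  assert (Hsnd : filterlim snd FT (locn n x)) by apply filterlim_snd.
  assert (Hk : filterlim (fun p => (c + fst p) / sq n (snd p)) FT (locally 1)).
  { replace 1 with (c / sq n x) by (rewrite Hxc; field; lra).
    apply (flim_Tmap FT n x0 (fun p => c + fst p) snd c x Hx0 (flim_fst_right n x c) Hsnd); lra. }
  pose proof (flim_smul FT _ _ _ _ Hk Hsnd) as Hky; rewrite smul_1 in Hky.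
  assert (B1 : FT (fun p => sq n (vsub (snd p) x) < d ^ 2)).
  { apply (filterlim_imp FT (locn n x) snd _ _ Hsnd (locn_sq_lt n x x _ Hxx)); tauto. }
  assert (B2 : FT (fun p => sq n (vsub (smul ((c + fst p) / sq n (snd p)) (snd p)) x) < d ^ 2)).
  { apply (filterlim_imp FT (locn n x) _ _ _ Hky (locn_sq_lt n x x _ Hxx)); tauto. }
  generalize (filter_and _ _ B1 B2); apply filter_imp; intros [t y] [H1 H2] HD; simpl in *.
  assert (Hy : pt n y) by apply HD.
  assert (Hsy : 0 < sq n y < c + t) by (destruct HD as [_ [Ha [Hb _]]]; rewrite vsub_zv in Hb; lra).
  rewrite kel_ray; apply ray_mono; [exact Hy| |].
  - apply Rle_div_r; lra.
  - intros s Hs; apply and_comm, Hball; [apply pt_smul, Hy|].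
    apply nrm_lt; [exact Hd|]; apply (segment_in_ball x y (d ^ 2) ((c + t) / sq n y)); assumption.
Qed.

Lemma flim_kel_right (c : R) (x : nat -> R) :
  0 < c -> pt n x -> 0 < sq n x -> 0 < sq n (Tmap n x0 c x) ->
  filterlim (fun p => K (c + fst p) (snd p)) (filter_prod (at_right 0) (locn n x)) (locally (K c x)).
Proof.
  intros Hc Hx Hs HT; unfold K.
  apply (flim_kel _ n m x0 u (fun p => c + fst p) snd); try assumption.
  - apply flim_fst_right.
  - apply filterlim_snd.
  - apply u_cont; [apply pt_Tmap; assumption|exact HT].
Qed.

Lemma extend_interior (c : R) (x : nat -> R) :
  0 < c < sq n x0 -> below c -> Dom n x0 c x ->
  filter_prod (at_right 0) (locn n x) (fun p => u (vadd x0 (snd p)) <= K (c + fst p) (snd p)).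
Proof.
  intros Hc HP HD; pose proof (w_pos c x Hc HP HD) as Hw; unfold w in Hw.
  destruct (Dom_facts c x Hc HD) as [Hx [Hs [HT Hv]]].
  set (FT := filter_prod (at_right 0) (locn n x)).
  assert (L : filterlim (fun p => K (c + fst p) (snd p) - u (vadd x0 (snd p))) FT (locally (K c x - u (vadd x0 x)))).
  { apply flim_minus; [typeclasses eauto|apply flim_kel_right; try assumption; lra|].
    apply (filterlim_comp _ _ _ snd (fun y => u (vadd x0 y)) FT (locn n x) _ filterlim_snd).
    apply (proj1 (cont_at_flim n (fun y => u (vadd x0 y)) x)), cont_at_shift; [assumption|assumption|].
    apply u_cont; [apply pt_vadd; assumption|exact Hv]. }
  generalize (flim_gt FT _ _ 0 L ltac:(lra)); apply filter_imp; intros; lra.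
Qed.

Lemma extend_puncture (c : R) (x : nat -> R) :
  0 < c < sq n x0 -> below c -> pt n x -> x = zv \/ x = zc n x0 c ->
  filter_prod (at_right 0) (locn n x)
    (fun p => Dom n x0 (c + fst p) (snd p) -> u (vadd x0 (snd p)) <= K (c + fst p) (snd p)).
Proof.
  intros Hc HP Hx Hxx.
  assert (Hz : 0 < c ^ 2 / sq n x0) by (apply Rdiv_lt_0_compat; [apply pow_lt|]; lra).
  assert (Hz' : c ^ 2 / sq n x0 < c) by (apply Rlt_div_l; nra).
  assert (Hxc : sq n x < c) by (destruct Hxx as [->| ->]; [rewrite sq_zv|rewrite sq_zc by exact Hs0]; lra).
  assert (Hzp := pt_zc n x0 c Hx0).
  assert (HDx : locn n x (fun y => 0 < sq n (vsub y x) -> Dom n x0 c y)).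
  { assert (Hzz : forall a b, pt n a -> pt n b -> sq n a <> sq n b -> 0 < sq n (vsub a b)).
    { intros a b Ha Hb Hab; destruct (Rle_lt_or_eq_dec 0 _ (sq_nonneg n (vsub a b))) as [H|H]; [exact H|].
      symmetry in H; apply sq_vsub_eq0 in H; [subst; tauto|assumption|assumption]. }
    generalize (filter_and _ _ (locn_pt n x) (locn_sq0_lt n x _ Hxc)).
    destruct Hxx as [E|E].
    - assert (H0 : 0 < sq n (vsub x (zc n x0 c))).
      { apply Hzz; [exact Hx|exact Hzp|]; rewrite E, sq_zv, sq_zc by exact Hs0; lra. }
      intros HL; generalize (filter_and _ _ HL (locn_sq_gt n (zc n x0 c) x _ H0)).
      apply filter_imp; intros y [[Hy1 Hy2] Hy3] Hy4; rewrite E in Hy4; repeat split; assumption.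
    - assert (H0 : 0 < sq n (vsub x zv)).
      { apply Hzz; [exact Hx|apply pt_zv|]; rewrite E, sq_zv, sq_zc by exact Hs0; lra. }
      intros HL; generalize (filter_and _ _ HL (locn_sq_gt n zv x _ H0)).
      apply filter_imp; intros y [[Hy1 Hy2] Hy3] Hy4; rewrite E in Hy4; repeat split; assumption. }
  destruct HDx as [d [Hd HDx]].
  assert (HRd : exists R0, 0 < R0 /\ forall y, pt n y -> 0 < sq n (vsub y x) <= R0 -> Dom n x0 c y).
  { exists (d ^ 2 / 2); pose proof (pow_lt d 2 Hd); split; [lra|]; intros y Hy [H1 H2].
    apply HDx; [exact Hy|apply nrm_lt; lra|exact H1]. }
  destruct HRd as [R0 [HR0 HDR]].
  destruct (compact_pos_bound n (2 * R0 + 2 * sq n x) (fun y => sq n (vsub y x) = R0) (w c)) as [s [Hs Hws]].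
  { intros y Hy Hys; assert (HD : Dom n x0 c y) by (apply HDR; [exact Hy|lra]); split.
    - pose proof (sq_le_double n y x); lra.
    - split; [apply w_super; assumption|apply w_pos; assumption]. }
  { intros y Hy Hne; apply locn_off_sphere, Hne. }
  assert (Hw : forall y, pt n y /\ sq n (vsub y x) < R0 /\ 0 < sq n (vsub y x) /\ 0 < sq n (vsub y x) -> s <= w c y).
  { apply (punctured_ball_min n m x x x R0 s (w c)); try assumption.
    - intros y [H1 [H2 [H3 _]]]; assert (HD : Dom n x0 c y) by (apply HDR; [exact H1|lra]).
      split; [apply w_super; assumption|left; apply w_pos; assumption].
    - intros y Hy Hys eps Heps.
      assert (HD : Dom n x0 c y) by (apply HDR; [exact Hy|lra]).
      destruct (w_super c y Hc HP HD) as [Hcont _]; apply cont_at_flim in Hcont.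
      pose proof (Hws y Hy Hys) as H.
      generalize (flim_gt (locn n y) (w c) (w c y) (s - eps) Hcont ltac:(lra)); apply filter_imp; tauto. }
  assert (Hv0 : 0 < sq n (vadd x0 x)) by (apply vadd_nonzero; [assumption|assumption|lra]).
  assert (Hucont : filterlim (fun y => u (vadd x0 y)) (locn n x) (locally (u (vadd x0 x)))).
  { apply (proj1 (cont_at_flim n (fun y => u (vadd x0 y)) x)), cont_at_shift; [assumption|assumption|].
    apply u_cont; [apply pt_vadd; assumption|exact Hv0]. }
  destruct (proj1 (flim_eps (locn n x) _ _) Hucont (s / 4) ltac:(lra)) as [d1 [Hd1 Hu1]].
  set (R1 := Rmin (R0 / 2) (d1 ^ 2 / 2)).
  assert (HR1 : 0 < R1 /\ R1 < R0 /\ R1 < d1 ^ 2).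
  { pose proof (pow_lt d1 2 Hd1); pose proof (Rmin_l (R0 / 2) (d1 ^ 2 / 2)); pose proof (Rmin_r (R0 / 2) (d1 ^ 2 / 2)).
    assert (0 < R1) by (apply Rmin_pos; lra); unfold R1 in *; lra. }
  (* On the small ball [u] varies by less than [s / 4] from its value at the centre. So [A] lies
     above [u] there and below [K c], which is at least [u + s]. *)
  set (A := u (vadd x0 x) + s / 2).
  assert (HuA : forall y, pt n y -> sq n (vsub y x) <= R1 -> u (vadd x0 y) < u (vadd x0 x) + s / 4 /\
    u (vadd x0 x) - s / 4 < u (vadd x0 y)).
  { intros y Hy Hys; specialize (Hu1 y Hy ltac:(apply nrm_lt; lra)); apply Rabs_def2 in Hu1; lra. }
  destruct (compact_uniform n (2 * R1 + 2 * sq n x) (fun t y => sq n (vsub y x) = R1 ->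
    A < K (c + t) y /\ 0 < sq n (vsub y (zc n x0 (c + t))))) as [e [He HQ]].
  { intros y Hy; destruct (Req_dec (sq n (vsub y x)) R1) as [Hys|Hys].
    - assert (HD : Dom n x0 c y) by (apply HDR; [exact Hy|lra]).
      destruct (Dom_facts c y Hc HD) as [_ [Hsy [HTy _]]].
      assert (HwA : A < K c y).
      { assert (s <= w c y) by (apply Hw; repeat split; try assumption; lra).
        pose proof (HuA y Hy ltac:(lra)); unfold w in *; unfold A; lra. }
      set (FT := filter_prod (at_right 0) (locn n y)).
      pose proof (flim_gt FT _ _ _ (flim_kel_right c y ltac:(lra) Hy ltac:(lra) HTy) HwA) as L1.
      assert (HDz : 0 < sq n (vsub y (zc n x0 c))) by apply HD.
      pose proof (flim_gt FT _ _ _ (flim_sqzc FT n x0 _ snd _ _ (flim_fst_right n y c) filterlim_snd) HDz) as L2.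
      generalize (filter_and _ _ L1 L2); apply filter_imp; intros [t z]; simpl; tauto.
    - apply (filter_prod_right _ _ (fun t y => sq n (vsub y x) = R1 -> A < K (c + t) y /\ 0 < sq n (vsub y (zc n x0 (c + t))))
        (fun z => sq n (vsub z x) <> R1)); [apply locn_off_sphere, Hys|intros; tauto]. }
  set (e' := Rmin e (sq n x0 - c)).
  assert (He' : 0 < e' /\ e' <= e /\ c + e' <= sq n x0).
  { pose proof (Rmin_l e (sq n x0 - c)); pose proof (Rmin_r e (sq n x0 - c)).
    assert (0 < e') by (apply Rmin_pos; lra); unfold e' in *; lra. }
  assert (HB : sq n (vsub x x) < R1) by (rewrite sq_vsub_self; lra).
  exists (fun t => 0 < t < e') (fun y => pt n y /\ sq n (vsub y x) < R1).
  { apply at_right_lt; lra. }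
  { apply filter_and; [apply locn_pt|apply (locn_sq_lt n x x _ HB)]. }
  intros t y Ht [Hy HyR] HD; simpl in *.
  assert (HA : A <= K (c + t) y); [|pose proof (HuA y Hy ltac:(lra)); unfold A in HA; lra].
  assert (Hball : forall y, pt n y -> sq n (vsub y x) <= R1 -> 0 < sq n (vsub y zv) -> 0 < sq n (vsub y (zc n x0 (c + t))) ->
    0 < sq n y /\ 0 < sq n (Tmap n x0 (c + t) y)).
  { intros z Hz1 Hz2 Hz3 Hz4; rewrite vsub_zv in Hz3; split; [exact Hz3|apply Tmap_nonzero; try assumption; lra]. }
  apply (punctured_ball_min n m x zv (zc n x0 (c + t)) R1 A (K (c + t))); try assumption.
  - apply pt_zv.
  - apply pt_zc, Hx0.
  - intros z [Hz1 [Hz2 [Hz3 Hz4]]]; destruct (Hball z Hz1 ltac:(lra) Hz3 Hz4) as [Hz5 Hz6]; split.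
    + apply kel_super; try assumption; lra.
    + left; apply kel_pos; assumption.
  - intros z Hzpt Hzs eps Heps.
    assert (Hsz : sq n z <= 2 * R1 + 2 * sq n x) by (pose proof (sq_le_double n z x); lra).
    destruct (HQ t z ltac:(lra) Hzpt Hsz Hzs) as [HQ1 HQ2].
    assert (HDz : Dom n x0 c z) by (apply HDR; [exact Hzpt|lra]).
    destruct (Hball z Hzpt ltac:(lra) ltac:(apply HDz) HQ2) as [Hz5 Hz6].
    destruct (kel_super (c + t) z Hzpt ltac:(lra) Hz5 Hz6) as [Hcont _]; apply cont_at_flim in Hcont.
    generalize (flim_gt (locn n z) (K (c + t)) _ (A - eps) Hcont ltac:(lra)); apply filter_imp; tauto.
  - destruct HD as [_ [_ [HD3 HD4]]]; repeat split; assumption.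
Qed.

Lemma extend_below (c : R) : 0 < c < sq n x0 -> below c ->
  exists e, 0 < e /\ forall t, 0 < t < e -> forall y, Dom n x0 (c + t) y -> u (vadd x0 y) <= K (c + t) y.
Proof.
  intros Hc HP.
  destruct (compact_uniform n (sq n x0) (fun t y => Dom n x0 (c + t) y -> u (vadd x0 y) <= K (c + t) y)) as [e [He H]].
  - intros x Hx.
    destruct (Rtotal_order (sq n x) c) as [H1|[H1|H1]].
    + destruct (Req_dec (sq n (vsub x zv)) 0) as [E1|E1];
        [|destruct (Req_dec (sq n (vsub x (zc n x0 c))) 0) as [E2|E2]].
      * apply extend_puncture; try assumption; left; apply (sq_vsub_eq0 n); [assumption|apply pt_zv|assumption].
      * apply extend_puncture; try assumption; right; apply (sq_vsub_eq0 n); [assumption|apply pt_zc, Hx0|assumption].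
      * assert (HD : Dom n x0 c x).
        { pose proof (sq_nonneg n (vsub x zv)); pose proof (sq_nonneg n (vsub x (zc n x0 c))).
          repeat split; [exact Hx|exact H1|lra|lra]. }
        generalize (extend_interior c x Hc HP HD); apply filter_imp; intros [t y]; simpl; tauto.
    + apply extend_sphere; assumption.
    + exists (fun t => 0 < t < (sq n x - c) / 2) (fun y => (sq n x + c) / 2 < sq n y).
      * apply at_right_lt; lra.
      * apply (flim_gt (locn n x) _ _ _ (flim_sq0 n x)); lra.
      * intros t y Ht Hy [_ [HD _]]; simpl in *; lra.
  - exists (Rmin e (sq n x0 - c)); split; [apply Rmin_pos; lra|]; intros t Ht y HD.
    pose proof (Rmin_l e (sq n x0 - c)); pose proof (Rmin_r e (sq n x0 - c)).
    apply H; [lra|apply HD| |exact HD]; destruct HD as [_ [HD _]]; lra.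
Qed.

(** Either the reflected offset [k y] is small, in a ball where [Psi > 0] because
    [Psi zv = m u(x0)], and [ray_mono] applies; or [z = k y] is far, and a lower bound for [K R0]
    says that [u(x0 + z)] decays no faster than [|z|^(-2m)]. In that case [K c y] gains a factor
    [(R0 / c)^m], large for small [c]. *)
Lemma start_below : exists c0, 0 < c0 /\ forall c, 0 < c < c0 -> forall y, Dom n x0 c y -> u (vadd x0 y) <= K c y.
Proof.
  assert (Hz0 : vadd x0 zv = x0) by (apply functional_extensionality; intros i; unfold vadd, zv; ring).
  assert (Hv0 : 0 < sq n (vadd x0 zv)) by (rewrite Hz0; exact Hs0).
  assert (Hpsi : 0 < Psi zv).
  { unfold Psi; rewrite (rsum_ext n _ (fun _ => 0)) by (intros; unfold zv; ring).
    rewrite rsum_const, Hz0; destruct (Hpos x0 Hx0 Hs0); nra. }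
  assert (Hucont : filterlim (fun y => u (vadd x0 y)) (locn n zv) (locally (u (vadd x0 zv)))).
  { apply (proj1 (cont_at_flim n (fun y => u (vadd x0 y)) zv)), cont_at_shift; [assumption|apply pt_zv|].
    apply u_cont; [rewrite Hz0; exact Hx0|exact Hv0]. }
  pose proof (flim_gt (locn n zv) _ _ _ (Psi_cont zv (pt_zv n) Hv0) Hpsi) as L1.
  assert (L2 : locn n zv (fun y => 0 < sq n (vadd x0 y))).
  { apply (flim_gt (locn n zv) _ _ 0 (filterlim_comp _ _ _ _ _ _ _ _ (flim_shift n x0 zv Hx0 (pt_zv n)) (flim_sq0 n (vadd x0 zv))) Hv0). }
  assert (L3 : locn n zv (fun y => u (vadd x0 y) < u x0 + 1)).
  { apply (flim_lt (locn n zv) _ _ _ Hucont); rewrite Hz0; lra. }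
  destruct (filter_and _ _ L1 (filter_and _ _ L2 L3)) as [d [Hd Hball']].
  assert (Hball : forall y, pt n y -> sq n y < d ^ 2 -> 0 < Psi y /\ 0 < sq n (vadd x0 y) /\ u (vadd x0 y) < u x0 + 1).
  { intros y Hy Hs; apply Hball'; [exact Hy|]; apply nrm_lt; [exact Hd|]; rewrite vsub_zv; exact Hs. }
  set (R0 := d ^ 2 / 2).
  assert (HR0 : 0 < R0 /\ R0 < d ^ 2) by (pose proof (pow_lt d 2 Hd); unfold R0; lra).
  assert (Hpv : forall y, pt n y -> sq n y = R0 -> 0 < sq n (vadd x0 y)) by (intros; apply Hball; [assumption|lra]).
  destruct (compact_pos_bound n R0 (fun y => sq n y = R0) (fun y => u (vadd x0 y))) as [s [Hs Hus]].
  { intros y Hy Hys; pose proof (Hpv y Hy Hys); assert (Hpt := pt_vadd n x0 y Hx0 Hy).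
    split; [lra|split; [apply cont_at_shift; [exact Hx0|exact Hy|apply u_cont; assumption]|apply Hpos; assumption]]. }
  { intros y Hy Hne; apply locn_off_sphere0, Hne. }
  assert (Hout : forall y, pt n y /\ sq n (vsub y zv) < R0 /\ 0 < sq n (vsub y zv) /\ 0 < sq n (vsub y (zc n x0 R0)) ->
    s <= K R0 y).
  { apply (punctured_ball_min n m zv zv (zc n x0 R0) R0 s (K R0)); try assumption; try apply pt_zv.
    - apply pt_zc, Hx0.
    - intros y [H1 [H2 [H3 H4]]]; rewrite vsub_zv in H2, H3.
      assert (HT : 0 < sq n (Tmap n x0 R0 y)) by (apply Tmap_nonzero; try assumption; lra).
      split; [apply kel_super; try assumption; lra|left; apply kel_pos; assumption].
    - intros y Hy Hys eps Heps; rewrite vsub_zv in Hys.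
      assert (HT : 0 < sq n (Tmap n x0 R0 y)).
      { unfold Tmap; rewrite Hys; replace (R0 / R0) with 1 by (field; lra); rewrite smul_1; apply Hpv; assumption. }
      destruct (kel_super R0 y Hy ltac:(lra) ltac:(lra) HT) as [Hcont _]; apply cont_at_flim in Hcont.
      pose proof (Hus y Hy Hys) as Hu; cbv beta in Hu; rewrite <- (kel_sphere R0 y) in Hu by (try assumption; lra).
      generalize (flim_gt (locn n y) (K R0) _ (s - eps) Hcont ltac:(lra)); apply filter_imp; tauto. }
  destruct (Rpower_inv_large m ((u x0 + 1) / s) Hm0) as [e [He HB]].
  assert (Hmin : 0 < Rmin (R0 * e) (Rmin R0 (sq n x0))) by (repeat apply Rmin_pos; try apply Rmult_lt_0_compat; lra).
  exists (Rmin (R0 * e) (Rmin R0 (sq n x0))); split; [exact Hmin|]; intros c Hc y HD.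
  pose proof (Rmin_l (R0 * e) (Rmin R0 (sq n x0))); pose proof (Rmin_r (R0 * e) (Rmin R0 (sq n x0))).
  pose proof (Rmin_l R0 (sq n x0)); pose proof (Rmin_r R0 (sq n x0)).
  destruct (Dom_facts c y ltac:(lra) HD) as [Hy [Hsy [HT Hvy]]].
  set (k := c / sq n y).
  assert (Hk : 1 < k) by (apply Rlt_div_r; lra).
  assert (Hkc : k * sq n y = c) by (unfold k; field; lra).
  assert (Hskx : sq n (smul k y) = k ^ 2 * sq n y) by apply sq_smul.
  destruct (Rlt_le_dec (k ^ 2 * sq n y) (d ^ 2)) as [Hin|Hin].
  - rewrite kel_ray; fold k; apply ray_mono; [exact Hy|lra|]; intros t Ht.
    assert (Hst : sq n (smul t y) < d ^ 2).
    { rewrite sq_smul; apply Rle_lt_trans with (k ^ 2 * sq n y); [|exact Hin].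
      apply Rmult_le_compat_r; [lra|]; apply pow_incr; lra. }
    destruct (Hball _ (pt_smul n t y Hy) Hst); tauto.
  - assert (Hkk : 0 < k ^ 2 * sq n y) by lra.
    (* [y'] is the reflection of [z] in the sphere of squared radius [R0], so [K R0 y'] and [K c y]
       evaluate [u] at the same point and differ only in the weight. *)
    set (z := smul k y); set (y' := smul (R0 / sq n z) z).
    assert (Hz : sq n z = k ^ 2 * sq n y) by exact Hskx.
    assert (Hy' : pt n y') by (apply pt_smul, pt_smul, Hy).
    assert (Hsy' : sq n y' = R0 ^ 2 / sq n z) by (unfold y'; rewrite sq_smul; field; lra).
    assert (Hsy1 : 0 < sq n y') by (rewrite Hsy'; apply Rdiv_lt_0_compat; [apply pow_lt|]; lra).
    assert (Hsy2 : sq n y' < R0) by (rewrite Hsy'; apply Rlt_div_l; nra).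
    assert (Hrat : R0 / sq n y' = sq n z / R0) by (rewrite Hsy'; field; lra).
    assert (HTy : Tmap n x0 R0 y' = vadd x0 z).
    { unfold Tmap; rewrite Hrat; f_equal; apply functional_extensionality; intros i.
      unfold y', smul at 1 2; field; lra. }
    assert (Hne : 0 < sq n (vsub y' (zc n x0 R0))).
    { destruct (Rle_lt_or_eq_dec 0 _ (sq_nonneg n (vsub y' (zc n x0 R0)))) as [H'|H']; [exact H'|exfalso].
      symmetry in H'; apply sq_vsub_eq0 in H'; [|exact Hy'|apply pt_zc, Hx0].
      rewrite H', Tmap_zc in HTy by (try assumption; lra).
      unfold Tmap in HT; fold k z in HT; rewrite <- HTy, sq_zv in HT; lra. }
    assert (Hs1 : s <= K R0 y') by (apply Hout; rewrite vsub_zv; repeat split; assumption).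
    unfold K, kel in Hs1; rewrite HTy, Hrat in Hs1.
    assert (HK : K c y = Rpower (R0 / c) m * (Rpower (sq n z / R0) m * u (vadd x0 z))).
    { rewrite kel_ray; fold k z; rewrite <- Rmult_assoc, Rpower_mult_distr by (apply Rdiv_lt_0_compat; lra).
      f_equal; f_equal; rewrite Hz, <- Hkc; field; lra. }
    assert (Hlarge : (u x0 + 1) / s < Rpower (1 / (c / R0)) m).
    { apply HB; split; [apply Rdiv_lt_0_compat; lra|apply Rlt_div_l; lra]. }
    replace (1 / (c / R0)) with (R0 / c) in Hlarge by (field; lra).
    assert (Hu1 : u (vadd x0 y) < u x0 + 1) by (apply Hball; [exact Hy|lra]).
    apply Rlt_le, Rlt_le_trans with (1 := Hu1); rewrite HK.
    replace (u x0 + 1) with ((u x0 + 1) / s * s) by (field; lra).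
    apply Rmult_le_compat; try lra.
    apply Rlt_le, Rdiv_lt_0_compat; [destruct (Hpos x0 Hx0 Hs0); lra|exact Hs].
Qed.

Lemma kel_cont_c (c : R) (y : nat -> R) : 0 < c -> pt n y -> 0 < sq n y -> 0 < sq n (Tmap n x0 c y) ->
  filterlim (fun c => K c y) (locally c) (locally (K c y)).
Proof.
  intros Hc Hy Hs HT; unfold K; apply (flim_kel (locally c) n m x0 u (fun c => c) (fun _ => y)); try assumption.
  - apply filterlim_id.
  - intros P HP; unfold filtermap; apply filter_forall; intros t; apply (locn_self n y P Hy HP).
  - apply u_cont; [apply pt_Tmap; assumption|exact HT].
Qed.

(** For fixed [y] the domain conditions and a strict failure of the comparison are open in [c], so a
    failure at [c] would already occur at some smaller [c']. *)
Lemma closed_below (c : R) : 0 < c < sq n x0 ->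
  (forall c', 0 < c' < c -> forall y, Dom n x0 c' y -> u (vadd x0 y) <= K c' y) ->
  forall y, Dom n x0 c y -> u (vadd x0 y) <= K c y.
Proof.
  intros Hc H y HD; destruct (Dom_facts c y Hc HD) as [Hy [Hs [HT _]]].
  destruct (Rle_lt_dec (u (vadd x0 y)) (K c y)) as [Hle|Hlt]; [exact Hle|exfalso].
  pose proof (flim_lt (locally c) _ _ _ (kel_cont_c c y ltac:(lra) Hy ltac:(lra) HT) Hlt) as L1.
  assert (L2 : locally c (fun c' => 0 < sq n (vsub y (zc n x0 c')))).
  { apply (flim_gt (locally c) _ _ 0 (flim_sqzc (locally c) n x0 (fun c => c) (fun _ => y) c y (filterlim_id _ _)
      (fun P HP => filter_forall _ (fun t => locn_self n y P Hy HP)))); apply HD. }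
  destruct (filter_and _ _ L1 L2) as [e He].
  set (h := Rmin e (c - sq n y) / 2).
  assert (Hh : 0 < h /\ h < e /\ h < c - sq n y).
  { pose proof (cond_pos e); pose proof (Rmin_l e (c - sq n y)); pose proof (Rmin_r e (c - sq n y)).
    assert (0 < Rmin e (c - sq n y)) by (apply Rmin_pos; lra); unfold h; lra. }
  destruct (He (c - h)) as [H1 H2].
  { apply ball_R; apply Rabs_def1; lra. }
  assert (u (vadd x0 y) <= K (c - h) y); [|lra].
  apply H; [lra|]; destruct HD as [_ [_ [HD _]]]; repeat split; try assumption; lra.
Qed.

End MovingSpheres.

(** Continuous induction on the squared radius: start, closedness from the left, and openness to the
    right. [M] stands for [|x0|^2], which is never reached. *)
Lemma real_induction (M : R) (P : R -> Prop) :
  (exists c0, 0 < c0 /\ forall c, 0 < c < c0 -> c < M -> P c) ->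
  (forall c, 0 < c < M -> (forall c', 0 < c' < c -> P c') -> P c) ->
  (forall c, 0 < c < M -> P c -> exists e, 0 < e /\ forall t, 0 < t < e -> c + t < M -> P (c + t)) ->
  forall c, 0 < c < M -> P c.
Proof.
  intros [c0 [Hc0 H0]] Hcl Hop c Hc; apply NNPP; intros HnP.
  destruct (completeness (fun s => 0 < s <= c /\ forall c', 0 < c' < s -> P c')) as [s [Hs1 Hs2]].
  - exists c; intros s [Hs _]; lra.
  - exists (Rmin c c0); split; [split; [apply Rmin_pos; lra|apply Rmin_l]|].
    intros c' Hc'; pose proof (Rmin_r c c0); pose proof (Rmin_l c c0); apply H0; lra.
  - assert (Hmc : Rmin c c0 <= s).
    { apply Hs1; split; [split; [apply Rmin_pos; lra|apply Rmin_l]|].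
      intros c' Hc'; pose proof (Rmin_r c c0); pose proof (Rmin_l c c0); apply H0; lra. }
    assert (Hs0 : 0 < s) by (apply Rlt_le_trans with (2 := Hmc), Rmin_pos; lra).
    assert (Hsc : s <= c) by (apply Hs2; intros r [Hr _]; lra).
    assert (Hbelow : forall c', 0 < c' < s -> P c').
    { intros c' Hc'; apply NNPP; intros Hn; assert (s <= c'); [|lra].
      apply Hs2; intros r [Hr1 Hr2]; destruct (Rle_lt_dec r c') as [H|H]; [exact H|].
      exfalso; apply Hn, Hr2; lra. }
    assert (HPs : P s) by (apply Hcl; [lra|exact Hbelow]).
    destruct (Rle_lt_or_eq_dec s c Hsc) as [Hlt|Heq]; [|subst s; contradiction].
    destruct (Hop s ltac:(lra) HPs) as [e [He H1]].
    set (s' := Rmin c (s + e)).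
    assert (Hs' : s < s') by (unfold s', Rmin; destruct (Rle_dec c (s + e)); lra).
    assert (s' <= s); [|lra]; apply Hs1; split.
    + split; [lra|apply Rmin_l].
    + intros c' Hc'; destruct (Rtotal_order c' s) as [H|[->|H]]; [apply Hbelow; lra|exact HPs|].
      replace c' with (s + (c' - s)) by ring.
      pose proof (Rmin_r c (s + e)); pose proof (Rmin_l c (s + e)); unfold s' in Hc'; apply H1; lra.
Qed.

(** * Radial symmetry and monotonicity *)

Section Symmetry.

Context (n : nat) (m : R) (Hm : 2 * m = INR n - 2) (Hm0 : 0 < m).
Context (F G : R -> R -> R) (HF : growth m F) (HG : growth m G).
Context (u v : (nat -> R) -> R).
Context (D1u D1v : nat -> (nat -> R) -> R) (D2u D2v : nat -> nat -> (nat -> R) -> R).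
Context (HCu : C2_punct_with n u D1u D2u) (HCv : C2_punct_with n v D1v D2v).
Context (Hpos : forall x, pt n x -> 0 < sq n x -> 0 < u x /\ 0 < v x).
Context (Hequ : forall x, pt n x -> 0 < sq n x -> lap n D2u x = - F (u x) (v x)).
Context (Heqv : forall x, pt n x -> 0 < sq n x -> lap n D2v x = - G (v x) (u x)).

Lemma moving_spheres (x0 : nat -> R) : pt n x0 -> 0 < sq n x0 ->
  forall c, 0 < c < sq n x0 -> below n m u v x0 c.
Proof.
  intros Hx0 Hs0.
  assert (Hpos' : forall x, pt n x -> 0 < sq n x -> 0 < v x /\ 0 < u x) by (intros; apply and_comm, Hpos; assumption).
  assert (Hswap : forall c, below n m u v x0 c -> below n m v u x0 c) by (intros c H y Hy; apply and_comm, H, Hy).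
  apply real_induction.
  - destruct (start_below n m Hm Hm0 F HF u v D1u D2u HCu Hpos Hequ x0 Hx0 Hs0) as [c1 [Hc1 H1]].
    destruct (start_below n m Hm Hm0 G HG v u D1v D2v HCv Hpos' Heqv x0 Hx0 Hs0) as [c2 [Hc2 H2]].
    exists (Rmin c1 c2); split; [apply Rmin_pos; assumption|]; intros c Hc _ y Hy.
    pose proof (Rmin_l c1 c2); pose proof (Rmin_r c1 c2).
    split; [apply H1|apply H2]; try assumption; lra.
  - intros c Hc H y Hy; split.
    + apply (closed_below n m u D1u D2u HCu x0 Hx0 Hs0 c Hc); [|exact Hy]; intros; apply H; assumption.
    + apply (closed_below n m v D1v D2v HCv x0 Hx0 Hs0 c Hc); [|exact Hy]; intros; apply H; assumption.
  - intros c Hc H.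
    destruct (extend_below n m Hm Hm0 F HF u v D1u D2u HCu Hpos Hequ x0 Hx0 Hs0 c Hc H) as [e1 [He1 H1]].
    destruct (extend_below n m Hm Hm0 G HG v u D1v D2v HCv Hpos' Heqv x0 Hx0 Hs0 c Hc (Hswap c H)) as [e2 [He2 H2]].
    exists (Rmin e1 e2); split; [apply Rmin_pos; assumption|]; intros t Ht _ y Hy.
    pose proof (Rmin_l e1 e2); pose proof (Rmin_r e1 e2).
    split; [apply H1|apply H2]; try assumption; lra.
Qed.

(* Letting the centre [x - s th] of the spheres recede to infinity keeps only the directional derivative. *)
Lemma grad_outward (x th : nat -> R) : pt n x -> 0 < sq n x -> pt n th -> dot n x th <= 0 ->
  0 <= rsum n (fun k => D1u k x * th k).
Proof.
  intros Hx Hsx Hth Hdot.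
  destruct (Req_dec (sq n th) 0) as [E|E].
  { apply sq_zero in E; [|exact Hth]; subst th.
    rewrite (rsum_ext n _ (fun _ => 0)) by (intros; unfold zv; ring); rewrite rsum_const; lra. }
  assert (Hsth : 0 < sq n th) by (pose proof (sq_nonneg n th); lra).
  set (S := rsum n (fun k => D1u k x * th k)).
  assert (Hmain : forall s, 0 < s -> 0 <= m * u x + s * S).
  (* The centre is placed so that [x = x0 + y]. Then [x . th <= 0] gives [|y| < |x0|], so spheres
     slightly larger than the one through [x] are admissible and yield the sign of a right
     derivative. *)
  { intros s Hs; set (y := smul s th); set (x0 := vsub x y).
    assert (Hy : pt n y) by (apply pt_smul, Hth).
    assert (Hx0 : pt n x0) by (apply pt_vsub; assumption).
    assert (Ex : vadd x0 y = x) by (apply functional_extensionality; intros i; unfold vadd, x0, vsub; ring).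
    assert (Hsy : 0 < sq n y) by (unfold y; rewrite sq_smul; apply Rmult_lt_0_compat; [apply pow_lt|]; assumption).
    assert (Hlt : sq n y < sq n x0).
    { unfold x0; rewrite sq_vsub; unfold y at 2; rewrite dot_smul.
      assert (s * dot n x th <= 0) by nra; lra. }
    assert (Hs0 : 0 < sq n x0) by lra.
    assert (EP : Psi n m u D1u x0 y = m * u x + s * S).
    { unfold Psi; rewrite Ex; f_equal; unfold S; rewrite <- rsum_scal; apply rsum_ext.
      intros; unfold y, smul; ring. }
    assert (Hd := ray_derive n m u D1u D2u HCu x0 Hx0 y 1 Hy Rlt_0_1
      ltac:(rewrite smul_1, Ex; exact Hsx)).
    rewrite smul_1, EP in Hd.
    assert (E1 := Rpower_1_l m).
    rewrite E1 in Hd; replace (1 / 1 * (m * u x + s * S)) with (m * u x + s * S) in Hd by field.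
    (* The bound [k^2 < rho] serves twice: it keeps the squared radius [k |y|^2] below [|x0|^2], and
       it makes the puncture [zc] shorter than [y], so that [y] lies in the domain. *)
    set (rho := sq n x0 / sq n y).
    assert (Hrho : 1 < rho) by (apply Rlt_div_r; lra).
    set (e := Rmin 1 ((rho - 1) / 3)).
    assert (He : 0 < e) by (apply Rmin_pos; lra).
    apply (derive_right_min _ 1 _ e Hd He); intros k Hk.
    rewrite E1, smul_1, Ex.
    assert (Hk1 : k <= 1 + (rho - 1) / 3) by (pose proof (Rmin_r 1 ((rho - 1) / 3)); unfold e in Hk; lra).
    assert (Hk2 : k <= 2) by (pose proof (Rmin_l 1 ((rho - 1) / 3)); unfold e in Hk; lra).
    assert (Hkk : k * k < rho) by (assert ((k - 1) * (k - 1) <= (k - 1) * 1) by (apply Rmult_le_compat_l; lra); 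
      destruct (Rle_lt_or_eq_dec _ _ Hk1); [lra|pose proof (Rmin_r 1 ((rho - 1) / 3)); unfold e in Hk; lra]).
    assert (Hkx : k * k * sq n y < sq n x0).
    { replace (sq n x0) with (rho * sq n y) by (unfold rho; field; lra); apply Rmult_lt_compat_r; assumption. }
    assert (Hky : k * sq n y < k * k * sq n y) by (apply Rmult_lt_compat_r; [exact Hsy|]; nra).
    assert (Hky' : sq n y < k * sq n y) by (rewrite <- (Rmult_1_l (sq n y)) at 1; apply Rmult_lt_compat_r; lra).
    destruct (moving_spheres x0 Hx0 Hs0 (k * sq n y) ltac:(lra) y) as [Hb _].
    - repeat split; [exact Hy|exact Hky'|rewrite vsub_zv; exact Hsy|].
      destruct (Rle_lt_or_eq_dec 0 _ (sq_nonneg n (vsub y (zc n x0 (k * sq n y))))) as [H|H]; [exact H|exfalso].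
      symmetry in H; apply sq_vsub_eq0 in H; [|exact Hy|apply pt_zc, Hx0].
      apply (f_equal (sq n)) in H; rewrite sq_zc in H by exact Hs0.
      assert (H' : sq n y * sq n x0 = (k * sq n y) ^ 2) by (rewrite H at 1; field; lra).
      assert (sq n y * (k * k * sq n y) < sq n y * sq n x0) by (apply Rmult_lt_compat_l; assumption); lra.
    - unfold kel, Tmap in Hb; replace (k * sq n y / sq n y) with k in Hb by (field; lra).
      rewrite Ex in Hb; lra. }
  destruct (Rle_lt_dec 0 S) as [H|H]; [exact H|exfalso].
  assert (Hu : 0 < u x) by (apply Hpos; assumption).
  (* For negative [S] this [s] turns [Hmain] into [0 <= -1]. *)
  specialize (Hmain ((m * u x + 1) / (- S)) ltac:(apply Rdiv_lt_0_compat; nra)).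
  replace ((m * u x + 1) / - S * S) with (- (m * u x + 1)) in Hmain by (field; lra); lra.
Qed.

Lemma grad_tangential (x th : nat -> R) : pt n x -> 0 < sq n x -> pt n th -> dot n x th = 0 ->
  rsum n (fun k => D1u k x * th k) = 0.
Proof.
  intros Hx Hsx Hth Hdot; apply Rle_antisym; [|apply grad_outward; try assumption; lra].
  assert (H := grad_outward x (smul (-1) th) Hx Hsx (pt_smul n _ th Hth) ltac:(rewrite dot_smul, Hdot; lra)).
  rewrite (rsum_ext n _ (fun k => (-1) * (D1u k x * th k))) in H by (intros; unfold smul; ring).
  rewrite rsum_scal in H; lra.
Qed.

(** A circle in the plane of the coordinates 0 and [j]. Only the remaining coordinates are taken
    from [x], which makes the curve independent of where [x] sits on it. *)
Definition rot (j : nat) (r : R) (x : nat -> R) (t : R) : nat -> R :=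
  fun i => if Nat.eqb i 0 then r * cos t else if Nat.eqb i j then r * sin t else x i.

Definition rot' (j : nat) (r : R) (t : R) : nat -> R :=
  fun i => kron i 0 * (- r * sin t) + kron i j * (r * cos t).

Lemma rot_derive (j : nat) (r : R) (x : nat -> R) (t : R) (i : nat) : (0 < j)%nat ->
  is_derive (fun t => rot j r x t i) t (rot' j r t i).
Proof.
  intros Hj; unfold rot, rot', kron; destruct (Nat.eqb_spec i 0) as [->|H0].
  - destruct (Nat.eqb_spec 0 j); [lia|]; auto_derive; [exact I|ring].
  - destruct (Nat.eqb_spec i j); auto_derive; try exact I; ring.
Qed.

Lemma rsum_rot' (j : nat) (r t : R) (f : nat -> R) : (0 < j < n)%nat ->
  rsum n (fun i => f i * rot' j r t i) = f 0%nat * (- r * sin t) + f j * (r * cos t).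
Proof.
  intros Hj; unfold rot'.
  rewrite (rsum_ext n _ (fun i => kron i 0 * (f i * (- r * sin t)) + kron i j * (f i * (r * cos t)))) by (intros; ring).
  rewrite rsum_plus, (rsum_kron n 0 (fun i => f i * (- r * sin t))), (rsum_kron n j (fun i => f i * (r * cos t))) by lia.
  reflexivity.
Qed.

Lemma pt_rot (j : nat) (r : R) (x : nat -> R) (t : R) : (0 < j < n)%nat -> pt n x -> pt n (rot j r x t).
Proof.
  intros Hj Hx i Hi; unfold rot; destruct (Nat.eqb_spec i 0); [lia|]; destruct (Nat.eqb_spec i j); [lia|apply Hx, Hi].
Qed.

Lemma pt_rot' (j : nat) (r t : R) : (0 < j < n)%nat -> pt n (rot' j r t).
Proof.
  intros Hj i Hi; unfold rot', kron; destruct (Nat.eqb_spec i 0); [lia|]; destruct (Nat.eqb_spec i j); [lia|ring].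
Qed.

Lemma rot_0 (j : nat) (r : R) (x : nat -> R) (t : R) : rot j r x t 0%nat = r * cos t.
Proof. reflexivity. Qed.

Lemma rot_j (j : nat) (r : R) (x : nat -> R) (t : R) : (0 < j)%nat -> rot j r x t j = r * sin t.
Proof. intros Hj; unfold rot; rewrite Nat.eqb_refl; destruct (Nat.eqb_spec j 0); [lia|reflexivity]. Qed.

Lemma sq_rot_pos (j : nat) (r : R) (x : nat -> R) (t : R) : (0 < j < n)%nat -> 0 < r -> 0 < sq n (rot j r x t).
Proof.
  intros Hj Hr.
  pose proof (sq_ge_coord n 0 (rot j r x t) ltac:(lia)) as H0; rewrite rot_0 in H0.
  pose proof (sq_ge_coord n j (rot j r x t) ltac:(lia)) as H1; rewrite rot_j in H1 by lia.
  pose proof (sin2_cos2 t) as H2; unfold Rsqr in H2.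
  assert (Hr2 : 0 < r * r) by (apply Rmult_lt_0_compat; assumption).
  assert ((r * cos t) ^ 2 + (r * sin t) ^ 2 = r * r) by (transitivity (r * r * (sin t * sin t + cos t * cos t)); [ring|rewrite H2; ring]).
  lra.
Qed.

Lemma grad_rot (j : nat) (r : R) (x : nat -> R) (t : R) : (0 < j < n)%nat -> 0 < r -> pt n x ->
  D1u 0%nat (rot j r x t) * (- r * sin t) + D1u j (rot j r x t) * (r * cos t) = 0.
Proof.
  intros Hj Hr Hx; rewrite <- (rsum_rot' j r t (fun k => D1u k (rot j r x t)) Hj).
  apply grad_tangential; [apply pt_rot; assumption|apply sq_rot_pos; assumption|apply pt_rot', Hj|].
  unfold dot; rewrite rsum_rot', rot_0, rot_j by lia; ring.
Qed.

Lemma polar_angle (a b : R) : exists r t, 0 <= r /\ r ^ 2 = a ^ 2 + b ^ 2 /\ a = r * cos t /\ b = r * sin t.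
Proof.
  set (r := sqrt (a ^ 2 + b ^ 2)).
  assert (Hr2 : r ^ 2 = a ^ 2 + b ^ 2) by (apply pow2_sqrt; nra).
  destruct (Rle_lt_or_eq_dec 0 r (sqrt_pos _)) as [Hr|Hr].
  - assert (Hb : -1 <= a / r <= 1).
    { assert (Habs : - r <= a <= r) by nra.
      split; [apply Rle_div_r|apply Rle_div_l]; lra. }
    set (s := if Rle_dec 0 b then 1 else -1).
    exists r, (s * acos (a / r)); split; [lra|split; [exact Hr2|]].
    assert (Hs : cos (s * acos (a / r)) = cos (acos (a / r)) /\ sin (s * acos (a / r)) = s * sin (acos (a / r))).
    { unfold s; destruct (Rle_dec 0 b); [rewrite !Rmult_1_l; tauto|].
      replace (-1 * acos (a / r)) with (- acos (a / r)) by ring; rewrite cos_neg, sin_neg; split; ring. }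
    destruct Hs as [-> ->]; rewrite cos_acos, sin_acos by exact Hb; split; [field; lra|].
    replace (1 - (a / r)²) with ((b / r) ^ 2) by (unfold Rsqr; field_simplify; [|lra|lra]; rewrite Hr2; field; rewrite <- Hr2; nra).
    replace ((b / r) ^ 2) with ((Rabs b / r) ^ 2) by (unfold Rdiv; rewrite !Rpow_mult_distr, pow2_abs; reflexivity).
    rewrite sqrt_pow2 by (apply Rdiv_le_0_compat; [apply Rabs_pos|exact Hr]).
    unfold s; destruct (Rle_dec 0 b); [rewrite Rabs_right by lra|rewrite Rabs_left by lra]; field; lra.
  - exists 0, 0; rewrite <- Hr in Hr2; split; [lra|split; [nra|]]; split; nra.
Qed.

Lemma rot_invariant (j : nat) (r : R) (x : nat -> R) (s t : R) : (0 < j < n)%nat -> 0 < r -> pt n x ->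
  u (rot j r x s) = u (rot j r x t).
Proof.
  intros Hj Hr Hx.
  assert (Hd : forall a, is_derive (fun a => u (rot j r x a)) a 0).
  { intros a; evar_last.
    - apply (chain_rule n u D1u (rot j r x) (rot' j r a) a).
      + intros; apply pt_rot; assumption.
      + apply (C2_punct_at n u D1u D2u _ HCu); [apply pt_rot; assumption|apply sq_rot_pos; assumption].
      + intros; apply rot_derive; lia.
    - rewrite rsum_rot' by exact Hj; apply grad_rot; assumption. }
  destruct (MVT_gen (fun a => u (rot j r x a)) t s (fun _ => 0)) as [c [_ Hc]].
  - intros; apply Hd.
  - intros a _; apply derivable_continuous_pt; exists 0; apply is_derive_Reals, Hd.
  - lra.
Qed.

Definition ax (r : R) : nat -> R := fun i => if Nat.eqb i 0 then r else 0.

Lemma pt_ax (r : R) : (0 < n)%nat -> pt n (ax r).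
Proof. intros Hn i Hi; unfold ax; destruct (Nat.eqb_spec i 0); [lia|reflexivity]. Qed.

(* [x] after rotating the coordinates [1, ..., k] into coordinate [0]. *)
Definition fold_coord (x : nat -> R) (k : nat) : nat -> R :=
  fun i => if Nat.eqb i 0 then sqrt (rsum (S k) (fun l => x l ^ 2)) else if Nat.leb i k then 0 else x i.

(** Rotation in the plane of the coordinates 0 and [j] until the latter vanishes. If the radius in
    that plane is 0, the two points already agree. *)
Lemma fold_step (j : nat) (x : nat -> R) : (0 < j < n)%nat -> pt n x ->
  0 < sq n x ->
  u x = u (fun i => if Nat.eqb i 0 then sqrt (x 0%nat ^ 2 + x j ^ 2) else if Nat.eqb i j then 0 else x i).
Proof.
  intros Hj Hx Hs; destruct (polar_angle (x 0%nat) (x j)) as [r [t [Hr [Hr2 [E0 Ej]]]]].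
  assert (Es : sqrt (x 0%nat ^ 2 + x j ^ 2) = r) by (rewrite <- Hr2; apply sqrt_pow2, Hr).
  rewrite Es; destruct (Rle_lt_or_eq_dec 0 r Hr) as [Hr0|Hr0].
  - transitivity (u (rot j r x t)); [|transitivity (u (rot j r x 0))].
    + f_equal; apply functional_extensionality; intros i; unfold rot.
      destruct (Nat.eqb_spec i 0) as [->|]; [exact E0|]; destruct (Nat.eqb_spec i j) as [->|]; [exact Ej|reflexivity].
    + apply rot_invariant; assumption.
    + f_equal; apply functional_extensionality; intros i; unfold rot; rewrite cos_0, sin_0.
      destruct (Nat.eqb i 0); [ring|]; destruct (Nat.eqb i j); [ring|reflexivity].
  - f_equal; apply functional_extensionality; intros i; rewrite <- Hr0 in *.
    destruct (Nat.eqb_spec i 0) as [->|]; [rewrite E0; ring|]; destruct (Nat.eqb_spec i j) as [->|]; [rewrite Ej; ring|reflexivity].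
Qed.

(** The coordinates [1, ..., n - 1] are folded one after another into coordinate 0, which ends on
    the axis. Each fold preserves the norm, so the point never reaches the origin and the next
    rotation is legitimate. *)
Lemma radial (x : nat -> R) : (2 <= n)%nat -> pt n x -> 0 < sq n x -> u x = u (ax (nrm n x)).
Proof.
  intros Hn Hx Hs.
  assert (Hpre : forall k, 0 <= rsum k (fun l => x l ^ 2)) by (intros; apply rsum_nonneg; intros; apply pow2_ge_0).
  assert (Hsqf : forall k, (S k < n)%nat -> pt n (fold_coord x (S k)) /\ sq n (fold_coord x (S k)) = sq n x).
  { intros k Hk; split.
    - intros i Hi; unfold fold_coord; destruct (Nat.eqb_spec i 0); [lia|]; destruct (Nat.leb_spec i (S k)); [lia|apply Hx, Hi].
    - unfold sq; assert (Hj : forall j, (1 <= j <= S (S k))%nat ->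
        rsum j (fun i => fold_coord x (S k) i ^ 2) = rsum (S (S k)) (fun l => x l ^ 2)).
      { induction j as [|j IH]; intros Hj; [lia|]; destruct (Nat.eq_dec j 0) as [->|Hj0].
        - cbn [rsum]; unfold fold_coord; cbn [Nat.eqb]; rewrite pow2_sqrt by apply Hpre; cbn [rsum]; ring.
        - cbn [rsum]; rewrite IH by lia; unfold fold_coord.
          destruct (Nat.eqb_spec j 0); [lia|]; destruct (Nat.leb_spec j (S k)); [|lia]; cbn [rsum]; ring. }
      assert (Hd : forall d, (S (S k) + d <= n)%nat ->
        rsum (S (S k) + d) (fun i => fold_coord x (S k) i ^ 2) = rsum (S (S k) + d) (fun l => x l ^ 2)).
      { induction d as [|d IH]; intros Hd; [rewrite Nat.add_0_r; apply Hj; lia|].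
        rewrite Nat.add_succ_r; cbn [rsum]; rewrite IH by lia; f_equal; unfold fold_coord.
        destruct (Nat.eqb_spec (S (S k) + d) 0); [lia|]; destruct (Nat.leb_spec (S (S k) + d) (S k)); [lia|reflexivity]. }
      replace n with (S (S k) + (n - S (S k)))%nat by lia; apply Hd; lia. }
  assert (Hf : forall k, (S k < n)%nat -> u x = u (fold_coord x (S k))).
  { induction k as [|k IH]; intros Hk.
    - rewrite (fold_step 1 x) by (try assumption; lia); f_equal; apply functional_extensionality; intros i.
      unfold fold_coord; destruct (Nat.eqb_spec i 0); [f_equal; simpl; ring|].
      destruct (Nat.eqb_spec i 1), (Nat.leb_spec i 1); try lia; reflexivity.
    - rewrite IH by lia; destruct (Hsqf k ltac:(lia)) as [H1 H2].
      rewrite (fold_step (S (S k)) (fold_coord x (S k))) by (try assumption; try lia; rewrite H2; exact Hs).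
      f_equal; apply functional_extensionality; intros i; unfold fold_coord.
      destruct (Nat.eqb_spec i 0).
      + rewrite Nat.eqb_refl, pow2_sqrt by apply Hpre; f_equal.
        destruct (Nat.eqb_spec (S (S k)) 0); [lia|]; destruct (Nat.leb_spec (S (S k)) (S k)); [lia|]; reflexivity.
      + destruct (Nat.eqb_spec i (S (S k))), (Nat.leb_spec i (S k)), (Nat.leb_spec i (S (S k))); try lia; reflexivity. }
  rewrite (Hf (n - 2)%nat) by lia; f_equal; apply functional_extensionality; intros i; unfold fold_coord, ax, nrm.
  destruct (Nat.eqb_spec i 0); [do 2 f_equal; lia|].
  destruct (Nat.leb_spec i (S (n - 2))); [reflexivity|apply Hx; lia].
Qed.

Lemma ax_rot (j : nat) (r : R) : (0 < j)%nat -> rot j r (ax r) 0 = ax r.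
Proof.
  intros Hj; apply functional_extensionality; intros i; unfold rot, ax; rewrite cos_0, sin_0.
  destruct (Nat.eqb i 0); [ring|]; destruct (Nat.eqb i j); ring.
Qed.

Lemma sq_ax (r : R) : (0 < n)%nat -> sq n (ax r) = r ^ 2.
Proof.
  intros Hn; rewrite <- (rsum_kron n 0 (fun _ => r ^ 2) Hn); apply rsum_ext; intros i _.
  unfold ax, kron; destruct (Nat.eqb i 0); ring.
Qed.

Lemma ax_derive (f : (nat -> R) -> R) (D : nat -> (nat -> R) -> R) (r : R) : (0 < n)%nat ->
  C1_at n f D (ax r) -> is_derive (fun r => f (ax r)) r (D 0%nat (ax r)).
Proof.
  intros Hn Hf; evar_last.
  - apply (chain_rule n f D ax (fun k => kron k 0) r); [intros; apply pt_ax, Hn|exact Hf|].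
    intros k _; unfold ax, kron; destruct (Nat.eqb k 0); auto_derive; trivial.
  - rewrite (rsum_ext n _ (fun k => kron k 0 * D k (ax r))) by (intros; ring).
    apply (rsum_kron n 0 (fun k => D k (ax r)) Hn).
Qed.

(* Differentiating the identity [grad_rot] at angle [0]. *)
Lemma lap_axis (r : R) : (2 <= n)%nat -> 0 < r ->
  lap n D2u (ax r) = D2u 0%nat 0%nat (ax r) + (INR n - 1) * (D1u 0%nat (ax r) / r).
Proof.
  intros Hn Hr.
  assert (Hp : pt n (ax r)) by (apply pt_ax; lia).
  assert (Hs : 0 < sq n (ax r)) by (rewrite sq_ax by lia; apply pow_lt, Hr).
  destruct (C2_punct_at n u D1u D2u _ HCu Hp Hs) as [_ [_ HC]].
  assert (Hj : forall j, (0 < j < n)%nat -> D2u j j (ax r) = D1u 0%nat (ax r) / r).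
  { intros j Hj.
    assert (Hd : forall i, (i < n)%nat -> is_derive (fun t => D1u i (rot j r (ax r) t)) 0
      (rsum n (fun k => D2u i k (ax r) * rot' j r 0 k))).
    { intros i Hi; evar_last.
      - apply (chain_rule n (D1u i) (D2u i) (rot j r (ax r)) (rot' j r 0) 0).
        + intros; apply pt_rot; assumption.
        + rewrite ax_rot by lia; apply HC, Hi.
        + intros; apply rot_derive; lia.
      - rewrite ax_rot by lia; reflexivity. }
    assert (H0 : is_derive (fun t => D1u 0%nat (rot j r (ax r) t) * (- r * sin t) + D1u j (rot j r (ax r) t) * (r * cos t)) 0 0).
    { apply is_derive_extR with (fun _ => 0); [intros; symmetry; apply grad_rot; assumption|apply (is_derive_const 0)]. }
    assert (H1 : is_derive (fun t => D1u 0%nat (rot j r (ax r) t) * (- r * sin t) + D1u j (rot j r (ax r) t) * (r * cos t)) 0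
      (D1u 0%nat (ax r) * (- r) + D2u j j (ax r) * r * r)).
    { evar_last.
      - apply (is_derive_plus (fun t => D1u 0%nat (rot j r (ax r) t) * (- r * sin t)) (fun t => D1u j (rot j r (ax r) t) * (r * cos t))).
        + apply (is_derive_mulR (fun t => D1u 0%nat (rot j r (ax r) t)) (fun t => - r * sin t) 0
            (rsum n (fun k => D2u 0%nat k (ax r) * rot' j r 0 k)) (- r * cos 0));
            [apply Hd; lia|auto_derive; [exact I|ring]].
        + apply (is_derive_mulR (fun t => D1u j (rot j r (ax r) t)) (fun t => r * cos t) 0
            (rsum n (fun k => D2u j k (ax r) * rot' j r 0 k)) (- r * sin 0));
            [apply Hd; lia|auto_derive; [exact I|ring]].
      - rewrite !rsum_rot', !ax_rot, cos_0, sin_0 by lia; unfold plus, mult; simpl; ring. }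
    apply is_derive_unique in H0; apply is_derive_unique in H1; rewrite H0 in H1.
    assert (H2 : r * (D2u j j (ax r) * r - D1u 0%nat (ax r)) = 0) by lra.
    apply Rmult_integral in H2; destruct H2 as [H2|H2]; [lra|].
    replace (D1u 0%nat (ax r)) with (D2u j j (ax r) * r) by lra; field; lra. }
  set (b := D1u 0%nat (ax r) / r) in *.
  unfold lap; rewrite (rsum_ext n _ (fun i => b + kron i 0 * (D2u 0%nat 0%nat (ax r) - b))).
  - rewrite rsum_plus, rsum_const, (rsum_kron n 0 (fun _ => D2u 0%nat 0%nat (ax r) - b)) by lia; ring.
  - intros i Hi; unfold kron; destruct (Nat.eqb_spec i 0) as [->|Hne]; [ring|rewrite Hj by lia; ring].
Qed.

(** In the logarithmic radius [t = ln r], [A1] is [r u_r]. Its sign is [grad_outward] for the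
    direction [-e_0], and its equation is the Laplacian on the axis from [lap_axis]. *)
Lemma radial_profile : (2 <= n)%nat -> exists A A1 : R -> R,
  (forall x, pt n x -> 0 < sq n x -> u x = A (ln (nrm n x))) /\
  (forall t, A t = u (ax (exp t)) /\ A1 t <= 0 /\ is_derive A t (A1 t) /\
     is_derive A1 t (- (INR n - 2) * A1 t - exp (2 * t) * F (u (ax (exp t))) (v (ax (exp t))))).
Proof.
  intros Hn; exists (fun t => u (ax (exp t))), (fun t => exp t * D1u 0%nat (ax (exp t))); split.
  - intros x Hx Hs; rewrite exp_ln by (apply nrm_pos, Hs); apply radial; assumption.
  - intros t; set (r := exp t).
    assert (Hr : 0 < r) by apply exp_pos.
    assert (Hp : pt n (ax r)) by (apply pt_ax; lia).
    assert (Hs : 0 < sq n (ax r)) by (rewrite sq_ax by lia; apply pow_lt, Hr).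
    destruct (C2_punct_at n u D1u D2u _ HCu Hp Hs) as [_ [HC1 HC2]].
    split; [reflexivity|split; [|split]].
    + assert (H := grad_outward (ax r) (ax (-1)) Hp Hs ltac:(apply pt_ax; lia)).
      assert (E : forall f : nat -> R, rsum n (fun k => f k * ax (-1) k) = - f 0%nat).
      { intros f; rewrite (rsum_ext n _ (fun k => kron k 0 * (- f k))).
        - apply (rsum_kron n 0 (fun k => - f k)); lia.
        - intros k _; unfold ax, kron; destruct (Nat.eqb k 0); ring. }
      unfold dot in H; rewrite !E in H; unfold ax at 1 in H; simpl in H; specialize (H ltac:(lra)); nra.
    + evar_last; [apply (is_derive_comp (fun r => u (ax r)) exp t); [apply (ax_derive u D1u); [lia|exact HC1]|apply is_derive_exp]|].
      unfold scal; simpl; unfold mult; simpl; reflexivity.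
    + evar_last.
      { apply (is_derive_mulR exp (fun t => D1u 0%nat (ax (exp t))) t); [apply is_derive_exp|].
        apply (is_derive_comp (fun r => D1u 0%nat (ax r)) exp t); [apply (ax_derive (D1u 0%nat) (D2u 0%nat)); [lia|apply HC2; lia]|apply is_derive_exp]. }
      pose proof (Hequ (ax r) Hp Hs) as E; rewrite lap_axis in E by assumption.
      unfold plus, scal; simpl; unfold mult; simpl; fold r.
      replace (exp (2 * t)) with (r * r) by (unfold r; rewrite <- exp_plus; f_equal; ring).
      replace (D2u 0%nat 0%nat (ax r)) with (- F (u (ax r)) (v (ax r)) - (INR n - 1) * (D1u 0%nat (ax r) / r)) by lra.
      field; lra.
Qed.

End Symmetry.

(** * The Emden-Fowler system *)

Lemma incr_of_derive (f df : R -> R) (a b : R) : a <= b ->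
  (forall t, a <= t <= b -> is_derive f t (df t)) -> (forall t, a <= t <= b -> 0 <= df t) -> f a <= f b.
Proof.
  intros Hab Hd Hp; destruct (Rle_lt_or_eq_dec a b Hab) as [H|<-]; [|lra].
  destruct (MVT_cor2 f df a b H) as [c [Hc1 Hc2]]; [intros; apply is_derive_Reals, Hd; assumption|].
  specialize (Hp c ltac:(lra)); nra.
Qed.

(** The passage to [s -> -oo] in a lower bound whose right side fades. Combined with a monotone
    quantity it replaces integration from the singularity. *)
Lemma exp_below (k h c T : R) : 0 < k -> (forall s, s <= T -> - c * exp (k * s) <= h) -> 0 <= h.
Proof.
  intros Hk H; destruct (Rle_lt_dec 0 h) as [Hh|Hh]; [exact Hh|exfalso].
  set (c' := Rabs c + 1).
  assert (Hc' : 0 < c') by (unfold c'; pose proof (Rabs_pos c); lra).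
  set (s := Rmin T (ln (- h / c') / k)).
  assert (Hs : exp (k * s) <= - h / c').
  { rewrite <- (exp_ln (- h / c')) by (apply Rdiv_lt_0_compat; lra).
    assert (k * s <= ln (- h / c')).
    { replace (ln (- h / c')) with (k * (ln (- h / c') / k)) by (field; lra).
      apply Rmult_le_compat_l; [lra|apply Rmin_r]. }
    destruct (Rle_lt_or_eq_dec _ _ H0) as [Hlt|Heq]; [left; apply exp_increasing, Hlt|rewrite Heq; lra]. }
  specialize (H s (Rmin_l _ _)).
  assert (Hp : 0 < exp (k * s)) by apply exp_pos.
  assert (c * exp (k * s) < c' * exp (k * s))
    by (apply Rmult_lt_compat_r; [exact Hp|unfold c'; pose proof (Rle_abs c); lra]).
  assert (c' * exp (k * s) <= - h).
  { replace (- h) with (c' * (- h / c')) by (field; lra); apply Rmult_le_compat_l; lra. }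
  lra.
Qed.

Lemma is_derive_exp_lin (k t : R) : is_derive (fun s => exp (k * s)) t (k * exp (k * t)).
Proof. auto_derive; [exact I|ring]. Qed.

Lemma Rpower_exp_l (k t q : R) : Rpower (exp (k * t)) q = exp (q * k * t).
Proof. unfold Rpower; rewrite ln_exp; f_equal; ring. Qed.

Section DecayBounds.

Context (N q mu : R) (HN : 0 < N) (Hq : 0 < q) (Hmu : 0 < mu).
Context (A A1 f : R -> R).
Context (HA : forall t, 0 < A t) (HA1 : forall t, A1 t <= 0).
Context (DA : forall t, is_derive A t (A1 t)).
Context (DA1 : forall t, is_derive A1 t (- N * A1 t - exp (2 * t) * f t)).
Context (Hf : forall t, mu * Rpower (A t) (2 * q + 1) <= f t).

(** With [N = n - 2] this is [- r^(n-1) u_r], the flux through the sphere of radius [r] up to a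
    constant; it increases because [u] is superharmonic. *)
Let J (t : R) : R := exp (N * t) * - A1 t.

Lemma J_derive (t : R) : is_derive J t (exp ((N + 2) * t) * f t).
Proof.
  evar_last.
  - apply (is_derive_mulR (fun s => exp (N * s)) (fun s => - A1 s) t (N * exp (N * t)) (- (- N * A1 t - exp (2 * t) * f t)));
      [apply is_derive_exp_lin|apply (is_derive_opp A1), DA1].
  - unfold plus, mult; simpl; replace ((N + 2) * t) with (N * t + 2 * t) by ring; rewrite exp_plus; ring.
Qed.

Lemma forcing_pos (t : R) : 0 < f t.
Proof. eapply Rlt_le_trans; [|apply Hf]; apply Rmult_lt_0_compat; [exact Hmu|apply Rpower_pos]. Qed.

Lemma A_decr (s t : R) : s <= t -> A t <= A s.
Proof.
  intros Hst; apply Ropp_le_cancel; apply (incr_of_derive (fun t => - A t) (fun t => - A1 t) s t Hst).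
  - intros r _; apply (is_derive_opp A), DA.
  - intros r _; specialize (HA1 r); lra.
Qed.

(** On [[t, t + 1]] the mean value theorem gives a point [c] with [- A1 c = A t - A (t + 1) < A t],
    and the monotone flux [J] carries this back to [t] at the cost of [exp N]. *)
Lemma gradient_bound (t : R) : - A1 t <= exp N * A t.
Proof.
  destruct (MVT_cor2 A A1 t (t + 1)) as [c [Hc1 Hc2]]; [lra|intros; apply is_derive_Reals, DA|].
  assert (HJ : J t <= J c).
  { apply (incr_of_derive J (fun t => exp ((N + 2) * t) * f t) t c); [lra|intros; apply J_derive|].
    intros; apply Rlt_le, Rmult_lt_0_compat; [apply exp_pos|apply forcing_pos]. }
  unfold J in HJ.
  assert (Hexp : exp (N * c) <= exp (N * t) * exp N).
  { rewrite <- exp_plus; destruct (Rle_lt_or_eq_dec (N * c) (N * t + N)) as [H|H]; [nra|left; apply exp_increasing, H|rewrite H; lra]. }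
  pose proof (HA (t + 1)); pose proof (HA1 c); pose proof (exp_pos (N * t)); pose proof (exp_pos N).
  assert (H3 : exp (N * c) * - A1 c <= exp (N * t) * exp N * - A1 c) by (apply Rmult_le_compat_r; lra).
  assert (H4 : - A1 t <= exp N * - A1 c).
  { apply (Rmult_le_reg_l (exp (N * t))); lra. }
  assert (exp N * - A1 c <= exp N * A t) by (apply Rmult_le_compat_l; lra); lra.
Qed.

(** Before [t] the decreasing [A] is at least [A t], so the forcing is at least [al]. Integrating
    the flux equation from [-oo], where [J >= 0], gives the estimate. *)
Lemma decay_rate (t : R) : mu / (N + 2) * exp (2 * t) * Rpower (A t) (2 * q + 1) <= - A1 t.
Proof.
  set (al := mu * Rpower (A t) (2 * q + 1)).
  set (H := fun s => J s - al / (N + 2) * exp ((N + 2) * s)).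
  assert (Hal : 0 < al) by (apply Rmult_lt_0_compat; [exact Hmu|apply Rpower_pos]).
  assert (Hinc : forall s, s <= t -> H s <= H t).
  { intros s Hs; apply (incr_of_derive H (fun r => exp ((N + 2) * r) * f r - al / (N + 2) * ((N + 2) * exp ((N + 2) * r))) s t Hs).
    - intros r _; apply (is_derive_minus J (fun s => al / (N + 2) * exp ((N + 2) * s))); [apply J_derive|].
      apply (is_derive_scal (fun s => exp ((N + 2) * s))), is_derive_exp_lin.
    - intros r Hr; replace (_ - _) with (exp ((N + 2) * r) * (f r - al)) by (field; lra).
      apply Rmult_le_pos; [left; apply exp_pos|].
      assert (al <= mu * Rpower (A r) (2 * q + 1)).
      { apply Rmult_le_compat_l; [lra|]; apply Rle_Rpower_l; [lra|split; [apply HA|apply A_decr; lra]]. }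
      specialize (Hf r); lra. }
  assert (H0 : 0 <= H t).
  { apply (exp_below (N + 2) (H t) (al / (N + 2)) t); [lra|]; intros s Hs.
    specialize (Hinc s Hs); assert (0 <= J s) by (apply Rmult_le_pos; [left; apply exp_pos|specialize (HA1 s); lra]).
    unfold H in *; lra. }
  unfold H, J in H0; replace ((N + 2) * t) with (N * t + 2 * t) in H0 by ring; rewrite exp_plus in H0.
  apply (Rmult_le_reg_l (exp (N * t))); [apply exp_pos|].
  replace (exp (N * t) * (mu / (N + 2) * exp (2 * t) * Rpower (A t) (2 * q + 1)))
    with (al / (N + 2) * (exp (N * t) * exp (2 * t))) by (unfold al; field; lra); lra.
Qed.

(** Separation of variables: by [decay_rate], [Z = A^(-2q)] has [Z' >= 2 q ka exp (2 t)], and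
    [Z > 0] near [-oo], so [Z >= q ka exp (2 t)]. The power [1 / (2q)] of this is the claim. *)
Lemma decay_bound (t : R) : exp (1 / q * t) * A t <= Rpower (q * mu / (N + 2)) (- (1 / (2 * q))).
Proof.
  set (ka := mu / (N + 2)).
  assert (Hka : 0 < ka) by (apply Rdiv_lt_0_compat; lra).
  set (Z := fun t => Rpower (A t) (- (2 * q))).
  set (H := fun t => Z t - q * ka * exp (2 * t)).
  assert (DZ : forall s, is_derive Z s (A1 s * (- (2 * q) / A s * Rpower (A s) (- (2 * q))))).
  { intros s; apply (is_derive_comp (fun x => Rpower x (- (2 * q))) A s); [apply is_derive_Rpower, HA|apply DA]. }
  assert (Hinc : forall s, s <= t -> H s <= H t).
  { intros s Hs; apply (incr_of_derive H (fun s => A1 s * (- (2 * q) / A s * Rpower (A s) (- (2 * q))) - q * ka * (2 * exp (2 * s))) s t Hs).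
    - intros r _; apply (is_derive_minus Z (fun s => q * ka * exp (2 * s))); [apply DZ|].
      apply (is_derive_scal (fun s => exp (2 * s))), is_derive_exp_lin.
    - intros r _; pose proof (decay_rate r) as Hr; fold ka in Hr; pose proof (HA r) as HAr.
      set (P := Rpower (A r) (- (2 * q))).
      assert (HP : 0 < P) by apply Rpower_pos.
      assert (EP : P * Rpower (A r) (2 * q + 1) = A r).
      { unfold P; rewrite <- Rpower_plus; replace (- (2 * q) + (2 * q + 1)) with 1 by ring; apply Rpower_1, HAr. }
      assert (Hr' : P * (ka * exp (2 * r) * Rpower (A r) (2 * q + 1)) <= P * - A1 r) by (apply Rmult_le_compat_l; lra).
      replace (P * (ka * exp (2 * r) * Rpower (A r) (2 * q + 1))) with (ka * exp (2 * r) * A r) in Hr'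
        by (rewrite <- EP at 1; ring).
      replace (A1 r * (- (2 * q) / A r * P) - q * ka * (2 * exp (2 * r)))
        with (2 * q / A r * (P * - A1 r - ka * exp (2 * r) * A r)) by (field; lra).
      apply Rmult_le_pos; [apply Rlt_le, Rdiv_lt_0_compat; lra|lra]. }
  assert (H0 : 0 <= H t).
  { apply (exp_below 2 (H t) (q * ka) t); [lra|]; intros s Hs; specialize (Hinc s Hs).
    assert (0 < Z s) by apply Rpower_pos; unfold H in *; lra. }
  assert (HZ : q * ka * exp (2 * t) <= Z t) by (unfold H in H0; lra).
  assert (Hqk : 0 < q * ka) by (apply Rmult_lt_0_compat; assumption).
  assert (HB : 0 < q * ka * exp (2 * t)) by (apply Rmult_lt_0_compat; [exact Hqk|apply exp_pos]).
  set (g := 1 / (2 * q)).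
  assert (Hg : 0 < g) by (apply Rdiv_lt_0_compat; lra).
  assert (H1 : Rpower (q * ka * exp (2 * t)) g <= Rpower (Z t) g) by (apply Rle_Rpower_l; lra).
  replace (Rpower (Z t) g) with (/ A t) in H1.
  2:{ unfold Z; rewrite Rpower_mult; replace (- (2 * q) * g) with (-(1)) by (unfold g; field; lra).
      rewrite Rpower_Ropp, Rpower_1 by apply HA; reflexivity. }
  rewrite <- Rpower_mult_distr in H1 by (try apply exp_pos; lra).
  rewrite Rpower_exp_l in H1; replace (g * 2 * t) with (1 / q * t) in H1 by (unfold g; field; lra).
  replace (q * mu / (N + 2)) with (q * ka) by (unfold ka; field; lra).
  rewrite Rpower_Ropp; set (Q := Rpower (q * ka) g) in *.
  assert (HQ : 0 < Q) by apply Rpower_pos.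
  apply (Rmult_le_reg_l Q); [exact HQ|]; rewrite Rinv_r by lra.
  pose proof (HA t) as HAt; apply (Rmult_le_compat_r (A t)) in H1; [|lra].
  rewrite Rinv_l in H1 by lra; lra.
Qed.

End DecayBounds.

(** A Barbalat argument. If [D t >= eps], the Lipschitz bound keeps [D >= eps / 2] on [[t - h, t]],
    so [E] gains at least [eta] there; this is impossible once [E] is within [eta] of its
    infimum. *)
Lemma derivative_vanishes (E D D' : R -> R) (a M L : R) : 0 < a -> 0 < L ->
  (forall t, is_derive E t (a * D t)) -> (forall t, 0 <= D t) -> (forall t, Rabs (E t) <= M) ->
  (forall t, is_derive D t (D' t)) -> (forall t, Rabs (D' t) <= L) ->
  forall eps, 0 < eps -> exists T, forall t, t <= T -> D t < eps.
Proof.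
  intros Ha HL DE HD HE DD HD' eps He.
  assert (Hinc : forall s t, s <= t -> E s <= E t).
  { intros s t Hst; apply (incr_of_derive E (fun t => a * D t) s t Hst); [intros; apply DE|].
    intros; apply Rmult_le_pos; [lra|apply HD]. }
  set (h := eps / (2 * L)); assert (Hh : 0 < h) by (apply Rdiv_lt_0_compat; lra).
  set (eta := a * (eps / 2) * h); assert (Heta : 0 < eta) by (apply Rmult_lt_0_compat; [apply Rmult_lt_0_compat; lra|exact Hh]).
  destruct (completeness (fun r => exists t, r = - E t)) as [e [He1 He2]].
  - exists M; intros r [t ->]; specialize (HE t); apply Rabs_le_between in HE; lra.
  - exists (- E 0), 0; reflexivity.
  - assert (Hex : exists T, - e <= E T < - e + eta).
    { apply NNPP; intros Hn; assert (e <= e - eta); [|lra].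
      apply He2; intros r [t ->]; destruct (Rle_lt_dec (- E t) (e - eta)) as [H|H]; [exact H|].
      exfalso; apply Hn; exists t; specialize (He1 (- E t) (ex_intro _ t eq_refl)); lra. }
    destruct Hex as [T HT]; exists T; intros t Ht.
    destruct (Rlt_le_dec (D t) eps) as [H|H]; [exact H|exfalso].
    destruct (MVT_cor2 E (fun t => a * D t) (t - h) t) as [c [Hc1 Hc2]]; [lra|intros; apply is_derive_Reals, DE|].
    destruct (MVT_cor2 D D' c t) as [d [Hd1 Hd2]]; [lra|intros; apply is_derive_Reals, DD|].
    specialize (HD' d); apply Rabs_le_between in HD'.
    assert (D' d * (t - c) <= L * h) by (apply Rle_trans with (L * (t - c)); [apply Rmult_le_compat_r|apply Rmult_le_compat_l]; lra).
    assert (EL : L * h = eps / 2) by (unfold h; field; lra).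
    assert (Hge : eta <= a * D c * (t - (t - h))).
    { unfold eta; replace (t - (t - h)) with h by ring; apply Rmult_le_compat_r; [lra|]; apply Rmult_le_compat_l; lra. }
    pose proof (Hinc t T Ht); specialize (He1 (- E (t - h)) (ex_intro _ (t - h) eq_refl)); lra.
Qed.

(** At the last time [s] before [t0] with [y <= eta], continuity gives [y s = eta], and [y > eta]
    just after forces a slope [>= 0]. *)
Lemma barrier_backward (y y' : R -> R) (eta t0 : R) :
  (forall t, t <= t0 -> is_derive y t (y' t)) -> eta < y t0 ->
  (forall t, t <= t0 -> y t = eta -> y' t < 0) -> forall t, t <= t0 -> eta < y t.
Proof.
  intros Dy H0 Hb t1 Ht1; destruct (Rlt_le_dec eta (y t1)) as [H|H]; [exact H|exfalso].
  destruct (completeness (fun s => t1 <= s <= t0 /\ y s <= eta)) as [s [Hs1 Hs2]].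
  - exists t0; intros s [Hs _]; lra.
  - exists t1; lra.
  - assert (Hts : t1 <= s <= t0) by (split; [apply Hs1; lra|apply Hs2; intros r [Hr _]; lra]).
    assert (Hafter : forall r, s < r <= t0 -> eta < y r).
    { intros r Hr; destruct (Rlt_le_dec eta (y r)) as [Hy|Hy]; [exact Hy|].
      assert (r <= s) by (apply Hs1; lra); lra. }
    assert (Hc : forall eps, 0 < eps -> exists d, 0 < d /\ forall r, Rabs (r - s) < d -> Rabs (y r - y s) < eps).
    { intros eps Heps.
      assert (Hcont : continuous y s) by (apply (ex_derive_continuous y); exists (y' s); apply Dy; lra).
      destruct (proj1 (flim_eps (locally s) y (y s)) Hcont eps Heps) as [d Hd].
      exists d; split; [apply cond_pos|]; intros r Hr; apply Hd.
      apply ball_R; exact Hr. }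
    assert (Hys : y s = eta).
    { destruct (Rtotal_order (y s) eta) as [Hy|[Hy|Hy]]; [|exact Hy|].
      - assert (Hlt : s < t0) by (destruct (Rle_lt_or_eq_dec s t0 ltac:(lra)) as [?|E]; [assumption|subst s; lra]).
        destruct (Hc (eta - y s) ltac:(lra)) as [d [Hd1 Hd2]].
        set (r := s + Rmin (d / 2) (t0 - s)).
        assert (Hr : 0 < Rmin (d / 2) (t0 - s)) by (apply Rmin_pos; lra).
        pose proof (Rmin_l (d / 2) (t0 - s)); pose proof (Rmin_r (d / 2) (t0 - s)).
        specialize (Hd2 r ltac:(unfold r; apply Rabs_def1; lra)); apply Rabs_def2 in Hd2.
        specialize (Hafter r ltac:(unfold r; lra)); lra.
      - destruct (Hc (y s - eta) ltac:(lra)) as [d [Hd1 Hd2]].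
        assert (s <= s - d / 2); [|lra]; apply Hs2; intros r [Hr1 Hr2].
        destruct (Rle_lt_dec r (s - d / 2)) as [Hr|Hr]; [exact Hr|exfalso].
        assert (r <= s) by (apply Hs1; split; assumption).
        specialize (Hd2 r ltac:(apply Rabs_def1; lra)); apply Rabs_def2 in Hd2; lra. }
    assert (Hlt : s < t0) by (destruct (Rle_lt_or_eq_dec s t0 ltac:(lra)) as [?|E]; [assumption|subst s; lra]).
    assert (0 <= y' s); [|specialize (Hb s ltac:(lra) Hys); lra].
    apply (derive_right_min y s (y' s) (t0 - s)); [apply Dy; lra|lra|].
    intros r Hr; specialize (Hafter r ltac:(lra)); lra.
Qed.

Definition coupled (mu beta q x y : R) : R := mu * Rpower x (2 * q + 1) + beta * Rpower x q * Rpower y (q + 1).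

(** * Energy and behaviour of bounded orbits at -oo *)

Section EmdenFowler.

Context (N q mu1 mu2 beta K L : R).
Context (HN : 0 < N) (Hq : 0 < q) (Hmu1 : 0 < mu1) (Hmu2 : 0 < mu2) (Hbeta : 0 < beta) (HL : 0 < L).
Let de := 1 / q.
Context (HdN : 1 / q < N) (HdN2 : N < 2 * (1 / q)).
(** The coefficients produced by [u = r^(-de) X] in the radial equation. [HdN2] makes the
    antidamping [a] positive and [HdN] makes [b] positive. *)
Let a := 2 * de - N.
Let b := de * (N - de).
Let f (mu x y : R) : R := coupled mu beta q x y.
Context (X X1 Y Y1 : R -> R).
Context (HX : forall t, 0 < X t <= K) (HY : forall t, 0 < Y t <= K).
Context (HX1 : forall t, Rabs (X1 t) <= L * X t) (HY1 : forall t, Rabs (Y1 t) <= L * Y t).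
Context (DX : forall t, is_derive X t (X1 t)) (DY : forall t, is_derive Y t (Y1 t)).
Context (DX1 : forall t, is_derive X1 t (a * X1 t + b * X t - f mu1 (X t) (Y t))).
Context (DY1 : forall t, is_derive Y1 t (a * Y1 t + b * Y t - f mu2 (Y t) (X t))).

Lemma de_pos : 0 < de.
Proof. apply Rdiv_lt_0_compat; lra. Qed.

Lemma a_pos : 0 < a.
Proof. unfold a, de; lra. Qed.

Lemma b_pos : 0 < b.
Proof. apply Rmult_lt_0_compat; [apply de_pos|unfold de; lra]. Qed.

Lemma K_pos : 0 < K.
Proof. specialize (HX 0); lra. Qed.

Lemma coupling_pos (mu x y : R) : 0 < mu -> 0 < f mu x y.
Proof.
  intros Hmu; unfold f, coupled; pose proof (Rpower_pos x (2 * q + 1)); pose proof (Rpower_pos x q); pose proof (Rpower_pos y (q + 1)).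
  assert (0 < mu * Rpower x (2 * q + 1)) by (apply Rmult_lt_0_compat; assumption).
  assert (0 < beta * Rpower x q * Rpower y (q + 1)) by (repeat apply Rmult_lt_0_compat; assumption); lra.
Qed.

Lemma coupling_le (mu x y : R) : 0 < mu -> 0 < x <= K -> 0 < y <= K -> f mu x y <= f mu K K.
Proof.
  intros Hmu Hx Hy; unfold f, coupled; apply Rplus_le_compat.
  - apply Rmult_le_compat_l; [lra|apply Rle_Rpower_l; lra].
  - apply Rmult_le_compat; [|left; apply Rpower_pos| |apply Rle_Rpower_l; lra].
    + apply Rmult_le_pos; [lra|left; apply Rpower_pos].
    + apply Rmult_le_compat_l; [lra|apply Rle_Rpower_l; lra].
Qed.

Let D (t : R) : R := X1 t ^ 2 + Y1 t ^ 2.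
Let W2 (t : R) : R := X t ^ 2 + Y t ^ 2.
Let P (t : R) : R := X t * f mu1 (X t) (Y t) + Y t * f mu2 (Y t) (X t).
Let V (t : R) : R := mu1 * Rpower (X t) (2 * q + 2) + 2 * beta * (Rpower (X t) (q + 1) * Rpower (Y t) (q + 1))
                     + mu2 * Rpower (Y t) (2 * q + 2).
(** Kinetic minus quadratic energy plus a potential [V / (2q + 2)] whose gradient in [(X, Y)] is the
    coupling: the common coefficient [beta] makes the system variational. *)
Let E (t : R) : R := D t / 2 - b / 2 * W2 t + V t / (2 * q + 2).
Let g (t : R) : R := X t * X1 t + Y t * Y1 t.

Lemma Rpower_S (x r : R) : 0 < x -> Rpower x (r + 1) = x * Rpower x r.
Proof. intros Hx; rewrite Rpower_plus, Rpower_1 by exact Hx; ring. Qed.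

Lemma V_P (t : R) : V t = P t.
Proof.
  destruct (HX t) as [Hx _]; destruct (HY t) as [Hy _]; unfold V, P, f, coupled.
  replace (2 * q + 2) with (2 * q + 1 + 1) by ring; rewrite !Rpower_S by assumption; ring.
Qed.

Lemma E_derive (t : R) : is_derive E t (a * D t).
Proof.
  destruct (HX t) as [Hx _]; destruct (HY t) as [Hy _].
  assert (R2 : forall h h1 s, (forall t, is_derive h t (h1 t)) -> 0 < h t ->
     is_derive (fun t => Rpower (h t) s) t (h1 t * (s / h t * Rpower (h t) s))).
  { intros h h1 s Hh Hp; apply (is_derive_comp (fun x => Rpower x s) h t); [apply is_derive_Rpower, Hp|apply Hh]. }
  assert (Sq : forall h l, is_derive h t l -> is_derive (fun t => h t ^ 2) t (2 * h t * l)).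
  { intros h l Hh; evar_last; [apply (is_derive_pow h 2 t l Hh)|simpl; ring]. }
  evar_last.
  - apply (is_derive_plus (fun t => D t / 2 - b / 2 * W2 t) (fun t => V t / (2 * q + 2)) t).
    + apply (is_derive_minus (fun t => D t / 2) (fun t => b / 2 * W2 t) t).
      * apply is_derive_extR with (fun t => / 2 * D t); [intros; field|].
        apply (is_derive_scal D t (/ 2)), (is_derive_plus (fun t => X1 t ^ 2) (fun t => Y1 t ^ 2)); apply Sq; [apply DX1|apply DY1].
      * apply (is_derive_scal W2 t (b / 2)), (is_derive_plus (fun t => X t ^ 2) (fun t => Y t ^ 2)); apply Sq; [apply DX|apply DY].
    + apply is_derive_extR with (fun t => / (2 * q + 2) * V t); [intros; field; lra|].
      apply (is_derive_scal V t (/ (2 * q + 2))).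
      apply (is_derive_plus (fun t => mu1 * Rpower (X t) (2 * q + 2) + 2 * beta * (Rpower (X t) (q + 1) * Rpower (Y t) (q + 1)))
        (fun t => mu2 * Rpower (Y t) (2 * q + 2))).
      * apply (is_derive_plus (fun t => mu1 * Rpower (X t) (2 * q + 2)) (fun t => 2 * beta * (Rpower (X t) (q + 1) * Rpower (Y t) (q + 1)))).
        -- apply (is_derive_scal (fun t => Rpower (X t) (2 * q + 2))), (R2 X X1); assumption.
        -- apply (is_derive_scal (fun t => Rpower (X t) (q + 1) * Rpower (Y t) (q + 1))).
           apply (is_derive_mulR (fun t => Rpower (X t) (q + 1)) (fun t => Rpower (Y t) (q + 1)));
             [apply (R2 X X1); assumption|apply (R2 Y Y1); assumption].
      * apply (is_derive_scal (fun t => Rpower (Y t) (2 * q + 2))), (R2 Y Y1); assumption.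
  - unfold minus, plus, opp, mult; simpl; unfold D, f, coupled.
    replace (2 * q + 2) with (2 * q + 1 + 1) by ring; rewrite !Rpower_S by assumption.
    field; repeat split; lra.
Qed.

(** A virial identity: [g] is half the derivative of [W2]. By homogeneity [V = P], and eliminating
    it in favour of [E] exposes the sign of the energy. *)
Lemma g_derive (t : R) : is_derive g t ((q + 2) * D t + a * g t - q * b * W2 t - (2 * q + 2) * E t).
Proof.
  evar_last.
  - apply (is_derive_plus (fun t => X t * X1 t) (fun t => Y t * Y1 t)).
    + apply (is_derive_mulR X X1 t _ _ (DX t) (DX1 t)).
    + apply (is_derive_mulR Y Y1 t _ _ (DY t) (DY1 t)).
  - unfold E; rewrite V_P; unfold plus, mult, P, W2, D, g; simpl; field; lra.
Qed.

Lemma X1_bound (t : R) : Rabs (X1 t) <= L * K /\ Rabs (Y1 t) <= L * K.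
Proof.
  split; eapply Rle_trans; try apply HX1; try apply HY1; apply Rmult_le_compat_l; try lra; [apply HX|apply HY].
Qed.

Lemma g_bound (t : R) (e : R) : Rabs (X1 t) <= e -> Rabs (Y1 t) <= e -> Rabs (g t) <= 2 * K * e.
Proof.
  intros H1 H2; unfold g; eapply Rle_trans; [apply Rabs_triang|]; rewrite !Rabs_mult.
  destruct (HX t); destruct (HY t); rewrite (Rabs_right (X t)), (Rabs_right (Y t)) by lra.
  assert (X t * Rabs (X1 t) <= K * e) by (apply Rmult_le_compat; try lra; apply Rabs_pos).
  assert (Y t * Rabs (Y1 t) <= K * e) by (apply Rmult_le_compat; try lra; apply Rabs_pos); lra.
Qed.

Lemma E_bound : exists M, forall t, Rabs (E t) <= M.
Proof.
  pose proof b_pos as Hb; pose proof K_pos as HK.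
  set (M3 := mu1 * Rpower K (2 * q + 2) + 2 * beta * (Rpower K (q + 1) * Rpower K (q + 1)) + mu2 * Rpower K (2 * q + 2)).
  exists ((L * K) ^ 2 + b * K ^ 2 + M3 / (2 * q + 2)); intros t.
  destruct (X1_bound t) as [H1 H2]; apply Rabs_le_between in H1, H2.
  destruct (HX t) as [Hx1 Hx2]; destruct (HY t) as [Hy1 Hy2].
  assert (HD : 0 <= D t <= 2 * (L * K) ^ 2) by (unfold D; split; nra).
  assert (HW : 0 <= W2 t <= 2 * K ^ 2) by (unfold W2; split; nra).
  assert (HV : 0 < V t <= M3).
  { unfold V, M3; pose proof (Rpower_pos (X t) (2 * q + 2)); pose proof (Rpower_pos (Y t) (2 * q + 2)).
    pose proof (Rpower_pos (X t) (q + 1)); pose proof (Rpower_pos (Y t) (q + 1)).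
    assert (Rpower (X t) (2 * q + 2) <= Rpower K (2 * q + 2)) by (apply Rle_Rpower_l; lra).
    assert (Rpower (Y t) (2 * q + 2) <= Rpower K (2 * q + 2)) by (apply Rle_Rpower_l; lra).
    assert (Rpower (X t) (q + 1) <= Rpower K (q + 1)) by (apply Rle_Rpower_l; lra).
    assert (Rpower (Y t) (q + 1) <= Rpower K (q + 1)) by (apply Rle_Rpower_l; lra).
    assert (Rpower (X t) (q + 1) * Rpower (Y t) (q + 1) <= Rpower K (q + 1) * Rpower K (q + 1)) by (apply Rmult_le_compat; lra).
    split; [|repeat apply Rplus_le_compat; apply Rmult_le_compat_l; lra].
    repeat apply Rplus_lt_0_compat; repeat apply Rmult_lt_0_compat; lra. }
  assert (HbW : 0 <= b / 2 * W2 t <= b * K ^ 2).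
  { split; [apply Rmult_le_pos; lra|]; replace (b * K ^ 2) with (b / 2 * (2 * K ^ 2)) by field; apply Rmult_le_compat_l; lra. }
  assert (HV' : 0 < V t / (2 * q + 2) <= M3 / (2 * q + 2)).
  { split; [apply Rdiv_lt_0_compat; lra|]; apply Rmult_le_compat_r; [left; apply Rinv_0_lt_compat|]; lra. }
  unfold E; apply Rabs_le_between; lra.
Qed.

Let D' (t : R) : R := 2 * X1 t * (a * X1 t + b * X t - f mu1 (X t) (Y t)) + 2 * Y1 t * (a * Y1 t + b * Y t - f mu2 (Y t) (X t)).

Lemma D_derive (t : R) : is_derive D t (D' t).
Proof.
  apply (is_derive_plus (fun t => X1 t ^ 2) (fun t => Y1 t ^ 2)); evar_last.
  - apply (is_derive_pow X1 2 t _ (DX1 t)).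
  - simpl; ring.
  - apply (is_derive_pow Y1 2 t _ (DY1 t)).
  - simpl; ring.
Qed.

Lemma D'_bound : exists M, 0 < M /\ forall t, Rabs (D' t) <= M.
Proof.
  pose proof a_pos as Ha; pose proof b_pos as Hb; pose proof K_pos as HK.
  set (LK := L * K); assert (HLK : 0 < LK) by (apply Rmult_lt_0_compat; assumption).
  set (B := a * LK + b * K + f mu1 K K + f mu2 K K).
  pose proof (coupling_pos mu1 K K Hmu1); pose proof (coupling_pos mu2 K K Hmu2).
  assert (0 < a * LK) by (apply Rmult_lt_0_compat; assumption).
  assert (0 < b * K) by (apply Rmult_lt_0_compat; assumption).
  assert (Haux : forall mu x1 x y, 0 < mu -> f mu K K <= f mu1 K K + f mu2 K K -> Rabs x1 <= LK -> 0 < x <= K -> 0 < y <= K ->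
    Rabs (2 * x1 * (a * x1 + b * x - f mu x y)) <= 2 * LK * B).
  { intros mu x1 x y Hmu Hsum Hx1 Hx Hy; pose proof (coupling_pos mu x y Hmu); pose proof (coupling_le mu x y Hmu Hx Hy).
    assert (0 <= b * x <= b * K) by (split; [apply Rmult_le_pos|apply Rmult_le_compat_l]; lra).
    apply Rabs_le_between in Hx1.
    assert (- (a * LK) <= a * x1 <= a * LK).
    { split; [replace (- (a * LK)) with (a * - LK) by ring|]; apply Rmult_le_compat_l; lra. }
    rewrite Rabs_mult; apply Rmult_le_compat; try apply Rabs_pos; apply Rabs_le_between; unfold B; lra. }
  exists (2 * LK * B + 2 * LK * B); split.
  - assert (0 < LK * B) by (apply Rmult_lt_0_compat; [exact HLK|unfold B; lra]); lra.
  - intros t; unfold D'; eapply Rle_trans; [apply Rabs_triang|]; destruct (X1_bound t).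
    apply Rplus_le_compat; apply Haux; try assumption; try apply HX; try apply HY; lra.
Qed.

Lemma D_nonneg (t : R) : 0 <= D t.
Proof. unfold D; pose proof (pow2_ge_0 (X1 t)); pose proof (pow2_ge_0 (Y1 t)); lra. Qed.

Lemma D_small_left (eps : R) : 0 < eps -> exists T, forall t, t <= T -> D t < eps.
Proof.
  destruct E_bound as [M HM]; destruct D'_bound as [M' [HM' HD']].
  apply (derivative_vanishes E D D' a M M'); try assumption; [apply a_pos|apply E_derive|apply D_nonneg|apply D_derive].
Qed.

(** [derivative_vanishes] after time reversal, with [- E (- t)] so that the energy is again
    increasing. *)
Lemma D_small_right (eps : R) : 0 < eps -> exists T, forall t, T <= t -> D t < eps.
Proof.
  intros He; destruct E_bound as [M HM]; destruct D'_bound as [M' [HM' HD']].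
  assert (Hm : forall s, is_derive (fun t => - t) s (-1)) by (intros; auto_derive; [exact I|ring]).
  destruct (derivative_vanishes (fun t => - E (- t)) (fun t => D (- t)) (fun t => - D' (- t)) a M M') with (eps := eps) as [T HT]; try assumption.
  - apply a_pos.
  - intros t; evar_last; [apply (is_derive_opp (fun t => E (- t))), (is_derive_comp E (fun t => - t) t); [apply E_derive|apply Hm]|].
    unfold opp, scal; simpl; unfold mult; simpl; ring.
  - intros; apply D_nonneg.
  - intros; rewrite Rabs_Ropp; apply HM.
  - intros t; evar_last; [apply (is_derive_comp D (fun t => - t) t); [apply D_derive|apply Hm]|].
    unfold scal; simpl; unfold mult; simpl; ring.
  - intros; rewrite Rabs_Ropp; apply HD'.
  - exists (- T); intros t Ht; rewrite <- (Ropp_involutive t); apply HT; lra.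
Qed.

Lemma sqrt_D_bound (t eps : R) : 0 < eps -> D t < eps ^ 2 -> Rabs (X1 t) <= eps /\ Rabs (Y1 t) <= eps.
Proof.
  intros He HD; unfold D in HD; pose proof (pow2_ge_0 (X1 t)); pose proof (pow2_ge_0 (Y1 t)).
  split; apply Rabs_le_between; split; nra.
Qed.

Lemma E_incr (s t : R) : s <= t -> E s <= E t.
Proof.
  intros Hst; apply (incr_of_derive E (fun t => a * D t) s t Hst); [intros; apply E_derive|].
  intros; apply Rmult_le_pos; [left; apply a_pos|apply D_nonneg].
Qed.

(** If [E t0 = e0 > 0], then [E >= e0] afterwards while the velocities tend to 0, so [g_derive]
    makes [g] decrease at a fixed rate, although [g] is bounded. *)
Lemma E_nonpos (t0 : R) : E t0 <= 0.
Proof.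
  destruct (Rle_lt_dec (E t0) 0) as [H|H]; [exact H|exfalso].
  pose proof a_pos as Ha; pose proof b_pos as Hb; pose proof K_pos as HK.
  set (e0 := E t0) in *.
  (* [C * eps] bounds [(q + 2) * D + a * g] when [D < eps^2] and [eps <= 1]; [eps] makes it at most
     [(q + 1) * e0], half of the energy term. *)
  set (C := q + 2 + 2 * a * K).
  assert (HC : 0 < C) by (unfold C; assert (0 < a * K) by (apply Rmult_lt_0_compat; assumption); lra).
  set (eps := Rmin 1 ((q + 1) * e0 / C)).
  assert (Heps : 0 < eps) by (apply Rmin_pos; [lra|apply Rdiv_lt_0_compat; [apply Rmult_lt_0_compat|]; lra]).
  destruct (D_small_right (eps ^ 2) (pow_lt _ _ Heps)) as [T0 HT0].
  set (T := Rmax T0 t0).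
  assert (Hg' : forall t, T <= t -> (q + 2) * D t + a * g t - q * b * W2 t - (2 * q + 2) * E t <= - ((q + 1) * e0)).
  { intros t Ht; pose proof (Rmax_l T0 t0) as HT1; pose proof (Rmax_r T0 t0) as HT2.
    specialize (HT0 t ltac:(unfold T in Ht; lra)).
    pose proof (E_incr t0 t ltac:(unfold T in Ht; lra)) as HE; fold e0 in HE.
    destruct (sqrt_D_bound t eps Heps HT0) as [Hd1 Hd2]; pose proof (g_bound t eps Hd1 Hd2) as Hg; apply Rabs_le_between in Hg.
    assert (Heps1 : eps ^ 2 <= eps) by (pose proof (Rmin_l 1 ((q + 1) * e0 / C)) as Hm; fold eps in Hm; nra).
    assert (HCe : C * eps <= (q + 1) * e0).
    { replace ((q + 1) * e0) with (C * ((q + 1) * e0 / C)) by (field; lra); apply Rmult_le_compat_l; [lra|apply Rmin_r]. }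
    assert (0 <= q * b * W2 t).
    { apply Rmult_le_pos; [apply Rmult_le_pos; lra|]; unfold W2; pose proof (pow2_ge_0 (X t)); pose proof (pow2_ge_0 (Y t)); lra. }
    assert ((q + 2) * D t <= (q + 2) * eps) by (apply Rmult_le_compat_l; lra).
    assert (a * g t <= a * (2 * K * eps)) by (apply Rmult_le_compat_l; lra).
    assert ((2 * q + 2) * e0 <= (2 * q + 2) * E t) by (apply Rmult_le_compat_l; lra).
    unfold C in HCe; lra. }
  set (B := 2 * K * (L * K)).
  assert (HgB : forall t, - B <= g t <= B).
  { intros t; destruct (X1_bound t) as [H1 H2]; apply Rabs_le_between, g_bound; assumption. }
  set (ka := (q + 1) * e0); assert (Hka : 0 < ka) by (apply Rmult_lt_0_compat; lra).
  (* Over this length [g] would drop by at least [2 * B + 1], more than the bound [B] on its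
     absolute value permits. *)
  set (h := (2 * B + 1) / ka).
  assert (HB : 0 < B) by (unfold B; repeat apply Rmult_lt_0_compat; lra).
  assert (Hh : 0 < h) by (apply Rdiv_lt_0_compat; lra).
  destruct (MVT_cor2 g (fun t => (q + 2) * D t + a * g t - q * b * W2 t - (2 * q + 2) * E t) T (T + h)) as [c [Hc1 Hc2]];
    [lra|intros; apply is_derive_Reals, g_derive|].
  specialize (Hg' c ltac:(lra)); fold ka in Hg'.
  replace (T + h - T) with h in Hc1 by ring.
  apply (Rmult_le_compat_r h) in Hg'; [|lra].
  replace (- ka * h) with (- (2 * B + 1)) in Hg' by (unfold h; field; lra).
  pose proof (HgB T); pose proof (HgB (T + h)); lra.
Qed.

(** If [E 0 = 0], the increasing nonpositive [E] vanishes on [[0, +oo)], hence so do [D] and [g] for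
    positive times; [g_derive] then leaves [q b W2 = 0], against positivity. *)
Lemma E_neg : E 0 < 0.
Proof.
  destruct (Rle_lt_or_eq_dec _ _ (E_nonpos 0)) as [H|H]; [exact H|exfalso].
  pose proof a_pos as Ha; pose proof b_pos as Hb.
  assert (HE : forall t, 0 <= t -> E t = 0).
  { intros t Ht; apply Rle_antisym; [apply E_nonpos|]; rewrite <- H; apply E_incr, Ht. }
  assert (Hloc : forall t, 0 < t -> locally t (fun s => 0 <= s)).
  { intros t Ht; exists (mkposreal t Ht); intros s Hs; apply (proj1 (ball_R _ _ _)) in Hs; simpl in Hs; apply Rabs_def2 in Hs; lra. }
  assert (HD : forall t, 0 < t -> D t = 0).
  { intros t Ht.
    assert (H0 : is_derive E t 0).
    { apply (is_derive_ext_loc (fun _ => 0)); [|apply (is_derive_const 0)].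
      generalize (Hloc t Ht); apply filter_imp; intros s Hs; symmetry; apply HE, Hs. }
    pose proof (E_derive t) as H1; apply is_derive_unique in H0; apply is_derive_unique in H1; rewrite H0 in H1.
    symmetry in H1; apply Rmult_integral in H1; destruct H1; lra. }
  assert (Hg : forall t, 0 < t -> g t = 0).
  { intros t Ht; pose proof (HD t Ht) as HDt; unfold D in HDt.
    assert (X1 t = 0) by nra; assert (Y1 t = 0) by nra; unfold g; rewrite H0, H1; ring. }
  assert (H0 : is_derive g 1 0).
  { apply (is_derive_ext_loc (fun _ => 0)); [|apply (is_derive_const 0)].
    assert (Hl : locally 1 (fun s => 1 / 2 < s)) by (apply (flim_gt (locally 1) (fun s => s) 1 (1/2) (filterlim_id _ _)); lra).
    generalize Hl; apply filter_imp; intros s Hs; symmetry; apply Hg; lra. }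
  pose proof (g_derive 1) as H1; apply is_derive_unique in H0; apply is_derive_unique in H1; rewrite H0 in H1.
  rewrite HD, Hg, HE in H1 by lra.
  assert (0 < q * b * W2 1).
  { apply Rmult_lt_0_compat; [apply Rmult_lt_0_compat; lra|]; unfold W2; destruct (HX 1); destruct (HY 1); nra. }
  lra.
Qed.

(** In [E t <= E 0 < 0] the only negative contribution is [- b / 2 * W2 t], which must therefore be
    bounded away from 0. *)
Lemma nonvanishing : exists c, 0 < c /\ forall t, t <= 0 -> 2 * c ^ 2 <= X t ^ 2 + Y t ^ 2.
Proof.
  pose proof b_pos as Hb; pose proof E_neg as HE.
  exists (sqrt (- E 0 / b)); split; [apply sqrt_lt_R0, Rdiv_lt_0_compat; lra|]; intros t Ht.
  rewrite pow2_sqrt by (apply Rlt_le, Rdiv_lt_0_compat; lra).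
  pose proof (E_incr t 0 Ht) as H; unfold E at 1 in H.
  assert (0 < V t).
  { unfold V; repeat apply Rplus_lt_0_compat; repeat apply Rmult_lt_0_compat; try apply Rpower_pos; lra. }
  assert (0 < V t / (2 * q + 2)) by (apply Rdiv_lt_0_compat; lra).
  pose proof (D_nonneg t); fold (W2 t).
  apply (Rmult_le_reg_l b); [exact Hb|].
  replace (b * (2 * (- E 0 / b))) with (- 2 * E 0) by (field; lra); lra.
Qed.

Lemma harnack (s t : R) : s <= t -> X s <= exp (L * (t - s)) * X t /\ X t <= exp (L * (t - s)) * X s.
Proof.
  intros Hst.
  assert (H1 : exp (L * s) * X s <= exp (L * t) * X t).
  { apply (incr_of_derive (fun t => exp (L * t) * X t) (fun t => L * exp (L * t) * X t + exp (L * t) * X1 t) s t Hst).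
    - intros r _; apply (is_derive_mulR (fun t => exp (L * t)) X r _ _ (is_derive_exp_lin L r) (DX r)).
    - intros r _; specialize (HX1 r); apply Rabs_le_between in HX1; pose proof (exp_pos (L * r)); nra. }
  assert (H2 : - (exp (- L * s) * X s) <= - (exp (- L * t) * X t)).
  { apply (incr_of_derive (fun t => - (exp (- L * t) * X t)) (fun t => - (- L * exp (- L * t) * X t + exp (- L * t) * X1 t)) s t Hst).
    - intros r _; apply (is_derive_opp (fun t => exp (- L * t) * X t)).
      apply (is_derive_mulR (fun t => exp (- L * t)) X r _ _ (is_derive_exp_lin (- L) r) (DX r)).
    - intros r _; specialize (HX1 r); apply Rabs_le_between in HX1; pose proof (exp_pos (- L * r)); nra. }
  split.
  - apply (Rmult_le_reg_l (exp (L * s))); [apply exp_pos|]; rewrite <- Rmult_assoc, <- exp_plus.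
    replace (L * s + L * (t - s)) with (L * t) by ring; exact H1.
  - apply (Rmult_le_reg_l (exp (- L * t))); [apply exp_pos|]; rewrite <- Rmult_assoc, <- exp_plus.
    replace (- L * t + L * (t - s)) with (- L * s) by ring; lra.
Qed.

Lemma harnack_unit (s t : R) : t - 1 <= s <= t -> exp (- L) * X t <= X s <= exp L * X t.
Proof.
  intros Hst; destruct (harnack s t ltac:(lra)) as [H1 H2].
  assert (He : exp (L * (t - s)) <= exp L).
  { destruct (Rle_lt_or_eq_dec (L * (t - s)) L) as [H|H]; [nra|left; apply exp_increasing, H|rewrite H; lra]. }
  destruct (HX s); destruct (HX t); split.
  - apply (Rmult_le_reg_l (exp L)); [apply exp_pos|]; rewrite <- Rmult_assoc, <- exp_plus.
    replace (L + - L) with 0 by ring; rewrite exp_0, Rmult_1_l.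
    apply Rle_trans with (1 := H2), Rmult_le_compat_r; lra.
  - apply Rle_trans with (1 := H1), Rmult_le_compat_r; lra.
Qed.

(** Over [[t - 1, t]] the equation, [|X1| <= L X] and the Harnack inequality bound the coupling by
    [C * X t]. If [X] is small then [Y >= c], and the coupling is at least [k * (X t)^q]; for
    [q < 1] this bounds [X t] from below. *)
Lemma lower_bound_sublinear (c : R) : q < 1 -> 0 < c -> (forall t, t <= 0 -> 2 * c ^ 2 <= X t ^ 2 + Y t ^ 2) ->
  exists e, 0 < e /\ forall t, t <= 0 -> e <= X t.
Proof.
  intros Hq1 Hc Hnv.
  pose proof a_pos as Ha; pose proof b_pos as Hb.
  set (k := beta * Rpower c (q + 1) * Rpower (exp (- L)) q).
  assert (Hk : 0 < k) by (unfold k; repeat apply Rmult_lt_0_compat; try apply Rpower_pos; lra).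
  set (C := (a * L + b) * exp L + L + L * exp L).
  assert (HC : 0 < C).
  { unfold C; pose proof (exp_pos L).
    assert (0 < a * L) by (apply Rmult_lt_0_compat; assumption).
    assert (0 < (a * L + b) * exp L) by (apply Rmult_lt_0_compat; lra).
    assert (0 < L * exp L) by (apply Rmult_lt_0_compat; lra); lra. }
  (* [X t < e1] keeps [X < c], hence [Y >= c], on the unit interval; below [e2] the inequality
     [k x^q <= C x] fails. *)
  set (e1 := exp (- L) * c); set (e2 := Rpower (k / C) (1 / (1 - q))).
  assert (He1 : 0 < e1) by (apply Rmult_lt_0_compat; [apply exp_pos|exact Hc]).
  exists (Rmin e1 e2); split; [apply Rmin_pos; [exact He1|apply Rpower_pos]|]; intros t Ht.
  destruct (Rle_lt_dec (Rmin e1 e2) (X t)) as [H|H]; [exact H|exfalso].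
  set (x := X t) in *; destruct (HX t) as [Hx _]; fold x in Hx.
  pose proof (Rmin_l e1 e2); pose proof (Rmin_r e1 e2).
  destruct (MVT_cor2 X1 (fun t => a * X1 t + b * X t - f mu1 (X t) (Y t)) (t - 1) t) as [s [Hs1 Hs2]];
    [lra|intros; apply is_derive_Reals, DX1|].
  destruct (harnack_unit s t ltac:(lra)) as [Hh1 Hh2]; fold x in Hh1, Hh2.
  destruct (harnack_unit (t - 1) t ltac:(lra)) as [Hh3 Hh4]; fold x in Hh3, Hh4.
  assert (HXs : X s < c).
  { apply Rle_lt_trans with (1 := Hh2); replace c with (exp L * e1); [apply Rmult_lt_compat_l; [apply exp_pos|lra]|].
    unfold e1; rewrite <- Rmult_assoc, <- exp_plus; replace (L + - L) with 0 by ring; rewrite exp_0; ring. }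
  destruct (HX s) as [Hxs _]; destruct (HY s) as [Hys _].
  assert (HYs : c <= Y s) by (specialize (Hnv s ltac:(lra)); nra).
  assert (Hf : k * Rpower x q <= f mu1 (X s) (Y s)).
  { unfold f, coupled; assert (0 < mu1 * Rpower (X s) (2 * q + 1)) by (apply Rmult_lt_0_compat; [lra|apply Rpower_pos]).
    assert (Hq1' : Rpower (exp (- L)) q * Rpower x q <= Rpower (X s) q).
    { rewrite Rpower_mult_distr by (try apply exp_pos; lra); apply Rle_Rpower_l; [lra|split; [|exact Hh1]].
      apply Rmult_lt_0_compat; [apply exp_pos|lra]. }
    assert (Hq2 : Rpower c (q + 1) <= Rpower (Y s) (q + 1)) by (apply Rle_Rpower_l; lra).
    assert (beta * (Rpower (exp (- L)) q * Rpower x q) * Rpower c (q + 1) <= beta * Rpower (X s) q * Rpower (Y s) (q + 1)).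
    { apply Rmult_le_compat; [|left; apply Rpower_pos| |exact Hq2].
      - apply Rmult_le_pos; [lra|]; apply Rmult_le_pos; left; apply Rpower_pos.
      - apply Rmult_le_compat_l; lra. }
    unfold k; lra. }
  pose proof (HX1 s) as B1; pose proof (HX1 t) as B2; pose proof (HX1 (t - 1)) as B3; fold x in B2.
  apply Rabs_le_between in B1, B2, B3.
  assert (Hmain : k * Rpower x q <= C * x).
  { assert (a * X1 s <= a * (L * X s)) by (apply Rmult_le_compat_l; lra).
    assert ((a * L + b) * X s <= (a * L + b) * (exp L * x)).
    { apply Rmult_le_compat_l; [|exact Hh2]; assert (0 < a * L) by (apply Rmult_lt_0_compat; assumption); lra. }
    assert (L * X (t - 1) <= L * (exp L * x)) by (apply Rmult_le_compat_l; lra).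
    unfold C; lra. }
  assert (Hx2 : k / C <= Rpower x (1 - q)).
  { apply Rle_div_l; [exact HC|].
    apply (Rmult_le_reg_r (Rpower x q)); [apply Rpower_pos|].
    replace (Rpower x (1 - q) * C * Rpower x q) with (C * x); [exact Hmain|].
    rewrite <- (Rpower_1 x) at 1 by exact Hx; replace 1 with (1 - q + q) at 1 by ring; rewrite Rpower_plus; ring. }
  assert (Hx3 : e2 <= x).
  { replace x with (Rpower (Rpower x (1 - q)) (1 / (1 - q))).
    - apply Rle_Rpower_l; [apply Rlt_le, Rdiv_lt_0_compat; lra|split; [apply Rdiv_lt_0_compat; assumption|exact Hx2]].
    - rewrite Rpower_mult; replace ((1 - q) * (1 / (1 - q))) with 1 by (field; lra); apply Rpower_1, Hx. }
  lra.
Qed.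

Lemma coupling_superlinear (t : R) : 1 < q ->
  f mu1 (X t) (Y t) <= (mu1 + beta) * Rpower K (q + 1) * Rpower (X t) (q - 1) * X t.
Proof.
  intros Hq1; destruct (HX t) as [Hx HxK]; destruct (HY t) as [Hy HyK]; unfold f, coupled.
  assert (Eq : Rpower (X t) q = Rpower (X t) (q - 1) * X t).
  { rewrite <- (Rpower_1 (X t)) at 3 by exact Hx; rewrite <- Rpower_plus; f_equal; ring. }
  replace (2 * q + 1) with (q + (q + 1)) by ring; rewrite Rpower_plus.
  assert (H0 : 0 < Rpower (X t) q) by apply Rpower_pos.
  assert (HXq : Rpower (X t) (q + 1) <= Rpower K (q + 1)) by (apply Rle_Rpower_l; lra).
  assert (HYq : Rpower (Y t) (q + 1) <= Rpower K (q + 1)) by (apply Rle_Rpower_l; lra).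
  replace ((mu1 + beta) * Rpower K (q + 1) * Rpower (X t) (q - 1) * X t)
    with (mu1 * (Rpower (X t) q * Rpower K (q + 1)) + beta * Rpower (X t) q * Rpower K (q + 1)) by (rewrite Eq; ring).
  apply Rplus_le_compat; [|apply Rmult_le_compat_l; [apply Rmult_le_pos|]; lra].
  apply Rmult_le_compat_l; [lra|]; apply Rmult_le_compat_l; lra.
Qed.

(** [- r u_r / u], the local decay exponent of [u]. It solves a Riccati equation whose equilibria
    without the coupling are 0, for bounded [u], and [N], for the fundamental solution. *)
Let y (t : R) : R := de - X1 t / X t.
Let y' (t : R) : R := - y t * (N - y t) + f mu1 (X t) (Y t) / X t.

Lemma y_derive (t : R) : is_derive y t (y' t).
Proof.
  destruct (HX t) as [Hx _]; evar_last.
  - apply (is_derive_minus (fun _ => de) (fun t => X1 t / X t)); [apply (is_derive_const de)|].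
    apply (is_derive_div X1 X t _ _ (DX1 t) (DX t)); lra.
  - unfold minus, plus, opp, zero; simpl; unfold y', y, a, b, f; field; lra.
Qed.

(* If [y > eta] somewhere, then [y > eta] at all earlier times, where
   [J = exp ((N - de) t) (y X)] satisfies [J' <= (N - de) / 2 J]; this is too slow for [y X] bounded. *)
Lemma slope_small (T : R) : (forall t, X1 t <= de * X t) ->
  (forall t, t <= T -> f mu1 (X t) (Y t) <= de / 2 * ((N - de) / 2) * X t) ->
  forall t, t <= T -> y t <= de / 2.
Proof.
  intros Hmono Hsmall t0 Ht0.
  pose proof de_pos as Hde; assert (HNd : 0 < N - de) by (unfold de; lra).
  destruct (Rle_lt_dec (y t0) (de / 2)) as [H|H]; [exact H|exfalso].
  set (eta := de / 2) in *; set (ka := (N - de) / 2) in *.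
  assert (Hup : forall t, t <= t0 -> eta < y t).
  { apply (barrier_backward y y' eta t0); [intros; apply y_derive|exact H|]; intros t Ht Hy.
    destruct (HX t) as [Hx _]; specialize (Hsmall t ltac:(lra)); unfold y'; rewrite Hy.
    assert (f mu1 (X t) (Y t) / X t <= eta * ka) by (apply Rle_div_l; lra).
    assert (0 < eta * (N - eta - ka)) by (apply Rmult_lt_0_compat; unfold eta, ka; lra); lra. }
  set (B := (de + L) * K).
  set (J := fun t => exp ((N - de) * t) * (de * X t - X1 t)).
  assert (DJ : forall t, is_derive J t (exp ((N - de) * t) * f mu1 (X t) (Y t))).
  { intros t; evar_last.
    - apply (is_derive_mulR (fun t => exp ((N - de) * t)) (fun t => de * X t - X1 t) t _
        (de * X1 t - (a * X1 t + b * X t - f mu1 (X t) (Y t))) (is_derive_exp_lin (N - de) t));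
        [].
      apply (is_derive_minus (fun t => de * X t) X1); [apply (is_derive_scal X t de), DX|apply DX1].
    - unfold plus, mult; simpl; unfold a, b; ring. }
  set (H1 := fun t => - (exp (- ka * t) * J t)).
  assert (Hinc : forall s, s <= t0 -> H1 s <= H1 t0).
  { intros s Hs; apply (incr_of_derive H1 (fun t => - (- ka * exp (- ka * t) * J t + exp (- ka * t) * (exp ((N - de) * t) * f mu1 (X t) (Y t)))) s t0 Hs).
    - intros t _; apply (is_derive_opp (fun t => exp (- ka * t) * J t)).
      apply (is_derive_mulR (fun t => exp (- ka * t)) J t _ _ (is_derive_exp_lin (- ka) t) (DJ t)).
    - intros t Ht; specialize (Hup t ltac:(lra)); specialize (Hsmall t ltac:(lra)); destruct (HX t) as [Hx _].
      assert (HyX : eta * X t <= de * X t - X1 t).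
      { replace (de * X t - X1 t) with (y t * X t) by (unfold y; field; lra); apply Rmult_le_compat_r; lra. }
      unfold J; replace (- (- ka * exp (- ka * t) * (exp ((N - de) * t) * (de * X t - X1 t)) + exp (- ka * t) * (exp ((N - de) * t) * f mu1 (X t) (Y t))))
        with (exp (- ka * t) * (exp ((N - de) * t) * (ka * (de * X t - X1 t) - f mu1 (X t) (Y t)))) by ring.
      apply Rmult_le_pos; [left; apply exp_pos|]; apply Rmult_le_pos; [left; apply exp_pos|].
      assert (ka * (eta * X t) <= ka * (de * X t - X1 t)) by (apply Rmult_le_compat_l; unfold ka in *; lra); lra. }
  assert (H0 : 0 <= H1 t0).
  { apply (exp_below ka (H1 t0) B t0); [unfold ka; lra|]; intros s Hs; apply Rle_trans with (2 := Hinc s Hs).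
    unfold H1, J; rewrite <- Rmult_assoc, <- exp_plus; replace (- ka * s + (N - de) * s) with (ka * s) by (unfold ka; field).
    destruct (HX s) as [Hx HxK]; pose proof (HX1 s) as Hb1; apply Rabs_le_between in Hb1.
    assert (de * X s - X1 s <= B).
    { unfold B; assert ((de + L) * X s <= (de + L) * K) by (apply Rmult_le_compat_l; lra); lra. }
    pose proof (exp_pos (ka * s)); nra. }
  assert (H2 : 0 < exp (- ka * t0) * J t0); [|unfold H1 in H0; lra].
  apply Rmult_lt_0_compat; [apply exp_pos|]; apply Rmult_lt_0_compat; [apply exp_pos|].
  destruct (HX t0) as [Hx _]; replace (de * X t0 - X1 t0) with (y t0 * X t0) by (unfold y; field; lra).
  apply Rmult_lt_0_compat; [unfold eta in H|]; lra.
Qed.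

(** A bootstrap. [y <= de / 2] gives [X = O(exp (de t / 2))]; for [q > 1] the ratio [f / X] is then
    exponentially small, the Riccati equation makes [y] exponentially small as well, and [y], now
    integrable at [-oo], is minus the logarithmic derivative of [exp (- de t) X], which is therefore
    bounded. *)
Lemma fast_decay (T : R) : 1 < q -> (forall t, X1 t <= de * X t) ->
  (forall t, t <= T -> f mu1 (X t) (Y t) <= de / 2 * ((N - de) / 2) * X t) ->
  exists M, forall t, t <= T -> X t <= M * exp (de * t).
Proof.
  intros Hq1 Hmono Hsmall; pose proof (slope_small T Hmono Hsmall) as Hy.
  pose proof de_pos as Hde; assert (HNd : 0 < N - de) by (unfold de; lra).
  set (X0 := X T); destruct (HX T) as [HX0 _]; fold X0 in HX0.
  assert (Hslow : forall t, t <= T -> X t <= X0 * exp (- (de / 2) * T) * exp (de / 2 * t)).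
  { intros t Ht.
    assert (Hi : exp (- (de / 2) * t) * X t <= exp (- (de / 2) * T) * X0).
    { apply (incr_of_derive (fun t => exp (- (de / 2) * t) * X t) (fun t => - (de / 2) * exp (- (de / 2) * t) * X t + exp (- (de / 2) * t) * X1 t) t T Ht).
      - intros r _; apply (is_derive_mulR (fun t => exp (- (de / 2) * t)) X r _ _ (is_derive_exp_lin (- (de / 2)) r) (DX r)).
      - intros r Hr; specialize (Hy r ltac:(lra)); destruct (HX r) as [Hx _].
        assert (y r * X r <= de / 2 * X r) by (apply Rmult_le_compat_r; lra).
        replace (y r * X r) with (de * X r - X1 r) in H by (unfold y; field; lra).
        pose proof (exp_pos (- (de / 2) * r)); nra. }
    apply (Rmult_le_reg_l (exp (- (de / 2) * t))); [apply exp_pos|].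
    replace (exp (- (de / 2) * t) * (X0 * exp (- (de / 2) * T) * exp (de / 2 * t)))
      with (exp (- (de / 2) * T) * X0 * (exp (- (de / 2) * t) * exp (de / 2 * t))) by ring.
    rewrite <- exp_plus; replace (- (de / 2) * t + de / 2 * t) with 0 by ring; rewrite exp_0; lra. }
  set (ga := (q - 1) * (de / 2)); assert (Hga : 0 < ga) by (apply Rmult_lt_0_compat; lra).
  set (ka := N - de / 2); assert (Hka : 0 < ka) by (unfold ka; lra).
  set (C := (mu1 + beta) * Rpower K (q + 1) * Rpower (X0 * exp (- (de / 2) * T)) (q - 1)).
  assert (HC : 0 < C) by (unfold C; repeat apply Rmult_lt_0_compat; try apply Rpower_pos; lra).
  assert (HR : forall t, t <= T -> f mu1 (X t) (Y t) / X t <= C * exp (ga * t)).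
  { intros t Ht; destruct (HX t) as [Hx _]; apply Rle_div_l; [exact Hx|].
    apply Rle_trans with (1 := coupling_superlinear t Hq1); apply Rmult_le_compat_r; [lra|].
    unfold C; rewrite (Rmult_assoc _ (Rpower (X0 * _) _)); apply Rmult_le_compat_l.
    - apply Rmult_le_pos; [lra|left; apply Rpower_pos].
    - replace (exp (ga * t)) with (Rpower (exp (de / 2 * t)) (q - 1)) by (rewrite Rpower_exp_l; f_equal; unfold ga; ring).
      rewrite Rpower_mult_distr by (first [apply exp_pos|apply Rmult_lt_0_compat; [exact HX0|apply exp_pos]]).
      apply Rle_Rpower_l; [lra|split; [exact Hx|apply Hslow, Ht]]. }
  assert (Hy0 : forall t, 0 <= y t).
  { intros t; destruct (HX t) as [Hx _]; unfold y; assert (X1 t / X t <= de) by (apply Rle_div_l; [exact Hx|apply Hmono]); lra. }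
  (* [C4 * exp (ga * t)] solves [z' = - ka * z + C * exp (ga * t)], the linear equation that
     dominates the Riccati equation when [y <= de / 2]. *)
  set (C4 := C / (ka + ga)); assert (HC4 : 0 < C4) by (apply Rdiv_lt_0_compat; lra).
  assert (Hyfast : forall t, t <= T -> y t <= C4 * exp (ga * t)).
  { intros t Ht.
    set (H1 := fun t => C4 * exp ((ka + ga) * t) - exp (ka * t) * y t).
    assert (Hinc : forall s, s <= t -> H1 s <= H1 t).
    { intros s Hs; apply (incr_of_derive H1 (fun t => C4 * ((ka + ga) * exp ((ka + ga) * t)) - (ka * exp (ka * t) * y t + exp (ka * t) * y' t)) s t Hs).
      - intros r _; apply (is_derive_minus (fun t => C4 * exp ((ka + ga) * t)) (fun t => exp (ka * t) * y t)).
        + apply (is_derive_scal (fun t => exp ((ka + ga) * t))), is_derive_exp_lin.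
        + apply (is_derive_mulR (fun t => exp (ka * t)) y r _ _ (is_derive_exp_lin ka r) (y_derive r)).
      - intros r Hr; specialize (HR r ltac:(lra)); specialize (Hy r ltac:(lra)); specialize (Hy0 r).
        replace ((ka + ga) * r) with (ka * r + ga * r) by ring; rewrite exp_plus.
        replace (C4 * ((ka + ga) * (exp (ka * r) * exp (ga * r))) - (ka * exp (ka * r) * y r + exp (ka * r) * y' r))
          with (exp (ka * r) * (C * exp (ga * r) - f mu1 (X r) (Y r) / X r + y r * (de / 2 - y r)))
          by (unfold C4, y', ka; field; split; [destruct (HX r)|unfold ka in *]; lra).
        apply Rmult_le_pos; [left; apply exp_pos|].
        assert (0 <= y r * (de / 2 - y r)) by (apply Rmult_le_pos; lra); lra. }
    assert (H0 : 0 <= H1 t).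
    { apply (exp_below ka (H1 t) (de / 2) t Hka); intros s Hs; apply Rle_trans with (2 := Hinc s Hs).
      specialize (Hy s ltac:(lra)); unfold H1; pose proof (exp_pos (ka * s)).
      assert (0 < C4 * exp ((ka + ga) * s)) by (apply Rmult_lt_0_compat; [exact HC4|apply exp_pos]).
      assert (exp (ka * s) * y s <= exp (ka * s) * (de / 2)) by (apply Rmult_le_compat_l; lra); lra. }
    unfold H1 in H0; replace ((ka + ga) * t) with (ka * t + ga * t) in H0 by ring; rewrite exp_plus in H0.
    apply (Rmult_le_reg_l (exp (ka * t))); [apply exp_pos|lra]. }
  (* An integrating factor: [A Q] is nondecreasing because [y <= C4 * exp (ga * t)], and [Q >= 1]
     then turns this into a bound for [A]. *)
  set (Q := fun t => exp (C4 / ga * exp (ga * t))).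
  assert (DQ : forall t, is_derive Q t (C4 * exp (ga * t) * Q t)).
  { intros t; unfold Q; auto_derive; [exact I|field; lra]. }
  set (A := fun t => exp (- de * t) * X t).
  assert (DA : forall t, is_derive A t (- y t * A t)).
  { intros t; destruct (HX t) as [Hx _]; evar_last.
    - apply (is_derive_mulR (fun t => exp (- de * t)) X t _ _ (is_derive_exp_lin (- de) t) (DX t)).
    - unfold plus, mult; simpl; unfold y, A; field; lra. }
  exists (A T * Q T); intros t Ht.
  assert (HAQ : A t * Q t <= A T * Q T).
  { apply (incr_of_derive (fun t => A t * Q t) (fun t => - y t * A t * Q t + A t * (C4 * exp (ga * t) * Q t)) t T Ht).
    - intros r _; apply (is_derive_mulR A Q r _ _ (DA r) (DQ r)).
    - intros r Hr; specialize (Hyfast r ltac:(lra)).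
      replace (- y r * A r * Q r + A r * (C4 * exp (ga * r) * Q r)) with (A r * Q r * (C4 * exp (ga * r) - y r)) by ring.
      apply Rmult_le_pos; [|lra]; apply Rmult_le_pos; [|left; apply exp_pos].
      apply Rmult_le_pos; [left; apply exp_pos|destruct (HX r); lra]. }
  assert (HQ1 : 1 <= Q t).
  { unfold Q; rewrite <- exp_0 at 1; left; apply exp_increasing, Rmult_lt_0_compat; [apply Rdiv_lt_0_compat; lra|apply exp_pos]. }
  assert (HAt : 0 < A t) by (apply Rmult_lt_0_compat; [apply exp_pos|apply HX]).
  assert (HA1 : A t <= A T * Q T) by nra.
  apply (Rmult_le_compat_r (exp (de * t))) in HA1; [|left; apply exp_pos].
  unfold A at 1 in HA1.
  replace (exp (- de * t) * X t * exp (de * t)) with (X t * (exp (- de * t) * exp (de * t))) in HA1 by ring.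
  rewrite <- exp_plus in HA1; replace (- de * t + de * t) with 0 in HA1 by ring; rewrite exp_0 in HA1; lra.
Qed.

(** The velocities vanish at [-oo], while at a small level [e] the linear term [b X] outweighs the
    superlinear coupling and produces a definite acceleration. So [X] cannot equal [e] before some
    time [T], and by continuity it stays above [e] or below it. *)
Lemma dichotomy_superlinear (c : R) : 1 < q -> (forall t, X1 t <= de * X t) ->
  0 < c -> (forall t, t <= 0 -> 2 * c ^ 2 <= X t ^ 2 + Y t ^ 2) ->
  (exists e T, 0 < e /\ T <= 0 /\ forall t, t <= T -> e <= X t) \/
  (exists M T, T <= 0 /\ forall t, t <= T -> X t <= M * exp (de * t) /\ c <= Y t).
Proof.
  intros Hq1 Hmono Hc Hnv.
  pose proof a_pos as Ha; pose proof b_pos as Hb; pose proof de_pos as Hde.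
  assert (HNd : 0 < N - de) by (unfold de; lra).
  set (C2 := (mu1 + beta) * Rpower K (q + 1)).
  assert (HC2 : 0 < C2) by (apply Rmult_lt_0_compat; [lra|apply Rpower_pos]).
  (* [b / 2] leaves half of the linear term in the crossing argument; the other bound is the
     smallness required by [fast_decay]. *)
  set (rho := Rmin (b / 2) (de / 2 * ((N - de) / 2))).
  assert (Hrho : 0 < rho) by (apply Rmin_pos; [lra|apply Rmult_lt_0_compat; lra]).
  set (e1 := Rpower (rho / C2) (1 / (q - 1))).
  assert (He1 : 0 < e1) by apply Rpower_pos.
  assert (Hf : forall t, X t <= e1 -> f mu1 (X t) (Y t) <= rho * X t).
  { intros t Ht; destruct (HX t) as [Hx _]; apply Rle_trans with (1 := coupling_superlinear t Hq1).
    apply Rmult_le_compat_r; [lra|]; fold C2; replace rho with (C2 * (rho / C2)) by (field; lra).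
    apply Rmult_le_compat_l; [lra|].
    replace (rho / C2) with (Rpower e1 (q - 1)); [apply Rle_Rpower_l; lra|].
    unfold e1; rewrite Rpower_mult; replace (1 / (q - 1) * (q - 1)) with 1 by (field; lra).
    apply Rpower_1, Rdiv_lt_0_compat; assumption. }
  (* The first bound keeps [X <= e1] on a whole unit interval after Harnack; the second ensures
     [Y >= c] wherever [X < e]. *)
  set (e := Rmin (exp (- L) * e1) c).
  assert (He : 0 < e) by (apply Rmin_pos; [apply Rmult_lt_0_compat; [apply exp_pos|exact He1]|exact Hc]).
  (* Velocities of size [ze] change by at most [2 * ze] over a unit of time, whereas the equation
     would force a change of at least [2 * (2 + a) * ze - a * ze]. *)
  set (ze := b / 2 * (exp (- L) * e) / (2 * (2 + a))).
  assert (Hbe : 0 < b / 2 * (exp (- L) * e)) by (apply Rmult_lt_0_compat; [lra|apply Rmult_lt_0_compat; [apply exp_pos|exact He]]).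
  assert (Hze : 0 < ze) by (apply Rdiv_lt_0_compat; [exact Hbe|lra]).
  assert (HeL : exp L * e <= e1).
  { apply Rle_trans with (exp L * (exp (- L) * e1)); [apply Rmult_le_compat_l; [left; apply exp_pos|apply Rmin_l]|].
    rewrite <- Rmult_assoc, <- exp_plus; replace (L + - L) with 0 by ring; rewrite exp_0; lra. }
  assert (Hee1 : e <= e1).
  { apply Rle_trans with (2 := HeL); rewrite <- (Rmult_1_l e) at 1; apply Rmult_le_compat_r; [lra|].
    rewrite <- exp_0; left; apply exp_increasing, HL. }
  destruct (D_small_left (ze ^ 2) (pow_lt _ _ Hze)) as [T0 HT0].
  set (T := Rmin T0 0).
  pose proof (Rmin_l T0 0) as HTa; pose proof (Rmin_r T0 0) as HTb; fold T in HTa, HTb.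
  assert (Hno : forall t, t <= T -> X t <> e).
  { intros t Ht HXt.
    destruct (MVT_cor2 X1 (fun t => a * X1 t + b * X t - f mu1 (X t) (Y t)) (t - 1) t) as [s [Hs1 Hs2]];
      [lra|intros; apply is_derive_Reals, DX1|].
    destruct (harnack_unit s t ltac:(lra)) as [Hh1 Hh2]; rewrite HXt in Hh1, Hh2.
    assert (Hfs : f mu1 (X s) (Y s) <= b / 2 * X s).
    { destruct (HX s) as [Hx _]; apply Rle_trans with (1 := Hf s ltac:(lra)); apply Rmult_le_compat_r; [lra|apply Rmin_l]. }
    assert (HB : forall r, r <= t -> - ze <= X1 r <= ze).
    { intros r Hr; destruct (sqrt_D_bound r ze Hze (HT0 r ltac:(lra))) as [H _]; apply Rabs_le_between, H. }
    pose proof (HB s ltac:(lra)); pose proof (HB t ltac:(lra)); pose proof (HB (t - 1) ltac:(lra)).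
    assert (b / 2 * (exp (- L) * e) <= b / 2 * X s) by (apply Rmult_le_compat_l; lra).
    assert (a * - ze <= a * X1 s) by (apply Rmult_le_compat_l; lra).
    replace (b / 2 * (exp (- L) * e)) with (2 * (2 + a) * ze) in * by (unfold ze; field; lra).
    assert (0 < a * ze) by (apply Rmult_lt_0_compat; assumption); lra. }
  assert (Hcont : continuity X).
  { intros t; apply derivable_continuous_pt; exists (X1 t); apply is_derive_Reals, DX. }
  destruct (Rle_lt_dec (X T) e) as [HXT|HXT].
  - right; assert (Hlt : forall t, t <= T -> X t < e).
    { intros t Ht; destruct (Rlt_le_dec (X t) e) as [H|H]; [exact H|exfalso].
      destruct (IVT_gen X T t e Hcont) as [s [Hs1 Hs2]].
      - split; [apply Rle_trans with (X T); [apply Rmin_l|exact HXT]|apply Rle_trans with (X t); [exact H|apply Rmax_r]].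
      - apply (Hno s); [|exact Hs2]; apply Rle_trans with (1 := proj2 Hs1), Rmax_lub; lra. }
    destruct (fast_decay T Hq1 Hmono) as [M HM].
    { intros t Ht; specialize (Hlt t Ht); destruct (HX t) as [Hx _].
      apply Rle_trans with (1 := Hf t ltac:(lra)); apply Rmult_le_compat_r; [lra|apply Rmin_r]. }
    exists M, T; split; [exact HTb|]; intros t Ht; split; [apply HM, Ht|].
    specialize (Hlt t Ht); specialize (Hnv t ltac:(lra)); destruct (HX t) as [Hx _]; destruct (HY t) as [Hy _].
    pose proof (Rmin_r (exp (- L) * e1) c) as Hec; fold e in Hec; nra.
  - left; exists e, T; split; [exact He|split; [exact HTb|]]; intros t Ht.
    destruct (Rle_lt_dec e (X t)) as [H|H]; [exact H|exfalso].
    destruct (IVT_gen X T t e Hcont) as [s [Hs1 Hs2]].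
    + split; [apply Rle_trans with (X t); [apply Rmin_r|lra]|apply Rle_trans with (X T); [lra|apply Rmax_l]].
    + apply (Hno s); [|exact Hs2]; apply Rle_trans with (1 := proj2 Hs1), Rmax_lub; lra.
Qed.

(** On the remaining interval [[T, 0]] the Harnack inequality costs at most the factor
    [exp (L T)]. *)
Lemma lower_bound_extend (e T : R) : T <= 0 -> 0 < e -> (forall t, t <= T -> e <= X t) ->
  exists e', 0 < e' /\ forall t, t <= 0 -> e' <= X t.
Proof.
  intros HT He H; exists (exp (L * T) * e); split; [apply Rmult_lt_0_compat; [apply exp_pos|exact He]|].
  intros t Ht; destruct (Rle_lt_dec t T) as [HtT|HtT].
  - apply Rle_trans with (2 := H t HtT); rewrite <- (Rmult_1_l e) at 2; apply Rmult_le_compat_r; [lra|].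
    rewrite <- exp_0; destruct (Rle_lt_or_eq_dec (L * T) 0) as [Hl|Hl]; [nra|left; apply exp_increasing, Hl|rewrite Hl; lra].
  - destruct (harnack T t ltac:(lra)) as [H1 _]; specialize (H T ltac:(lra)); destruct (HX t) as [Hx _].
    apply (Rmult_le_reg_l (exp (- L * T))); [apply exp_pos|]; rewrite <- Rmult_assoc, <- exp_plus.
    replace (- L * T + L * T) with 0 by ring; rewrite exp_0, Rmult_1_l.
    apply Rle_trans with (1 := H), Rle_trans with (1 := H1), Rmult_le_compat_r; [lra|].
    destruct (Rle_lt_or_eq_dec (L * (t - T)) (- L * T)) as [Hl|Hl]; [nra|left; apply exp_increasing, Hl|rewrite Hl; lra].
Qed.

End EmdenFowler.

(** * Profiles of solutions and the final bounds *)

Lemma coupled_scale (mu beta q s x y : R) : 0 < s -> 0 < x -> 0 < y ->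
  coupled mu beta q (s * x) (s * y) = Rpower s (2 * q + 1) * coupled mu beta q x y.
Proof.
  intros Hs Hx Hy; unfold coupled; rewrite <- !Rpower_mult_distr by assumption.
  replace (2 * q + 1) with (q + (q + 1)) by ring; rewrite !Rpower_plus; ring.
Qed.

(** The coupling is homogeneous of degree [2q + 1], and [m (2q + 1) < m + 2] is the condition
    [q m < 1]. *)
Lemma coupled_growth (m q mu beta : R) : 0 < q -> q * m < 1 -> 0 < mu -> 0 < beta ->
  growth m (coupled mu beta q).
Proof.
  intros Hq Hqm Hmu Hbeta.
  assert (Hp : forall a b, 0 < coupled mu beta q a b).
  { intros a b; unfold coupled; apply Rplus_lt_0_compat; repeat apply Rmult_lt_0_compat; try apply Rpower_pos; assumption. }
  split; [intros; apply Hp|split].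
  - intros a a' b b' Ha Hb; unfold coupled; apply Rplus_le_compat.
    + apply Rmult_le_compat_l; [lra|apply Rle_Rpower_l; lra].
    + apply Rmult_le_compat; [|left; apply Rpower_pos| |apply Rle_Rpower_l; lra].
      * apply Rmult_le_pos; [lra|left; apply Rpower_pos].
      * apply Rmult_le_compat_l; [lra|apply Rle_Rpower_l; lra].
  - intros k a b Hk Ha Hb; rewrite coupled_scale by (try assumption; apply Rpower_pos).
    rewrite Rpower_mult; apply Rmult_lt_compat_r; [apply Hp|apply Rpower_lt; [exact Hk|lra]].
Qed.

(* [X] and [Y] are [r^(1/q) u] and [r^(1/q) v] in the variable [t = ln r]. *)
Definition profile (n : nat) (q mu1 mu2 beta : R) (u v : (nat -> R) -> R) (K L : R) (X X1 Y Y1 : R -> R) : Prop :=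
  let N := INR n - 2 in
  (forall t, 0 < X t <= K) /\ (forall t, 0 < Y t <= K) /\
  (forall t, Rabs (X1 t) <= L * X t) /\ (forall t, Rabs (Y1 t) <= L * Y t) /\
  (forall t, is_derive X t (X1 t)) /\ (forall t, is_derive Y t (Y1 t)) /\
  (forall t, is_derive X1 t ((2 * (1 / q) - N) * X1 t + 1 / q * (N - 1 / q) * X t - coupled mu1 beta q (X t) (Y t))) /\
  (forall t, is_derive Y1 t ((2 * (1 / q) - N) * Y1 t + 1 / q * (N - 1 / q) * Y t - coupled mu2 beta q (Y t) (X t))) /\
  (forall t, X1 t <= 1 / q * X t) /\ (forall t, Y1 t <= 1 / q * Y t) /\
  (forall x, pt n x -> 0 < nrm n x -> u x = Rpower (nrm n x) (- (1 / q)) * X (ln (nrm n x))) /\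
  (forall x, pt n x -> 0 < nrm n x -> v x = Rpower (nrm n x) (- (1 / q)) * Y (ln (nrm n x))).

Lemma profile_sym (n : nat) (q mu1 mu2 beta : R) (u v : (nat -> R) -> R) (K L : R) (X X1 Y Y1 : R -> R) :
  profile n q mu1 mu2 beta u v K L X X1 Y Y1 -> profile n q mu2 mu1 beta v u K L Y Y1 X X1.
Proof. unfold profile; tauto. Qed.

(** By homogeneity of degree [2q + 1], multiplication by [exp (t / q)] absorbs the weight
    [exp (2 t)] and the equation becomes autonomous. It is stated for one component with the other
    merely positive, and applied to each in turn. *)
Lemma rescaled_equation (N q mu beta : R) (A A1 B : R -> R) : 0 < N -> 0 < q -> 0 < mu -> 0 < beta ->
  (forall t, 0 < A t) -> (forall t, 0 < B t) -> (forall t, A1 t <= 0) ->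
  (forall t, is_derive A t (A1 t)) ->
  (forall t, is_derive A1 t (- N * A1 t - exp (2 * t) * coupled mu beta q (A t) (B t))) ->
  exists X1, let X := fun t => exp (1 / q * t) * A t in let Y := fun t => exp (1 / q * t) * B t in
    (exists K, forall t, X t <= K) /\ (forall t, Rabs (X1 t) <= (1 / q + exp N) * X t) /\
    (forall t, is_derive X t (X1 t)) /\
    (forall t, is_derive X1 t ((2 * (1 / q) - N) * X1 t + 1 / q * (N - 1 / q) * X t - coupled mu beta q (X t) (Y t))) /\
    (forall t, X1 t <= 1 / q * X t).
Proof.
  intros HN Hq Hmu Hbeta HA HB HA1 DA DA1.
  exists (fun t => 1 / q * (exp (1 / q * t) * A t) + exp (1 / q * t) * A1 t); cbv zeta.
  assert (Hf : forall t, mu * Rpower (A t) (2 * q + 1) <= coupled mu beta q (A t) (B t)).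
  { intros t; unfold coupled.
    assert (0 < beta * Rpower (A t) q * Rpower (B t) (q + 1)) by (repeat apply Rmult_lt_0_compat; try apply Rpower_pos; assumption).
    lra. }
  assert (Hq' : 0 < 1 / q) by (apply Rdiv_lt_0_compat; lra).
  split; [|split; [|split; [|split]]].
  - exists (Rpower (q * mu / (N + 2)) (- (1 / (2 * q)))); intros t.
    apply (decay_bound N q mu HN Hq Hmu A A1 _ HA HA1 DA DA1 Hf).
  - intros t; pose proof (gradient_bound N q mu HN Hmu A A1 _ HA HA1 DA DA1 Hf t) as Hg.
    pose proof (exp_pos (1 / q * t)) as He; specialize (HA1 t); pose proof (HA t) as HAt.
    assert (exp (1 / q * t) * - A1 t <= exp (1 / q * t) * (exp N * A t)) by (apply Rmult_le_compat_l; lra).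
    assert (0 <= exp (1 / q * t) * - A1 t) by (apply Rmult_le_pos; lra).
    assert (0 < 1 / q * (exp (1 / q * t) * A t)) by (apply Rmult_lt_0_compat; [exact Hq'|apply Rmult_lt_0_compat; assumption]).
    assert (0 < exp N * (exp (1 / q * t) * A t)) by (repeat apply Rmult_lt_0_compat; try apply exp_pos; assumption).
    apply Rabs_le_between; lra.
  - intros t; evar_last.
    + apply (is_derive_mulR (fun t => exp (1 / q * t)) A t _ _ (is_derive_exp_lin (1 / q) t) (DA t)).
    + unfold plus, mult; simpl; ring.
  - intros t; evar_last.
    + apply (is_derive_plus (fun t => 1 / q * (exp (1 / q * t) * A t)) (fun t => exp (1 / q * t) * A1 t)).
      * apply (is_derive_scal (fun t => exp (1 / q * t) * A t)).
        apply (is_derive_mulR (fun t => exp (1 / q * t)) A t _ _ (is_derive_exp_lin (1 / q) t) (DA t)).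
      * apply (is_derive_mulR (fun t => exp (1 / q * t)) A1 t _ _ (is_derive_exp_lin (1 / q) t) (DA1 t)).
    + rewrite coupled_scale by (try apply exp_pos; auto).
      rewrite Rpower_exp_l; replace ((2 * q + 1) * (1 / q) * t) with (1 / q * t + 2 * t) by (field; lra).
      rewrite exp_plus; unfold plus, mult; simpl; ring.
  - intros t; specialize (HA1 t); pose proof (exp_pos (1 / q * t)).
    assert (0 <= exp (1 / q * t) * - A1 t) by (apply Rmult_le_pos; lra); lra.
Qed.

Lemma pos_sol_profile (n : nat) (mu1 mu2 beta q : R) (u v : (nat -> R) -> R) :
  (3 <= n)%nat -> 0 < mu1 -> 0 < mu2 -> 0 < beta -> 0 < q -> q * (INR n - 2) < 2 ->
  pos_sol n mu1 mu2 beta q u v ->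
  exists K L X X1 Y Y1, 0 < L /\ profile n q mu1 mu2 beta u v K L X X1 Y Y1.
Proof.
  intros Hn Hmu1 Hmu2 Hbeta Hq Hqn [D1u [D2u [D1v [D2v [HCu [HCv Hsol]]]]]].
  assert (HN : 1 <= INR n - 2) by (apply le_INR in Hn; simpl in Hn; lra).
  set (N := INR n - 2) in *; set (m := N / 2).
  assert (Hm : 2 * m = N) by (unfold m; field).
  assert (Hpos : forall x, pt n x -> 0 < sq n x -> 0 < u x /\ 0 < v x).
  { intros x Hx Hs; destruct (Hsol x Hx (proj2 (nrm_pos n x) Hs)) as [H1 [H2 _]]; tauto. }
  assert (Hpos' : forall x, pt n x -> 0 < sq n x -> 0 < v x /\ 0 < u x) by (intros; apply and_comm, Hpos; assumption).
  assert (Equ : forall x, pt n x -> 0 < sq n x -> lap n D2u x = - coupled mu1 beta q (u x) (v x)).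
  { intros x Hx Hs; destruct (Hsol x Hx (proj2 (nrm_pos n x) Hs)) as [_ [_ [H _]]]; unfold coupled; lra. }
  assert (Eqv : forall x, pt n x -> 0 < sq n x -> lap n D2v x = - coupled mu2 beta q (v x) (u x)).
  { intros x Hx Hs; destruct (Hsol x Hx (proj2 (nrm_pos n x) Hs)) as [_ [_ [_ H]]]; unfold coupled; lra. }
  assert (GF : growth m (coupled mu1 beta q)) by (apply coupled_growth; try assumption; unfold m; lra).
  assert (GG : growth m (coupled mu2 beta q)) by (apply coupled_growth; try assumption; unfold m; lra).
  destruct (radial_profile n m Hm ltac:(unfold m; lra) _ _ GF GG u v D1u D1v D2u D2v HCu HCv Hpos Equ Eqv ltac:(lia))
    as [A [A1 [HuA HA]]].
  destruct (radial_profile n m Hm ltac:(unfold m; lra) _ _ GG GF v u D1v D1u D2v D2u HCv HCu Hpos' Eqv Equ ltac:(lia))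
    as [B [B1 [HvB HB]]].
  fold N in HA, HB.
  assert (Hax : forall t, pt n (ax (exp t)) /\ 0 < sq n (ax (exp t))).
  { intros t; split; [apply pt_ax; lia|rewrite sq_ax by lia; apply pow_lt, exp_pos]. }
  assert (EA : forall t, A t = u (ax (exp t))) by (intros t; apply HA).
  assert (EB : forall t, B t = v (ax (exp t))) by (intros t; apply HB).
  assert (PA : forall t, 0 < A t) by (intros t; rewrite EA; apply Hpos; apply Hax).
  assert (PB : forall t, 0 < B t) by (intros t; rewrite EB; apply Hpos; apply Hax).
  destruct (rescaled_equation N q mu1 beta A A1 B) as [X1 [[K1 HK1] [HX1 [DX [DX1 HXm]]]]]; try assumption; try lra.
  { intros t; apply HA. }
  { intros t; apply HA. }
  { intros t; rewrite EA, EB; apply HA. }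
  destruct (rescaled_equation N q mu2 beta B B1 A) as [Y1 [[K2 HK2] [HY1 [DY [DY1 HYm]]]]]; try assumption; try lra.
  { intros t; apply HB. }
  { intros t; apply HB. }
  { intros t; rewrite EA, EB; apply HB. }
  exists (Rmax K1 K2), (1 / q + exp N), (fun t => exp (1 / q * t) * A t), X1, (fun t => exp (1 / q * t) * B t), Y1.
  assert (Hrep : forall r a, 0 < r -> a = Rpower r (- (1 / q)) * (exp (1 / q * ln r) * a)).
  { intros r a Hr; unfold Rpower; rewrite <- Rmult_assoc, <- exp_plus.
    replace (- (1 / q) * ln r + 1 / q * ln r) with 0 by ring; rewrite exp_0; ring. }
  split; [apply Rplus_lt_0_compat; [apply Rdiv_lt_0_compat; lra|apply exp_pos]|].
  split; [intros t; split; [apply Rmult_lt_0_compat; [apply exp_pos|apply PA]|apply Rle_trans with (1 := HK1 t), Rmax_l]|].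
  split; [intros t; split; [apply Rmult_lt_0_compat; [apply exp_pos|apply PB]|apply Rle_trans with (1 := HK2 t), Rmax_r]|].
  do 8 (split; [assumption|]); split.
  - intros x Hx Hs; rewrite (HuA x Hx (proj1 (nrm_pos n x) Hs)); apply Hrep, Hs.
  - intros x Hx Hs; rewrite (HvB x Hx (proj1 (nrm_pos n x) Hs)); apply Hrep, Hs.
Qed.

(** Used both to exhibit the singular component of a semi-singular solution and to refute a finite
    limit. *)
Lemma lower_bound_blowup (n : nat) (de c T : R) (v : (nat -> R) -> R) (Y : R -> R) : 0 < de -> 0 < c ->
  (forall x, pt n x -> 0 < nrm n x -> v x = Rpower (nrm n x) (- de) * Y (ln (nrm n x))) ->
  (forall t, t <= T -> c <= Y t) -> lim0_inf n v.
Proof.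
  intros Hde Hc Hv HY M; destruct (Rpower_inv_large de (M / c) Hde) as [e [He H]].
  exists (Rmin e (exp T)); split; [apply Rmin_pos; [exact He|apply exp_pos]|]; intros x Hx [Hr1 Hr2].
  pose proof (Rmin_l e (exp T)); pose proof (Rmin_r e (exp T)).
  rewrite (Hv x Hx Hr1); set (r := nrm n x) in *.
  assert (HT : ln r <= T) by (rewrite <- (ln_exp T); left; apply ln_increasing; lra).
  specialize (HY _ HT); specialize (H r ltac:(lra)).
  replace (Rpower (1 / r) de) with (Rpower r (- de)) in H
    by (unfold Rpower; f_equal; unfold Rdiv; rewrite Rmult_1_l, ln_Rinv by exact Hr1; ring).
  assert (M < Rpower r (- de) * c) by (apply Rlt_div_l in H; lra).
  apply Rlt_le_trans with (1 := H2), Rmult_le_compat_l; [left; apply Rpower_pos|exact HY].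
Qed.

Lemma lim0_inf_not_fin (n : nat) (u : (nat -> R) -> R) (l : R) : (0 < n)%nat -> lim0_inf n u -> ~ lim0_fin n u l.
Proof.
  intros Hn Hi Hf; destruct (Hi (l + 1)) as [d1 [Hd1 H1]]; destruct (Hf 1 Rlt_0_1) as [d2 [Hd2 H2]].
  set (r := Rmin d1 d2 / 2).
  assert (Hr : 0 < Rmin d1 d2) by (apply Rmin_pos; assumption).
  pose proof (Rmin_l d1 d2); pose proof (Rmin_r d1 d2).
  assert (Hx : pt n (ax r)) by (apply pt_ax, Hn).
  assert (Hnx : nrm n (ax r) = r).
  { change (nrm n (ax r)) with (sqrt (sq n (ax r))); rewrite sq_ax by exact Hn; apply sqrt_pow2; unfold r; lra. }
  specialize (H1 (ax r) Hx ltac:(rewrite Hnx; unfold r; lra)).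
  specialize (H2 (ax r) Hx ltac:(rewrite Hnx; unfold r; lra)); apply Rabs_def2 in H2; lra.
Qed.

Section Profiles.

Context (n : nat) (q mu1 mu2 beta K L : R) (u v : (nat -> R) -> R) (X X1 Y Y1 : R -> R).
Context (Hn : (3 <= n)%nat) (Hmu1 : 0 < mu1) (Hmu2 : 0 < mu2) (Hbeta : 0 < beta) (HL : 0 < L).
Context (Hq : 0 < q) (Hq1 : 1 < q * (INR n - 2)) (Hq2 : q * (INR n - 2) < 2).
Context (HP : profile n q mu1 mu2 beta u v K L X X1 Y Y1).

Lemma dimension_pos : 1 <= INR n - 2.
Proof. apply le_INR in Hn; simpl in Hn; lra. Qed.

Lemma exponent_range : 1 / q < INR n - 2 /\ INR n - 2 < 2 * (1 / q).
Proof.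
  split; [apply Rlt_div_l; lra|].
  apply (Rmult_lt_reg_l q); [exact Hq|]; replace (q * (2 * (1 / q))) with 2 by (field; lra); exact Hq2.
Qed.

Lemma profile_nonvanishing : exists c, 0 < c /\ forall t, t <= 0 -> 2 * c ^ 2 <= X t ^ 2 + Y t ^ 2.
Proof.
  destruct HP as [H1 [H2 [H3 [H4 [H5 [H6 [H7 [H8 _]]]]]]]]; destruct exponent_range as [He1 He2].
  exact (nonvanishing (INR n - 2) q mu1 mu2 beta K L Hq Hmu1 Hmu2 Hbeta HL He1 He2 X X1 Y Y1 H1 H2 H3 H4 H5 H6 H7 H8).
Qed.

Lemma profile_lower_sublinear : q < 1 -> exists e, 0 < e /\ forall t, t <= 0 -> e <= X t.
Proof.
  intros Hlt; destruct profile_nonvanishing as [c [Hc Hnv]].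
  destruct HP as [H1 [H2 [H3 [H4 [H5 [H6 [H7 [H8 _]]]]]]]]; destruct exponent_range as [He1 He2].
  exact (lower_bound_sublinear (INR n - 2) q mu1 beta K L Hq Hmu1 Hbeta HL He1 He2 X X1 Y H1 H2 H3 H5 H7 c Hlt Hc Hnv).
Qed.

(** In the fast-decay branch of [dichotomy_superlinear], [u] is bounded while [Y >= c] makes [v]
    blow up, which is one of the two forms of semi-singularity. *)
Lemma profile_lower_superlinear : 1 < q ->
  (exists e, 0 < e /\ forall t, t <= 0 -> e <= X t) \/ ((exists l, lim0_fin n u l) /\ lim0_inf n v).
Proof.
  intros Hlt; destruct profile_nonvanishing as [c [Hc Hnv]].
  destruct HP as [H1 [H2 [H3 [H4 [H5 [H6 [H7 [H8 [H9 [_ [Hu Hv]]]]]]]]]]]; destruct exponent_range as [He1 He2].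
  assert (HN : 0 < INR n - 2) by (pose proof dimension_pos; lra).
  destruct (dichotomy_superlinear (INR n - 2) q mu1 mu2 beta K L HN Hq Hmu1 Hmu2 Hbeta HL He1 He2 X X1 Y Y1
    H1 H2 H3 H4 H5 H6 H7 H8 c Hlt H9 Hc Hnv) as [[e [T [He [HT Hlow]]]]|[M [T [HT Hfast]]]].
  - left; exact (lower_bound_extend K L HL X X1 H1 H3 H5 e T HT He Hlow).
  - right; assert (Hq' : 0 < 1 / q) by (apply Rdiv_lt_0_compat; lra); split.
    (* [A] is [u] as a function of [ln r]; nonincreasing and bounded, it tends to its supremum at
       [-oo]. *)
    + set (A := fun t => exp (- (1 / q) * t) * X t).
      assert (Hdecr : forall s t, s <= t -> A t <= A s).
      { intros s t Hst; apply Ropp_le_cancel.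
        apply (incr_of_derive (fun t => - A t) (fun t => - (- (1 / q) * exp (- (1 / q) * t) * X t + exp (- (1 / q) * t) * X1 t)) s t Hst).
        - intros r _; apply (is_derive_opp A).
          apply (is_derive_mulR (fun t => exp (- (1 / q) * t)) X r _ _ (is_derive_exp_lin (- (1 / q)) r) (H5 r)).
        - intros r _; specialize (H9 r); pose proof (exp_pos (- (1 / q) * r)).
          assert (0 <= exp (- (1 / q) * r) * (1 / q * X r - X1 r)) by (apply Rmult_le_pos; lra); lra. }
      assert (HAM : forall t, A t <= M).
      { assert (Hle : forall t, t <= T -> A t <= M).
        { intros t Ht; destruct (Hfast t Ht) as [Hx _]; unfold A.
          apply (Rmult_le_compat_l (exp (- (1 / q) * t))) in Hx; [|left; apply exp_pos].
          replace (exp (- (1 / q) * t) * (M * exp (1 / q * t))) with (M * (exp (- (1 / q) * t) * exp (1 / q * t))) in Hx by ring.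
          rewrite <- exp_plus in Hx; replace (- (1 / q) * t + 1 / q * t) with 0 in Hx by ring; rewrite exp_0 in Hx; lra. }
        intros t; destruct (Rle_lt_dec t T) as [Ht|Ht]; [apply Hle, Ht|].
        apply Rle_trans with (A T); [apply Hdecr; lra|apply Hle; lra]. }
      destruct (completeness (fun r => exists t, r = A t)) as [l [Hl1 Hl2]].
      { exists M; intros r [t ->]; apply HAM. }
      { exists (A 0), 0; reflexivity. }
      exists l; intros eps Heps.
      assert (Hex : exists t, l - eps < A t).
      { apply NNPP; intros Hno; assert (l <= l - eps); [|lra]; apply Hl2; intros r [t ->].
        destruct (Rle_lt_dec (A t) (l - eps)) as [H|H]; [exact H|exfalso; apply Hno; exists t; exact H]. }
      destruct Hex as [t0 Ht0]; exists (exp t0); split; [apply exp_pos|]; intros x Hx [Hr1 Hr2].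
      rewrite (Hu x Hx Hr1); change (Rpower (nrm n x) (- (1 / q)) * X (ln (nrm n x))) with (A (ln (nrm n x))).
      assert (Hln : ln (nrm n x) <= t0) by (rewrite <- (ln_exp t0); left; apply ln_increasing; assumption).
      pose proof (Hdecr _ _ Hln); specialize (Hl1 _ (ex_intro _ (ln (nrm n x)) eq_refl)); apply Rabs_def1; lra.
    + apply (lower_bound_blowup n (1 / q) c T v Y Hq' Hc Hv); intros t Ht; apply Hfast, Ht.
Qed.

Lemma profile_bounds (e : R) (y : nat -> R) : (forall t, t <= 0 -> e <= X t) -> pt n y -> 0 < nrm n y < 1 ->
  e * Rpower (nrm n y) (- (1 / q)) <= u y <= K * Rpower (nrm n y) (- (1 / q)).
Proof.
  intros He Hy Hr; destruct HP as [H1 [_ [_ [_ [_ [_ [_ [_ [_ [_ [Hu _]]]]]]]]]]].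
  rewrite (Hu y Hy (proj1 Hr)), (Rmult_comm (Rpower _ _)).
  assert (Hln : ln (nrm n y) <= 0) by (rewrite <- ln_1; left; apply ln_increasing; lra).
  split; apply Rmult_le_compat_r; try (left; apply Rpower_pos); [apply He, Hln|apply H1].
Qed.

End Profiles.

Theorem theorem1p2 (n : nat) (mu1 mu2 beta p : R)
  (hn : (3 <= n)%nat) (hmu1 : 0 < mu1) (hmu2 : 0 < mu2) (hbeta : 0 < beta)
  (hp1 : INR n / (INR n - 2) < p) (hp2 : p < (INR n + 2) / (INR n - 2)) :
  let q := (p - 1) / 2 in
  ((4 <= n)%nat ->
     forall u v, pos_sol n mu1 mu2 beta q u v -> ~ semi_singular n u v) /\
  (((4 <= n)%nat \/
    (n = 3%nat /\ forall u v, pos_sol n mu1 mu2 beta q u v -> ~ semi_singular n u v)) ->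
   forall u v, pos_sol n mu1 mu2 beta q u v ->
   exists C1 C2, 0 < C1 /\ C1 <= C2 /\
     forall x, pt n x -> 0 < nrm n x < 1 ->
       C1 * Rpower (nrm n x) (- (2 / (p - 1))) <= u x /\
       u x <= C2 * Rpower (nrm n x) (- (2 / (p - 1))) /\
       C1 * Rpower (nrm n x) (- (2 / (p - 1))) <= v x /\
       v x <= C2 * Rpower (nrm n x) (- (2 / (p - 1)))).
Proof.
  intros q.
  assert (HN : 1 <= INR n - 2) by (apply (dimension_pos n hn)).
  assert (Hp : p = 2 * q + 1) by (unfold q; field).
  apply Rlt_div_l in hp1; [|lra]; apply Rlt_div_r in hp2; [|lra]; rewrite Hp in hp1, hp2.
  assert (Hq1 : 1 < q * (INR n - 2)) by lra.
  assert (Hq2 : q * (INR n - 2) < 2) by lra.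
  assert (Hq : 0 < q) by nra.
  assert (Hexp : 2 / (p - 1) = 1 / q) by (rewrite Hp; field; lra).
  assert (Hsub : (4 <= n)%nat -> q < 1) by (intros H; apply le_INR in H; simpl in H; nra).
  split.
  - intros Hn4 u v Hsol.
    destruct (pos_sol_profile n mu1 mu2 beta q u v) as [K [L [X [X1 [Y [Y1 [HL HP]]]]]]]; try assumption.
    assert (HP' := profile_sym _ _ _ _ _ _ _ _ _ _ _ _ _ HP).
    destruct (profile_lower_sublinear n q mu1 mu2 beta K L u v X X1 Y Y1) as [e1 [He1 H1]]; auto.
    destruct (profile_lower_sublinear n q mu2 mu1 beta K L v u Y Y1 X X1) as [e2 [He2 H2]]; auto.
    assert (Hq' : 0 < 1 / q) by (apply Rdiv_lt_0_compat; lra).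
    (* Since [X] and [Y] are both bounded below, both components blow up, and neither has a finite
       limit. *)
    intros [[[l Hl] _]|[_ [l Hl]]].
    + apply (lim0_inf_not_fin n u l ltac:(lia)) in Hl; [exact Hl|].
      apply (lower_bound_blowup n (1 / q) e1 0 u X Hq' He1); [apply HP|exact H1].
    + apply (lim0_inf_not_fin n v l ltac:(lia)) in Hl; [exact Hl|].
      apply (lower_bound_blowup n (1 / q) e2 0 v Y Hq' He2); [apply HP|exact H2].
  - intros Hcase u v Hsol.
    destruct (pos_sol_profile n mu1 mu2 beta q u v) as [K [L [X [X1 [Y [Y1 [HL HP]]]]]]]; try assumption.
    assert (HP' := profile_sym _ _ _ _ _ _ _ _ _ _ _ _ _ HP).
    assert (Hlow : (exists e, 0 < e /\ forall t, t <= 0 -> e <= X t) /\ (exists e, 0 < e /\ forall t, t <= 0 -> e <= Y t)).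
    { destruct Hcase as [Hn4|[E3 Hns]].
      - split; [apply (profile_lower_sublinear n q mu1 mu2 beta K L u v X X1 Y Y1)|
          apply (profile_lower_sublinear n q mu2 mu1 beta K L v u Y Y1 X X1)]; auto.
      - assert (Hsup : 1 < q) by (rewrite E3 in Hq1; simpl in Hq1; lra).
        specialize (Hns u v Hsol); split.
        + destruct (profile_lower_superlinear n q mu1 mu2 beta K L u v X X1 Y Y1) as [H|H]; auto.
          exfalso; apply Hns; left; exact H.
        + destruct (profile_lower_superlinear n q mu2 mu1 beta K L v u Y Y1 X X1) as [H|H]; auto.
          exfalso; apply Hns; right; tauto. }
    destruct Hlow as [[e1 [He1 H1]] [e2 [He2 H2]]].
    exists (Rmin e1 e2), K; split; [apply Rmin_pos; assumption|split].
    + apply Rle_trans with (1 := Rmin_l e1 e2), Rle_trans with (1 := H1 0 (Rle_refl 0)); apply HP.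
    + intros x Hx Hr; rewrite Hexp.
      assert (B1 := profile_bounds n q mu1 mu2 beta K L u v X X1 Y Y1 HP (Rmin e1 e2) x
        ltac:(intros t Ht; apply Rle_trans with (1 := Rmin_l e1 e2), H1, Ht) Hx Hr).
      assert (B2 := profile_bounds n q mu2 mu1 beta K L v u Y Y1 X X1 HP' (Rmin e1 e2) x
        ltac:(intros t Ht; apply Rle_trans with (1 := Rmin_r e1 e2), H2, Ht) Hx Hr).
      tauto.
Qed.
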